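(* Let $W=(W_t)_{t\ge 0}$ be a one-dimensional Brownian motion. For any $\alpha\in(1/2,1]$ there exists a family of random variables $\widetilde L^f_t$, indexed by $f\in\mathcal S_\alpha$ and $t\in[0,1]$ and defined on the probability space of $W$, such that: (i) for each $f\in\mathcal S_\alpha$, almost surely, $\widetilde L^f_t=L^f_t$ for all $t\in[0,1]$; (ii) with probability one, the map $f\mapsto \widetilde L^f_1$ is continuous on $\mathcal S_\alpha$ with respect to the supremum norm; and (iii) with probability one, $\sup_{f\in\mathcal S_\alpha}\widetilde L^f_1<\infty$.
   Context: For $\alpha\in(0,1]$, $\mathcal S_\alpha$ denotes the set of functions $f:[0,1]\to\mathbb R$ such that $\sup_{0\le t\le 1}|f(t)|\le 1$ and $|f(s)-f(t)|\le |s-t|^\alpha$ for all $s,t\in[0,1]$. For a Hölder continuous $f:[0,1]\to\mathbb R$, $L^f_t$ ($t\in[0,1]$) denotes the local time of $W$ along the curve $f$, defined as the limit in probability, as $\varepsilon\to 0^+$, of $$\frac{1}{2\varepsilon}\int_0^t \mathbf 1_{(f(s)-\varepsilon,\,f(s)+\varepsilon)}(W_s)\,ds.$$ For each fixed $f$, the process $t\mapsto L^f_t$ is taken in its version with continuous paths. *)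

(* Defs.v *)
From HB Require Import structures.
From mathcomp Require Import all_boot all_order all_algebra.
From mathcomp Require Import all_classical all_reals all_analysis.
Set Implicit Arguments.
Unset Strict Implicit.
Unset Printing Implicit Defensive.
Import Order.TTheory GRing.Theory Num.Theory.
Import numFieldNormedType.Exports.
Local Open Scope classical_set_scope.
Local Open Scope ring_scope.

Section BrownianMotion.
Context {R : realType} {d : measure_display} {T : measurableType d}.
Variable P : probability T R.

(* Since the [B i] may be [setT], the product rule for the whole family
   contains the one for every subfamily. *)
Definition mutually_independent (n : nat) (X : 'I_n -> T -> R) : Prop :=
  forall B : 'I_n -> set R, (forall i, measurable (B i)) ->
  P (\bigcap_(i in [set: 'I_n]) (X i @^-1` B i)) =
  (\prod_(i < n) P (X i @^-1` B i))%E.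

(* Time is indexed by all of R; only the times t >= 0 matter. The second
   parameter of [normal_prob] is the standard deviation. *)
Record brownian_motion (W : R -> {RV P >-> R}) : Prop := BrownianMotion {
  bm_start : {ae P, forall w, W 0 w = 0} ;
  bm_independent_increments : forall (n : nat) (t : nat -> R),
    0 <= t 0%N -> (forall i, t i <= t i.+1) ->
    mutually_independent (fun (i : 'I_n) w => W (t i.+1) w - W (t i) w) ;
  bm_normal_increments : forall (s t : R), 0 <= s -> s < t ->
    forall B : set R, measurable B ->
    P [set w | B (W t w - W s w)] = normal_prob 0 (Num.sqrt (t - s)) B ;
  bm_continuous_paths :
    forall w, {within `[0, +oo[, continuous (fun t => W t w)} }.

Definition cvg_in_probability (I : Type) (F : set_system I)
    (X : I -> T -> R) (Y : T -> R) : Prop :=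
  forall eta : R, 0 < eta ->
    P [set w | eta < `|X i w - Y w|] @[i --> F] --> 0%E.

Definition occupation_density (W : R -> T -> R) (f : R -> R) (t eps : R)
    (w : T) : R :=
  (2 * eps)^-1 * \int[lebesgue_measure]_(s in `[0, t])
    \1_(`]f s - eps, f s + eps[ : set R) (W s w).

(* [L] is a version with continuous paths of the local time of [W] along the
   curve [f]; two such versions are indistinguishable on [0, 1]. *)
Definition is_local_time (W : R -> {RV P >-> R}) (f : R -> R)
    (L : R -> {RV P >-> R}) : Prop :=
  (forall t, t \in `[0, 1] ->
     cvg_in_probability 0^'+ (occupation_density W f t) (L t)) /\
  (forall w, {within `[0, 1], continuous (fun t => L t w)}).

End BrownianMotion.

(* A function on [0, 1] is represented by any of its extensions to R. The
   topology of {uniform` `[0, 1] -> R} is that of the supremum norm on [0, 1],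
   and does not see the values outside [0, 1]. *)
Definition holder_class {R : realType} (alpha : R) :
    set {uniform` (`[0, 1] : set R) -> R} :=
  [set f | (forall t, t \in `[0, 1] -> `|f t| <= 1) /\
           (forall s t, s \in `[0, 1] -> t \in `[0, 1] ->
              `|f s - f t| <= `|s - t| `^ alpha)].

(* Main.v *)
Require Import Defs.
From HB Require Import structures.
From mathcomp Require Import all_boot all_order all_algebra.
From mathcomp Require Import all_classical all_reals all_analysis.
From mathcomp Require Import measurable_realfun ring lra zify.
Set Implicit Arguments.
Unset Strict Implicit.
Unset Printing Implicit Defensive.
Import Order.TTheory GRing.Theory Num.Theory.
Import numFieldNormedType.Exports.
Local Open Scope classical_set_scope.
Local Open Scope ring_scope.

(** Why the theorem holds.

    Let [curve_density w f r t] be the time that the path [w] spends before [t]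
    within distance [r] of the curve [f], divided by [2 * r].  Almost surely, these
    densities converge as [r] tends to [0], uniformly in [t] and in the curve [f].
    The difficulty is that the curves are uncountably many; the solution is to
    observe the path only through countably many quantities in which no curve
    appears.

    At level [n], cut time into [2 ^ n] blocks of length [h = 2 ^- n], and space,
    around the position of the path at the beginning of each block, into cells of
    width [l = h `^ al].  Over a block a curve of the Hölder class moves by at most
    one cell.  So the time that the path spends near the curve during the block is
    about the number of cells in the tube multiplied by the time spent in one of
    them, provided that the times spent in neighbouring cells are close to each
    other.  This is where [al > 1 / 2] enters: the path moves by about [sqrt h] over
    the block, which is many cells, and its local time is regular in space.  A level
    is good ([good_level]) if over each block the increment of the path, the time
    spent in each cell and the differences between neighbouring cells are as small
    as they should be, up to powers of a quantity [x] that decays geometrically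
    with [n].

    If all levels from some level on are good, the rest is deterministic.  For radii
    of the scale of level [n], the densities at two radii differ by at most a
    multiple of [x ^+ 2] times [1] plus the density at a larger radius
    ([curve_density_cmp]): errors only come from the blocks during which the path
    visits the tube, and during these it stays in the tube of the larger radius.
    As [x] is geometric, induction on the levels bounds all densities
    ([density_bounded]) and then makes them Cauchy at a rate that depends neither on
    the curve nor on the time ([density_cauchy]).  The limit is thus bounded over
    the class, and continuous in time since each density is Lipschitz in time.  It
    is continuous in the curve since the tube of radius [r] around [f] is contained
    in the tube of radius [r + de] around any curve at distance [de] from [f].

    It remains to see that almost every path has only finitely many bad levels.  The
    tail bounds come from a single inequality ([feynman_kac]): if [X] is the
    increment of the motion from time [a] on, then
    [E expR (F (X b) - F 0 - \int_a^b (F'' + F' ^+ 2) (X t) / 2 dt) <= 1].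
    This is Itô's formula for [expR F], and it follows from independence and from
    the exponential moments of Gaussian steps by approximating the motion by random
    walks.  If [F''] is a difference of two tent functions, the exponent contains
    the difference of the times spent in two places.  This yields
    [tent_time_tail] and [tent_time_diff_tail], by which a given cell is bad with a
    probability that is at most a multiple of [expR (- (2 * x)^-1)].  The pairs of a
    block and a cell at level [n] number at most a multiple of [8 ^ n], so the
    probabilities of the bad levels are summable ([bad_level_summable]).

    Finally, uniform convergence off events of small probability implies
    convergence in probability, so the limit is the local time along each curve.
    Limits in probability are almost surely unique at each rational time, and
    continuity extends this to all times ([local_time_unique]). *)


(** * Integrals of bounded functions over segments *)

Section IntegralToolbox.
Context {R : realType}.
Notation mu := (@lebesgue_measure R).
Implicit Types (f g : R -> R) (a b c : R).

Definition itg a b f : R := \int[mu]_(s in `[a, b]) f s.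

(** Continuity would not do: indicators of tubes around a curve are integrated. *)
Definition bounded_measurable a b f : Prop :=
  measurable_fun `[a, b] f /\ exists M, forall s, a <= s <= b -> `|f s| <= M.

Lemma bounded_measurableS a b c d f : a <= c -> d <= b ->
  bounded_measurable a b f -> bounded_measurable c d f.
Proof.
move=> ac db [mf [M fM]]; split; last first.
  exists M => s /andP[cs sd]; apply: fM.
  by rewrite (le_trans ac cs) (le_trans sd db).
apply: measurable_funS mf => // s /=.
by rewrite !in_itv/= => /andP[cs sd]; rewrite (le_trans ac cs) (le_trans sd db).
Qed.

Lemma bounded_measurable_integrable a b f :
  bounded_measurable a b f -> mu.-integrable `[a, b] (EFin \o f).
Proof.
move=> [mf [M fM]]; apply: measurable_bounded_integrable => //.
  by rewrite /= lebesgue_measure_itv/=; case: ifP => _; rewrite ltry.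
exists M; split; first exact: num_real.
move=> x Mx s /=; rewrite in_itv/= => sab; exact: le_trans (fM _ sab) (ltW Mx).
Qed.

Lemma bounded_measurable_cst a b (k : R) : bounded_measurable a b (fun=> k).
Proof. by split => //; exists `|k|. Qed.

Lemma bounded_measurableD a b f g : bounded_measurable a b f ->
  bounded_measurable a b g -> bounded_measurable a b (fun s => f s + g s).
Proof.
move=> [mf [M fM]] [mg [N gN]]; split; first exact: measurable_funD.
by exists (M + N) => s sab; apply: le_trans (ler_normD _ _) _; rewrite lerD ?fM ?gN.
Qed.

Lemma bounded_measurableM a b f g : bounded_measurable a b f ->
  bounded_measurable a b g -> bounded_measurable a b (fun s => f s * g s).
Proof.
move=> [mf [M fM]] [mg [N gN]]; split; first exact: measurable_funM.
by exists (M * N) => s sab; rewrite normrM ler_pM ?fM ?gN.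
Qed.

Lemma bounded_measurableZ a b (k : R) f : bounded_measurable a b f ->
  bounded_measurable a b (fun s => k * f s).
Proof. by move=> bf; apply: bounded_measurableM => //; exact: bounded_measurable_cst. Qed.

Lemma bounded_measurableB a b f g : bounded_measurable a b f ->
  bounded_measurable a b g -> bounded_measurable a b (fun s => f s - g s).
Proof.
move=> bf bg; have := bounded_measurableD bf (bounded_measurableZ (-1) bg).
by under eq_fun do rewrite mulN1r.
Qed.

Lemma bounded_measurable_sum a b (I : Type) (r : seq I) (F : I -> R -> R) :
  (forall i, bounded_measurable a b (F i)) ->
  bounded_measurable a b (fun s => \sum_(i <- r) F i s).
Proof.
move=> bF; elim: r => [|i r IH].
  by under eq_fun do rewrite big_nil; exact: bounded_measurable_cst.
by under eq_fun do rewrite big_cons; exact: bounded_measurableD.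
Qed.

Lemma eq_itg a b f g : (forall s, a <= s <= b -> f s = g s) ->
  itg a b f = itg a b g.
Proof. by move=> fg; apply: eq_Rintegral => s; rewrite inE/= in_itv/=; exact: fg. Qed.

Lemma itg_cst a b (k : R) : a <= b -> itg a b (fun=> k) = k * (b - a).
Proof.
move=> ab; rewrite /itg Rintegral_cst//= lebesgue_measure_itv/= lte_fin.
by move: ab; rewrite le_eqVlt => /predU1P[->|->//]; rewrite ltxx subrr.
Qed.

Lemma itgZ a b (k : R) f : bounded_measurable a b f ->
  itg a b (fun s => k * f s) = k * itg a b f.
Proof. by move=> bf; apply: RintegralZl => //; exact: bounded_measurable_integrable. Qed.

Lemma itgD a b f g : bounded_measurable a b f -> bounded_measurable a b g ->
  itg a b (fun s => f s + g s) = itg a b f + itg a b g.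
Proof. by move=> bf bg; apply: RintegralD => //; exact: bounded_measurable_integrable. Qed.

Lemma itgB a b f g : bounded_measurable a b f -> bounded_measurable a b g ->
  itg a b (fun s => f s - g s) = itg a b f - itg a b g.
Proof. by move=> bf bg; apply: RintegralB => //; exact: bounded_measurable_integrable. Qed.

Lemma itg_sum a b (I : Type) (r : seq I) (F : I -> R -> R) : a <= b ->
  (forall i, bounded_measurable a b (F i)) ->
  itg a b (fun s => \sum_(i <- r) F i s) = \sum_(i <- r) itg a b (F i).
Proof.
move=> ab bF; elim: r => [|i r IH].
  rewrite big_nil -[RHS](mul0r (b - a)) -itg_cst//.
  by apply: eq_itg => s _; rewrite big_nil.
rewrite big_cons -IH -itgD//; last exact: bounded_measurable_sum.
by apply: eq_itg => s _; rewrite big_cons.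
Qed.

Lemma le_itg a b f g : bounded_measurable a b f -> bounded_measurable a b g ->
  (forall s, a <= s <= b -> f s <= g s) -> itg a b f <= itg a b g.
Proof.
move=> bf bg fg; apply: le_Rintegral => //.
- exact: bounded_measurable_integrable.
- exact: bounded_measurable_integrable.
Qed.

Lemma itg_ge0 a b f : (forall s, a <= s <= b -> 0 <= f s) -> 0 <= itg a b f.
Proof. by move=> f0; apply: Rintegral_ge0 => s /=; rewrite in_itv/=; exact: f0. Qed.

Lemma itg_point a f : itg a a f = 0.
Proof. by rewrite /itg set_itv1 Rintegral_set1. Qed.

Lemma itg_split a b c f : a <= b -> b <= c -> bounded_measurable a c f ->
  itg a c f = itg a b f + itg b c f.
Proof.
move=> ab bc bf; rewrite /itg.
have intf := bounded_measurable_integrable bf.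
have := @Rintegral_itvB R f (BLeft a) (BRight c) b intf.
rewrite !bnd_simp => /(_ ab bc) E; apply/eqP; rewrite addrC -subr_eq; apply/eqP.
rewrite E Rintegral_itv_obnd_cbnd//.
by apply: integrableS intf => //=; apply: subset_itvr; rewrite bnd_simp.
Qed.

Lemma itg_bound a b f (k : R) : a <= b -> bounded_measurable a b f ->
  (forall s, a <= s <= b -> `|f s| <= k) -> `|itg a b f| <= k * (b - a).
Proof.
move=> ab bf fk; rewrite ler_norml -mulNr -!itg_cst//; apply/andP; split.
  apply: le_itg => //; first exact: bounded_measurable_cst.
  by move=> s /fk; rewrite ler_norml => /andP[].
apply: le_itg => //; first exact: bounded_measurable_cst.
by move=> s /fk; rewrite ler_norml => /andP[].
Qed.

Lemma le_itg_itv a b c f : a <= b -> b <= c -> bounded_measurable a c f ->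
  (forall s, a <= s <= c -> 0 <= f s) -> itg a b f <= itg a c f.
Proof.
move=> ab bc bf f0; rewrite (itg_split ab bc bf) lerDl.
by apply: itg_ge0 => s /andP[bs sc]; rewrite f0// (le_trans ab bs).
Qed.

Lemma itg_split_sum a (de : R) (N : nat) f : 0 <= de ->
  bounded_measurable a (a + N%:R * de) f ->
  itg a (a + N%:R * de) f =
  \sum_(i < N) itg (a + i%:R * de) (a + i.+1%:R * de) f.
Proof.
move=> de0; elim: N => [|N IH] bf.
  by rewrite big_ord0 mul0r addr0 itg_point.
have lN : a <= a + N%:R * de by rewrite lerDl mulr_ge0.
have lN1 : a + N%:R * de <= a + N.+1%:R * de.
  by rewrite lerD2l ler_wpM2r// ler_nat.
rewrite big_ord_recr/= -IH; first exact: itg_split.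
exact: bounded_measurableS bf.
Qed.

Lemma within_continuous_epsP (A : set R) f : {within A, continuous f} <->
  (forall x, A x -> forall e, 0 < e -> exists2 d, 0 < d &
     forall y, A y -> `|x - y| < d -> `|f x - f y| < e).
Proof.
split=> [/subspace_continuousP cf x Ax e e0|cf].
  have /cvgrPdist_lt/(_ e e0) := cf x Ax.
  rewrite near_withinE near_nbhs => /nbhs_ballP[d/= d0 dP].
  by exists d => // y Ay xy; exact: dP.
apply/subspace_continuousP => x Ax; apply/cvgrPdist_lt => e e0.
have [d d0 dP] := cf x Ax e e0; rewrite near_withinE near_nbhs.
apply/nbhs_ballP; exists d => //= y xy Ay; exact: dP.
Qed.

(** Heine's theorem: the segment is compact, and the property that is propagated
    holds near each point for all small radii. *)
Lemma within_continuous_unif a b f : {within `[a, b], continuous f} ->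
  forall e, 0 < e -> exists2 d, 0 < d &
    forall x y, a <= x <= b -> a <= y <= b -> `|x - y| < d -> `|f x - f y| < e.
Proof.
move=> /within_continuous_epsP cf e e0.
have := @segment_compact R a b; rewrite compact_near_coveringP => /(_ R (0^'+)
  (fun d x => a <= x <= b -> forall y, a <= y <= b -> `|x - y| < d -> `|f x - f y| < e)).
case.
- move=> x xab; have [|d d0 dP] := cf x xab (e / 2); first by rewrite divr_gt0.
  exists (ball x (d / 2), [set r | r < d / 2]) => /=.
    split; first by apply: nbhsx_ballx; rewrite divr_gt0.
    apply: nbhs_right_lt; by rewrite divr_gt0.
  move=> [x' r]/= [xx' rd] x'ab y yab x'y.
  have hx' : `|x - x'| < d.
    by apply: lt_le_trans xx' _; rewrite ler_pdivrMr// ler_peMr ?ler1n// ltW.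
  have hy : `|x - y| < d.
    rewrite (splitr d); apply: le_lt_trans (ler_distD x' _ _) _; apply: ltrD => //.
    exact: lt_trans rd.
  rewrite (splitr e); apply: le_lt_trans (ler_distD (f x) _ _) _; apply: ltrD.
    by rewrite distrC; apply: dP; rewrite /= ?in_itv/= ?x'ab ?yab.
  by apply: dP; rewrite /= ?in_itv/= ?yab.
- move=> d /= d0 dP; exists (d / 2); first by rewrite divr_gt0.
  move=> x y xab yab xy.
  have hd2 : d / 2 < d by rewrite ltr_pdivrMr// ltr_pMr// ltr1n.
  apply: (dP (d / 2)) => //=.
    by rewrite sub0r normrN gtr0_norm// divr_gt0.
  by rewrite divr_gt0.
Qed.

Lemma continuous_bounded_measurable a b f :
  {within `[a, b], continuous f} -> bounded_measurable a b f.
Proof.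
move=> cf; split.
  exact: (@subspace_continuous_measurable_fun R `[a, b] f).
have /compact_bounded[M [_ mrt]] :=
  continuous_compact cf (@segment_compact R a b).
exists (M + 1) => s sab; apply: mrt; first by rewrite ltrDl.
by exists s.
Qed.

(** Only left endpoints are sampled: the sums are those met by a random walk
    observed before each of its steps. *)
Lemma riemann_sum_cvg a b f : a <= b -> {within `[a, b], continuous f} ->
  ((b - a) / N.+1%:R * \sum_(i < N.+1) f (a + i%:R * ((b - a) / N.+1%:R)))
    @[N --> \oo] --> itg a b f.
Proof.
move=> ab cf; apply/cvgrPdist_le => e e0.
pose e' := e / (b - a + 1).
have ba0 : 0 < b - a + 1 by rewrite ltr_wpDl// subr_ge0.
have e'0 : 0 < e' by rewrite divr_gt0.
have [d d0 dP] := within_continuous_unif cf e'0.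
near=> N.
set de := (b - a) / N.+1%:R.
have de0 : 0 <= de by rewrite divr_ge0// subr_ge0.
have ded : de < d.
  rewrite ltr_pdivrMr// -ltr_pdivrMl// mulrC.
  apply: lt_trans (_ : N%:R < _); last by rewrite ltr_nat.
  by near: N; exact: nbhs_infty_gtr.
have bE : b = a + N.+1%:R * de by rewrite mulrC divfK// addrC subrK.
have bf := continuous_bounded_measurable cf.
rewrite {1}bE itg_split_sum -?bE//.
rewrite mulr_sumr -sumrB; apply: le_trans (ler_norm_sum _ _ _) _.
have -> : e = \sum_(i < N.+1) (e / N.+1%:R).
  by rewrite sumr_const card_ord -[RHS]mulr_natr divfK.
apply: ler_sum => i _.
have iN : a + i.+1%:R * de <= b by rewrite [leRHS]bE lerD2l ler_wpM2r// ler_nat.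
have i0 : a <= a + i%:R * de by rewrite lerDl mulr_ge0.
have ii : a + i%:R * de <= a + i.+1%:R * de by rewrite lerD2l ler_wpM2r// ler_nat.
have L : a + i.+1%:R * de - (a + i%:R * de) = de.
  by rewrite -natr1; ring.
have bfi := bounded_measurableS i0 iN bf.
set ti := a + i%:R * de.
have -> : de * f ti = itg ti (a + i.+1%:R * de) (fun=> f ti).
  by rewrite itg_cst// L mulrC.
rewrite -itgB//; last exact: bounded_measurable_cst.
apply: le_trans (itg_bound (k := e') _ _ _) _ => //.
- by apply: bounded_measurableB => //; exact: bounded_measurable_cst.
- move=> s /andP[s1 s2]; apply/ltW/dP.
  + by rewrite (le_trans i0)//= (le_trans s2).
  + by rewrite i0/= (le_trans ii).
  + apply: le_lt_trans ded; rewrite ger0_norm ?subr_ge0// -L lerB//.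
rewrite L /e' /de mulrA ler_wpM2r ?invr_ge0//.
by rewrite mulrAC ler_pdivrMr// ler_pM2l// lerDl.
Unshelve. all: by end_near.
Qed.

End IntegralToolbox.

(** * Exponential inequalities and Gaussian exponential moments *)

Section ExponentialInequalities.
Context {R : realType}.
Implicit Types x y z : R.

Lemma derive_ge0_ge0 (g g' : R -> R) : (forall x, is_derive x 1 g (g' x)) ->
  (forall x, 0 <= x -> 0 <= g' x) -> 0 <= g 0 -> forall x, 0 <= x -> 0 <= g x.
Proof.
move=> dg g'0 g0 x; rewrite le_eqVlt => /predU1P[<-//|x0].
have cg : {within `[0, x], continuous g}.
  by apply: derivable_within_continuous => y _; case: (dg y).
have [c cx E] := @MVT R g g' 0 x x0 (fun y _ => dg y) cg.
have : 0 <= g' c * (x - 0).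
    by rewrite mulr_ge0 ?subr_ge0 ?(ltW x0)// g'0//; move: cx; rewrite in_itv/= => /andP[/ltW].
  rewrite -E subr_ge0; exact: le_trans.
Qed.

Lemma expR_sub1_le x : expR x - 1 <= x * expR x.
Proof.
have := expR_ge1Dx (- x); rewrite expRN -(ler_pM2r (expR_gt0 x)) mulVf ?gt_eqF ?expR_gt0//.
lra.
Qed.

Lemma expR_taylor2_pos y : 0 <= y ->
  0 <= expR y - 1 - y - y ^+ 2 / 2 <= y ^+ 3 * expR y.
Proof.
have e x := @is_derive_expR R x.
have A : forall x, 0 <= x -> 0 <= x ^+ 2 * expR x - (expR x - 1 - x).
  apply: (@derive_ge0_ge0 _ (fun x => (2 * x + x ^+ 2) * expR x - (expR x - 1))).
  - by move=> x; apply: is_derive_eq; rewrite /GRing.scale/=; ring.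
  - move=> x x0; have := expR_sub1_le x; have := expR_gt0 x; nra.
  - by rewrite expR0; lra.
move=> y0; apply/andP; split.
  apply: (@derive_ge0_ge0 (fun y => expR y - 1 - y - y ^+ 2 / 2) (fun x => expR x - 1 - x)) y0.
  - by move=> x; apply: is_derive_eq; rewrite /GRing.scale/=; field.
  - by move=> x x0; have := expR_ge1Dx x; lra.
  - by rewrite expR0; lra.
rewrite -subr_ge0.
apply: (@derive_ge0_ge0 (fun y => y ^+ 3 * expR y - (expR y - 1 - y - y ^+ 2 / 2))
  (fun y => 3 * y ^+ 2 * expR y + y ^+ 3 * expR y - (expR y - 1 - y))) y0.
- by move=> x; apply: is_derive_eq; rewrite /GRing.scale/=; field.
- move=> x x0; have := A _ x0; have := expR_gt0 x; have : 0 <= x ^+ 3 by apply: exprn_ge0.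
  nra.
- by rewrite expR0; lra.
Qed.

Lemma expR_taylor2_neg y : 0 <= y ->
  - y ^+ 3 <= expR (- y) - 1 + y - y ^+ 2 / 2 <= 0.
Proof.
have B : forall x, 0 <= x -> 0 <= 1 - x + x ^+ 2 / 2 - expR (- x).
  apply: (@derive_ge0_ge0 _ (fun x => expR (- x) - 1 + x)).
  - by move=> x; apply: is_derive_eq; rewrite /GRing.scale/=; field.
  - by move=> x x0; have := expR_ge1Dx (- x); lra.
  - by rewrite oppr0 expR0; lra.
move=> y0; apply/andP; split; last by have := B _ y0; lra.
rewrite -subr_ge0.
apply: (@derive_ge0_ge0 (fun y => expR (- y) - 1 + y - y ^+ 2 / 2 - - y ^+ 3)
  (fun x => - expR (- x) + 1 - x + 3 * x ^+ 2)) y0.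
- by move=> x; apply: is_derive_eq; rewrite /GRing.scale/=; field.
- by move=> x x0; have := B _ x0; nra.
- by rewrite oppr0 expR0; lra.
Qed.

(** The factor [expR `|y|] in the remainder makes it valid for all [y]; it costs
    nothing under a Gaussian law. *)
Lemma expR_taylor2 y : `|expR y - 1 - y - y ^+ 2 / 2| <= `|y| ^+ 3 * expR `|y|.
Proof.
have [y0|y0] := leP 0 y.
  by have /andP[h1 h2] := expR_taylor2_pos y0; rewrite (ger0_norm y0) ger0_norm.
have Ny0 : 0 <= - y by rewrite oppr_ge0 ltW.
have := expR_taylor2_neg Ny0; rewrite opprK sqrrN => /andP[h1 h2].
rewrite ler0_norm; last by lra.
rewrite (ltr0_norm y0).
have h3 : 1 <= expR (- y) by rewrite -expR0 ler_expR.
apply: (@le_trans _ _ ((- y) ^+ 3)); first by lra.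
by rewrite ler_peMr// exprn_ge0.
Qed.

(** The remainder is traded for exponentials, whose Gaussian expectations are
    explicit.  Under the centred Gaussian law of deviation [s], those with rate
    [2 / s] do not depend on [s]: only the factor [s ^+ 3] remains. *)
Lemma cube_le_expR (s z : R) : 0 < s -> s <= 1 ->
  `|z| ^+ 3 * expR `|z| <= 6 * s ^+ 3 * (expR (2 / s * z) + expR (- (2 / s) * z)).
Proof.
move=> s0 s1.
have L0 : 0 <= `|z| / s by rewrite divr_ge0// ltW.
have h1 : `|z| ^+ 3 <= 6 * s ^+ 3 * expR (`|z| / s).
  have := expR_ge1Dxn 2 L0; rewrite (_ : 3`!%:R = 6)// => h.
  have -> : `|z| ^+ 3 = 6 * s ^+ 3 * ((`|z| / s) ^+ 3 / 6).
    by field; rewrite gt_eqF.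
  rewrite ler_wpM2l//; last by move: h; lra.
  by rewrite mulr_ge0// exprn_ge0// ltW.
have h2 : expR `|z| <= expR (`|z| / s).
  by rewrite ler_expR ler_pdivlMr// ler_piMr.
have h3 : expR (`|z| / s) * expR (`|z| / s) <= expR (2 / s * z) + expR (- (2 / s) * z).
  rewrite -expRD -mulr2n -[X in expR X]mulr_natl mulrA mulrAC.
  have [z0|z0] := leP 0 z; first by rewrite ger0_norm// lerDl expR_ge0.
  by rewrite ltr0_norm// mulrN mulNr lerDr expR_ge0.
have L3 : 0 <= `|z| ^+ 3 by rewrite exprn_ge0.
have s3 : 0 <= 6 * s ^+ 3 by rewrite mulr_ge0// exprn_ge0// ltW.
apply: (le_trans (ler_pM L3 (expR_ge0 _) h1 h2)).
by rewrite -(mulrA (6 * s ^+ 3)) ler_wpM2l.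
Qed.

End ExponentialInequalities.

Section GaussianExponentialMoments.
Context {R : realType}.
Notation mu := (@lebesgue_measure R).
Local Open Scope ereal_scope.

(** The density of the law is its Radon-Nikodym derivative with respect to
    Lebesgue measure. *)
Lemma integral_normal_prob (s : R) (f : R -> \bar R) :
  (forall x, 0 <= f x) -> measurable_fun setT f ->
  \int[normal_prob 0 s]_x f x = \int[mu]_x (f x * (normal_pdf 0 s x)%:E).
Proof.
move=> f0 mf.
have dom := normal_prob_dominates (0 : R) s.
rewrite -(Radon_Nikodym_SigmaFinite.change_of_variables dom)//.
have fi := Radon_Nikodym_SigmaFinite.f_integrable dom.
have mpdf : measurable_fun setT (fun x => (normal_pdf 0 s x)%:E).
  by apply/measurable_EFinP; exact: measurable_normal_pdf.
apply: ae_eq_integral => //.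
- by apply: emeasurable_funM => //; exact: measurable_int fi.
- exact: emeasurable_funM.
- apply: ae_eqe_mul2l; apply: integral_ae_eq => // E _ mE.
  by rewrite -Radon_Nikodym_SigmaFinite.f_integral.
Qed.

(** Completing the square gives the density of the Gaussian law centred at
    [c * s ^+ 2]. *)
Lemma normal_mgf (s c : R) : s != 0%R ->
  \int[normal_prob 0 s]_x (expR (c * x))%:E = (expR (c ^+ 2 * s ^+ 2 / 2))%:E.
Proof.
move=> s0; rewrite integral_normal_prob; last 2 first.
- by move=> x; rewrite lee_fin expR_ge0.
- by apply/measurable_EFinP; apply: measurableT_comp.
transitivity (\int[mu]_x ((expR (c ^+ 2 * s ^+ 2 / 2))%:E *
    (normal_pdf (c * s ^+ 2) s x)%:E)).
  apply: eq_integral => x _; rewrite -!EFinM; congr EFin; rewrite !normal_pdfE// mulrCA [RHS]mulrCA.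
  congr (_ * _)%R; rewrite /normal_fun -!expRD; congr expR; field.
  by rewrite s0.
rewrite ge0_integralZl//.
- by rewrite integral_normal_pdf mule1.
- by apply/measurable_EFinP; exact: measurable_normal_pdf.
- by move=> x _; rewrite lee_fin normal_pdf_ge0.
Qed.

End GaussianExponentialMoments.

(** * One Gaussian step *)

Section GaussianStep.
Context {R : realType}.
Implicit Types (F : R -> R) (K x z s : R).

(** The second-order expansion that Itô's formula needs, with a uniform
    remainder; stating it without derivatives lets piecewise cubic functions
    enter directly. *)
Record jet2 K F F1 F2 : Prop := Jet2 {
  jet2_ge0 : 0 <= K ;
  jet2_bound : forall x, `|F x| <= K ;
  jet2_bound1 : forall x, `|F1 x| <= K ;
  jet2_bound2 : forall x, `|F2 x| <= K ;
  jet2_taylor : forall x z,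
    `|F (x + z) - F x - F1 x * z - F2 x * z ^+ 2 / 2| <= K * `|z| ^+ 3 ;
  jet2_cont : continuous F ;
  jet2_cont1 : continuous F1 ;
  jet2_cont2 : continuous F2 }.

(** Brownian motion [X] gives [expR (F X)] the drift
    [ito_drift F' F'' X * expR (F X)]. *)
Definition ito_drift F1 F2 x : R := (F2 x + F1 x ^+ 2) / 2.

Lemma jet2_drift_continuous K F F1 F2 : jet2 K F F1 F2 ->
  continuous (ito_drift F1 F2).
Proof.
move=> jF x; apply: cvgM; last exact: cvg_cst.
apply: cvgD; first exact: (jet2_cont2 jF).
by under eq_fun do rewrite expr2; apply: cvgM; exact: (jet2_cont1 jF).
Qed.

Definition hyp_sin z : R := (expR z - expR (- z)) / 2.
Definition hyp_cos z : R := (expR z + expR (- z)) / 2.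

Lemma hyp_sin_taylor z : `|hyp_sin z - z| <= `|z| ^+ 3 * expR `|z|.
Proof.
have := expR_taylor2 z; have := expR_taylor2 (- z).
rewrite normrN !ler_norml /hyp_sin => /andP[a1 a2] /andP[b1 b2].
by apply/andP; split; lra.
Qed.

Lemma hyp_cos_taylor z : `|hyp_cos z - 1 - z ^+ 2 / 2| <= `|z| ^+ 3 * expR `|z|.
Proof.
have := expR_taylor2 z; have := expR_taylor2 (- z).
rewrite normrN !ler_norml /hyp_cos sqrrN => /andP[a1 a2] /andP[b1 b2].
by apply/andP; split; lra.
Qed.

(** The quadratic polynomial of the expansion is traded for hyperbolic
    functions, whose Gaussian expectations are given by the exponential
    moments. *)
Lemma jet2_expR_le K F F1 F2 : jet2 K F F1 F2 ->
  let C := 120 * (1 + K) ^+ 3 * expR (2 * K) in forall s x z, 0 < s -> s <= 1 ->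
  expR (F (x + z) - F x) <=
    1 + F1 x * hyp_sin z + (F2 x + F1 x ^+ 2) * (hyp_cos z - 1) +
    6 * C * s ^+ 3 * (expR (2 / s * z) + expR (- (2 / s) * z)).
Proof.
case=> K0 bF bF1 bF2 tF _ _ _ C s x z s0 s1.
set L := `|z|; set y := F (x + z) - F x.
set E := L ^+ 3 * expR L.
have L0 : 0 <= L by rewrite /L.
have e1 : 1 <= expR L by rewrite -expR0 ler_expR.
have eK : 1 <= expR (2 * K) by rewrite -expR0 ler_expR mulr_ge0.
have L3E : L ^+ 3 <= E by rewrite ler_peMr// exprn_ge0.
have E0 : 0 <= E by rewrite mulr_ge0 ?exprn_ge0 ?expR_ge0.
have L3 : 0 <= L ^+ 3 by rewrite exprn_ge0.
have z2 : z ^+ 2 = L ^+ 2 by rewrite /L real_normK// num_real.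
have F1z : `|F1 x * z| <= K * L by rewrite normrM ler_wpM2r.
have F2z : `|F2 x * z ^+ 2 / 2| <= K * L ^+ 2 / 2.
  rewrite normrM (ger0_norm (_ : 0 <= 2^-1))// ler_wpM2r// normrM normrX -/L.
  by rewrite ler_wpM2r// sqr_ge0.
have y2K : `|y| <= 2 * K.
  by apply: le_trans (ler_normB _ _) _; have := bF (x + z); have := bF x; lra.
have tz := tF x z; rewrite -/y -/L in tz.
(* Beyond [L = 1] the crude bounds on [F] and [F1] beat the Taylor bound. *)
have yd : `|y - F1 x * z| <= 3 * K * L ^+ 2.
  have [l1|l1] := leP L 1.
    have h : K * L ^+ 3 <= K * L ^+ 2 by rewrite ler_wpM2l// exprS ler_piMl// sqr_ge0.
    have -> : y - F1 x * z = (y - F1 x * z - F2 x * z ^+ 2 / 2) + F2 x * z ^+ 2 / 2 by ring.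
    have := ler_normD (y - F1 x * z - F2 x * z ^+ 2 / 2) (F2 x * z ^+ 2 / 2).
    have : 0 <= K * L ^+ 2 by rewrite mulr_ge0 ?sqr_ge0.
    lra.
  have := ler_normB y (F1 x * z).
  have : K <= K * L ^+ 2 by rewrite ler_peMr// exprn_ege1// ltW.
  have : K * L <= K * L ^+ 2 by rewrite ler_wpM2l// expr2 ler_peMr// ltW.
  lra.
have yL : `|y| <= 4 * K * L.
  have [l1|l1] := leP L 1.
    have h : K * L ^+ 2 <= K * L by rewrite ler_wpM2l// expr2 ler_piMl.
    have := ler_normD (y - F1 x * z) (F1 x * z); rewrite subrK; lra.
  have : K <= K * L by rewrite ler_peMr// ltW.
  lra.
have y2 : y ^+ 2 <= (F1 x * z) ^+ 2 + 15 * K ^+ 2 * L ^+ 3.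
  have : `|(y - F1 x * z) * (y + F1 x * z)| <= (3 * K * L ^+ 2) * (5 * K * L).
    rewrite normrM ler_pM//; have := ler_normD y (F1 x * z); lra.
  by move=> /(le_trans (ler_norm _)); lra.
have y3 : `|y| ^+ 3 <= 64 * K ^+ 3 * L ^+ 3.
  have -> : 64 * K ^+ 3 * L ^+ 3 = (4 * K * L) ^+ 3 by ring.
  by rewrite lerXn2r// nnegrE mulr_ge0// mulr_ge0.
have ey : expR y <= 1 + y + y ^+ 2 / 2 + 64 * K ^+ 3 * L ^+ 3 * expR (2 * K).
  have : `|y| ^+ 3 * expR `|y| <= 64 * K ^+ 3 * L ^+ 3 * expR (2 * K).
    by rewrite ler_pM ?exprn_ge0 ?expR_ge0// ler_expR.
  have := expR_taylor2 y; rewrite ler_norml => /andP[_]; lra.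
have sz : F1 x * z <= F1 x * hyp_sin z + K * E.
  have : `|F1 x * (hyp_sin z - z)| <= K * E.
    by rewrite normrM ler_pM//; exact: hyp_sin_taylor.
  by rewrite ler_norml => /andP[]; lra.
have V : `|F2 x + F1 x ^+ 2| <= K + K ^+ 2.
  apply: le_trans (ler_normD _ _) _; rewrite lerD// normrX.
  by rewrite lerXn2r ?nnegrE.
have cz : (F2 x + F1 x ^+ 2) * (z ^+ 2 / 2) <=
    (F2 x + F1 x ^+ 2) * (hyp_cos z - 1) + (K + K ^+ 2) * E.
  have : `|(F2 x + F1 x ^+ 2) * (hyp_cos z - 1 - z ^+ 2 / 2)| <= (K + K ^+ 2) * E.
    by rewrite normrM ler_pM//; exact: hyp_cos_taylor.
  by rewrite ler_norml => /andP[]; lra.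
have tot : expR y <= 1 + F1 x * hyp_sin z + (F2 x + F1 x ^+ 2) * (hyp_cos z - 1) +
    (3 * K + 9 * K ^+ 2 + 64 * K ^+ 3 * expR (2 * K)) * E.
  have h1 : y <= F1 x * z + F2 x * z ^+ 2 / 2 + K * L ^+ 3.
    by move: tz; rewrite ler_norml => /andP[]; lra.
  have h2 : K * L ^+ 3 <= K * E by rewrite ler_wpM2l.
  have h3 : K ^+ 2 * L ^+ 3 <= K ^+ 2 * E by rewrite ler_wpM2l// sqr_ge0.
  have h4 : K ^+ 3 * expR (2 * K) * L ^+ 3 <= K ^+ 3 * expR (2 * K) * E.
    by rewrite ler_wpM2l// mulr_ge0 ?exprn_ge0 ?expR_ge0.
  have h5 : 0 <= K ^+ 2 * E by rewrite mulr_ge0 ?sqr_ge0.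
  lra.
apply: (le_trans tot); rewrite lerD2l.
have C0 : 0 <= C by rewrite !mulr_ge0 ?exprn_ge0 ?expR_ge0// addr_ge0.
have hC : 3 * K + 9 * K ^+ 2 + 64 * K ^+ 3 * expR (2 * K) <= C.
  have a1 : 3 * K + 9 * K ^+ 2 <= (3 * K + 9 * K ^+ 2) * expR (2 * K).
    by rewrite ler_peMr// addr_ge0// mulr_ge0// exprn_ge0.
  have a2 : 3 * K + 9 * K ^+ 2 + 64 * K ^+ 3 <= 120 * (1 + K) ^+ 3.
    have := sqr_ge0 K; have : 0 <= K ^+ 3 by rewrite exprn_ge0.
    by rewrite (_ : (1 + K) ^+ 3 = 1 + 3 * K + 3 * K ^+ 2 + K ^+ 3); [lra | ring].
  have := ler_wpM2r (expR_ge0 (2 * K)) a2; rewrite /C; lra.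
apply: (@le_trans _ _ (C * E)).
  by have := ler_wpM2r E0 hC; lra.
have -> : 6 * C * s ^+ 3 * (expR (2 / s * z) + expR (- (2 / s) * z)) =
  C * (6 * s ^+ 3 * (expR (2 / s * z) + expR (- (2 / s) * z))) by ring.
by rewrite ler_wpM2l//; exact: cube_le_expR.
Qed.

End GaussianStep.

Section GaussianStepExpectation.
Context {R : realType}.

Lemma integrable_normal_expR (s c : R) : s != 0 ->
  (normal_prob 0 s).-integrable setT (fun z => (expR (c * z))%:E).
Proof.
move=> s0; apply/integrableP; split.
  by apply/measurable_EFinP; apply: measurableT_comp.
under eq_integral do rewrite gee0_abs ?lee_fin ?expR_ge0//.
by rewrite normal_mgf// ltry.
Qed.

(** The Gaussian expectation of [hyp_sin] vanishes and that of [hyp_cos] is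
    [expR (s ^+ 2 / 2)]: what is left is the drift, of order [s ^+ 2], and an
    error of order [s ^+ 3]. *)
Lemma normal_jet2_le (K : R) F F1 F2 : jet2 K F F1 F2 ->
  exists2 C, 0 <= C & forall s x, 0 < s -> s <= 1 ->
  (\int[normal_prob 0 s]_z (expR (F (x + z) - F x))%:E <=
   (expR (s ^+ 2 * ito_drift F1 F2 x + C * s ^+ 3))%:E)%E.
Proof.
move=> jF; have := jet2_expR_le jF.
set C := 120 * (1 + K) ^+ 3 * expR (2 * K) => /= pw.
have K0 := jet2_ge0 jF.
have C0 : 0 <= C by rewrite !mulr_ge0 ?exprn_ge0 ?expR_ge0// addr_ge0.
exists ((K + K ^+ 2) * (1 + expR 1) + 12 * C * expR 2).
  by rewrite addr_ge0// mulr_ge0 ?addr_ge0 ?expR_ge0 ?exprn_ge0// mulr_ge0.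
move=> s x s0 s1; set V := F2 x + F1 x ^+ 2.
have sN0 : s != 0 by rewrite gt_eqF.
(* The bound of [jet2_expR_le] as a combination of exponentials, listed by
   coefficient and rate. *)
pose r : seq (R * R) := [:: (1 - V, 0); ((V + F1 x) / 2, 1); ((V - F1 x) / 2, -1);
   (6 * C * s ^+ 3, 2 / s); (6 * C * s ^+ 3, - (2 / s))].
have int p : (normal_prob 0 s).-integrable setT (fun z => p.1%:E * (expR (p.2 * z))%:E)%E.
  by apply: integrableZl => //; exact: integrable_normal_expR.
have cF := jet2_cont jF.
apply: (@le_trans _ _ (\int[normal_prob 0 s]_z (\sum_(p <- r) p.1%:E * (expR (p.2 * z))%:E))%E).
  apply: ge0_le_integral => //.
  - apply/measurable_EFinP; apply: measurableT_comp => //.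
    apply: measurable_funB => //; apply: continuous_measurable_fun.
    move=> z; apply: (@continuous_comp _ _ _ (fun z => x + z) F) => //.
    by apply: cvgD => //; exact: cvg_cst.
    exact: cF.
  - by apply: (measurable_int (normal_prob 0 s)); apply: integrable_sum.
  - move=> z _; rewrite (eq_bigr (fun p => (p.1 * expR (p.2 * z))%:E)); last by [].
    rewrite sumEFin lee_fin.
    rewrite !big_cons big_nil /= mul0r expR0 mul1r mulN1r.
    by apply: le_trans (pw s x z s0 s1) _; rewrite -/V /hyp_sin /hyp_cos; lra.
rewrite integral_sum//.
rewrite (eq_bigr (fun p => (p.1 * expR (p.2 ^+ 2 * s ^+ 2 / 2))%:E)); last first.
  move=> p _; rewrite integralZl//; last exact: integrable_normal_expR.
  by rewrite normal_mgf.
rewrite sumEFin lee_fin !big_cons big_nil /=.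
have -> : (2 / s) ^+ 2 * s ^+ 2 / 2 = 2 by field.
have -> : (- (2 / s)) ^+ 2 * s ^+ 2 / 2 = 2 by field.
rewrite expr0n/= !mul0r expR0 sqrrN expr1n mul1r.
set v := s ^+ 2 / 2.
have v0 : 0 <= v by rewrite divr_ge0 ?sqr_ge0.
have s3 : 0 <= s ^+ 3 by rewrite exprn_ge0// ltW.
have s21 : s ^+ 2 <= 1 by rewrite exprn_ile1// ltW.
have v2s : v ^+ 2 <= s ^+ 3.
  have -> : v ^+ 2 = s ^+ 3 * (s / 4) by rewrite /v; field.
  by rewrite ler_piMr//; lra.
have v3s : v ^+ 3 <= s ^+ 3.
  by rewrite lerXn2r ?nnegrE ?(ltW s0)// /v; nra.
have v1 : v <= 1 by rewrite /v; lra.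
have hv : `|expR v - 1 - v| <= s ^+ 3 * (1 + expR 1).
  have /andP[h1 h2] := expR_taylor2_pos v0.
  have := expR_ge1Dx v => h3.
  have h4 : v ^+ 3 * expR v <= s ^+ 3 * expR 1.
    by rewrite ler_pM ?exprn_ge0 ?expR_ge0 ?ler_expR.
  by rewrite ger0_norm; lra.
have hV : `|V| <= K + K ^+ 2.
  apply: le_trans (ler_normD _ _) _; rewrite lerD ?(jet2_bound2 jF)// normrX.
  by rewrite lerXn2r ?nnegrE// (jet2_bound1 jF).
have hVv : V * (expR v - 1 - v) <= (K + K ^+ 2) * (s ^+ 3 * (1 + expR 1)).
  by apply: le_trans (ler_norm _) _; rewrite normrM ler_pM.
apply: le_trans (expR_ge1Dx _); rewrite /ito_drift -/V.
have -> : s ^+ 2 * (V / 2) = V * v by rewrite /v; field.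
lra.
Qed.

End GaussianStepExpectation.

(** * Independence of the past and the next step *)

Section IndependentStep.
Context {R : realType} {d : measure_display} {T : measurableType d}.
Variable P : probability T R.

(** The joint law of independent variables is the product of their laws, to which
    Fubini's theorem applies. *)
Lemma integral_indep (d' : measure_display) (T' : measurableType d')
    (d2 : measure_display) (S : measurableType d2)
    (U : {mfun T >-> T'}) (Z : {mfun T >-> S}) (nu : probability S R)
    (H : T' * S -> \bar R) :
  (forall A B, measurable A -> measurable B ->
     P (U @^-1` A `&` Z @^-1` B) = (P (U @^-1` A) * nu B)%E) ->
  (forall x, (0 <= H x)%E) -> measurable_fun setT H ->
  (\int[P]_w H (U w, Z w) = \int[P]_w \int[nu]_z H (U w, z))%E.
Proof.
move=> UZ H0 mH.
pose UZf w := (U w, Z w).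
have mUZ : measurable_fun setT UZf by exact: measurable_fun_pair.
pose UZm : {mfun T >-> (T' * S)%type} := HB.pack UZf (isMeasurableFun.Build _ _ _ _ _ mUZ).
have E := product_measure_unique (m1 := distribution P U) (m2 := nu)
  (m' := distribution P UZm).
transitivity (\int[distribution P UZm]_x H x)%E.
  by rewrite ge0_integral_distribution.
transitivity (\int[distribution P U \x nu]_x H x)%E.
  apply: eq_measure_integral => A mA _; apply/esym/E => // A1 B1 mA1 mB1.
rewrite fubini_tonelli1// ge0_integral_distribution//.
- exact: measurable_fun_fubini_tonelli_F.
- by move=> y; apply: integral_ge0.
Qed.

Definition walk (A : Type) (D : nat -> A -> R) (k : nat) (w : A) : R :=
  \sum_(i < k) D i w.

Lemma walkS (A : Type) (D : nat -> A -> R) k w :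
  walk D k.+1 w = walk D k w + D k w.
Proof. by rewrite /walk big_ord_recr. Qed.

Lemma measurable_walk (d' : measure_display) (T' : measurableType d')
    (D : nat -> T' -> R) k :
  (forall i, (i < k)%N -> measurable_fun setT (D i)) ->
  measurable_fun setT (walk D k).
Proof. by move=> mD; apply: measurable_sum => i; exact: mD. Qed.

Definition cylinder (D : nat -> T -> R) (k : nat) : set (set T) :=
  [set E | exists2 B : nat -> set R, (forall i, measurable (B i)) &
     E = \bigcap_(i in [set i | (i < k)%N]) (D i @^-1` B i)].

Lemma setI_closed_cylinder D k : setI_closed (cylinder D k).
Proof.
move=> _ _ [B mB ->] [C mC ->]; exists (fun i => B i `&` C i).
  by move=> i; exact: measurableI.
apply/seteqP; split=> [x [xB xC] i ik|x xBC]; first by split; [exact: xB|exact: xC].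
by split => i ik; have [] := xBC i ik.
Qed.

Lemma cylinder_setT D k : cylinder D k setT.
Proof.
by exists (fun=> setT) => //; apply/seteqP; split.
Qed.

Lemma measurable_cylinder (D : nat -> {mfun T >-> R}) k :
  cylinder D k `<=` measurable.
Proof.
move=> _ [B mB ->]; apply: bigcap_measurableType => i _.
by rewrite -[X in measurable X]setTI; exact: measurable_funP.
Qed.

(** An event determined by the first [k] variables is independent of the next
    one: both sides of the product rule are finite measures in the event, and
    they agree on cylinders. *)
Lemma mutually_independent_past (D : nat -> {mfun T >-> R}) (k : nat) :
  (forall n, mutually_independent P (fun i : 'I_n => D i : T -> R)) ->
  forall A B, <<s cylinder D k >> A -> measurable B ->
  (P (A `&` D k @^-1` B) = P A * P (D k @^-1` B))%E.
Proof.
move=> ind A B sA mB; set C := D k @^-1` B.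
have mC : measurable C by rewrite -[C]setTI; exact: measurable_funP.
pose r : {nonneg R} := NngNum (fine_ge0 (measure_ge0 P C)).
have := @g_sigma_algebra_measure_unique _ _ _ (cylinder D k)
  (@measurable_cylinder D k) (fun=> setT) (fun=> cylinder_setT D k) _
  (mrestr P mC) (mscale r P) (@setI_closed_cylinder D k) _ _ A sA.
rewrite /= /mrestr/= /mscale/= -/C => ->; last 3 first.
- by rewrite bigcup_const//; exists 0%N.
- move=> _ [B' mB' ->].
  rewrite fineK ?fin_num_measure//.
  pose B1 n (i : 'I_n) := if (i < k)%N then B' i else B.
  have mB1 n (i : 'I_n) : measurable (B1 n i) by rewrite /B1; case: ifP.
  have := ind k (B1 k) (mB1 k); have := ind k.+1 (B1 k.+1) (mB1 k.+1).
  have Bmax : B1 k.+1 ord_max = B by rewrite /B1/= ltnn.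
  rewrite big_ord_recr/= Bmax.
  have -> : \bigcap_(i in [set: 'I_k.+1]) (D i @^-1` B1 k.+1 i) =
            \bigcap_(i in [set i | (i < k)%N]) (D i @^-1` B' i) `&` C.
    apply/seteqP; split=> [x xB|x [xB xC] i _].
      split=> [i /= ik|].
        by have := xB (Ordinal (ltnW ik : (i < k.+1)%N)) I; rewrite /B1/= ik.
      by have := xB ord_max I; rewrite /B1/= ltnn.
    rewrite /B1; case: ifPn => ik; first exact: xB.
    have -> : nat_of_ord i = k by apply/eqP; rewrite eqn_leq -ltnS ltn_ord leqNgt.
    exact: xC.
  have -> : \bigcap_(i in [set: 'I_k]) (D i @^-1` B1 k i) =
            \bigcap_(i in [set i | (i < k)%N]) (D i @^-1` B' i).
    apply/seteqP; split=> [x xB i/= ik|x xB i _].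
      by have := xB (Ordinal ik) I; rewrite /B1/= ik.
    by rewrite /B1 ltn_ord; apply: xB; rewrite /=.
  move=> -> ->; rewrite muleC; congr (_ * _)%E.
- by move=> _; rewrite -ge0_fin_numE// fin_num_measure//; exact: measurableI.
by rewrite muleC fineK// fin_num_measure.
Qed.

End IndependentStep.

(** * An exponential inequality for Brownian motion *)

Section DiscreteFeynmanKac.
Context {R : realType} {d : measure_display} {T : measurableType d}.
Variable P : probability T R.

Definition walk_exponent (s : R) (F u : R -> R) (A : Type) (D : nat -> A -> R)
    (k : nat) (w : A) : R :=
  F (walk D k w) - F 0 - s ^+ 2 * \sum_(i < k) u (walk D i w).

Lemma measurable_walk_exponent (d' : measure_display) (T' : measurableType d')
    (D : nat -> T' -> R) k s F u :
  (forall i, (i < k)%N -> measurable_fun setT (D i)) ->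
  continuous F -> continuous u ->
  measurable_fun setT (walk_exponent s F u D k).
Proof.
move=> mD cF cu.
have mF := continuous_measurable_fun cF; have mu := continuous_measurable_fun cu.
apply: measurable_funB.
  by apply: measurable_funB => //; apply: measurableT_comp => //; exact: measurable_walk.
apply: measurable_funM => //; apply: measurable_sum => i.
apply: measurableT_comp => //; apply: measurable_walk => j ji; apply: mD.
exact: ltn_trans ji _.
Qed.

(** One-step conditional expectations multiply up; the exponent is arranged so
    that each of them is at most [expR (C * s ^+ 3)]. *)
Lemma walk_feynman_kac (D : nat -> {mfun T >-> R}) (s C : R) (F u : R -> R) :
  continuous F -> continuous u ->
  (forall n, mutually_independent P (fun i : 'I_n => D i : T -> R)) ->
  (forall i B, measurable B -> P (D i @^-1` B) = normal_prob 0 s B) ->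
  (forall x, (\int[normal_prob 0 s]_z (expR (F (x + z) - F x))%:E <=
   (expR (s ^+ 2 * u x + C * s ^+ 3))%:E)%E) ->
  forall N, (\int[P]_w (expR (walk_exponent s F u D N w))%:E <=
             (expR (N%:R * (C * s ^+ 3)))%:E)%E.
Proof.
move=> cF cu ind law step; elim=> [|k IH].
  under eq_integral do rewrite /walk_exponent /walk !big_ord0 subrr mulr0 subrr expR0.
  rewrite integral_cst// mul1e mul0r expR0.
  exact: probability_le1.
have mF := continuous_measurable_fun cF; have mu := continuous_measurable_fun cu.
pose Uf w := (walk D k w, walk_exponent s F u D k w - s ^+ 2 * u (walk D k w)).
have mUf (d' : measure_display) (T' : measurableType d') (D' : nat -> T' -> R) :
    (forall i, (i < k)%N -> measurable_fun setT (D' i)) ->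
    measurable_fun setT (fun w => (walk D' k w,
      walk_exponent s F u D' k w - s ^+ 2 * u (walk D' k w))).
  move=> mD'; apply: measurable_fun_pair; first exact: measurable_walk.
  apply: measurable_funB; first exact: measurable_walk_exponent.
  by apply: measurable_funM => //; apply: measurableT_comp => //; exact: measurable_walk.
have mU : measurable_fun setT Uf by exact: mUf.
pose U : {mfun T >-> (R * R)%type} := HB.pack Uf (isMeasurableFun.Build _ _ _ _ _ mU).
(* The Gaussian law lives on another copy of the Borel space of R. *)
have mZ : measurable_fun setT (D k : T -> measurableTypeR R) by exact: (measurable_funP (D k)).
pose Z : {mfun T >-> measurableTypeR R} := HB.pack (D k : T -> measurableTypeR R)
  (isMeasurableFun.Build _ _ _ _ _ mZ).
pose H (p : (R * R) * measurableTypeR R) := (expR (F (p.1.1 + p.2) - F p.1.1 + p.1.2))%:E.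
have mH : measurable_fun setT H.
  apply/measurable_EFinP; apply: measurableT_comp => //.
  apply: measurable_funD; last by apply: measurableT_comp => //; exact: measurableT_comp.
  apply: measurable_funB; apply: measurableT_comp => //; last exact: measurableT_comp.
  by apply: measurable_funD => //; exact: measurableT_comp.
have -> : (\int[P]_w (expR (walk_exponent s F u D k.+1 w))%:E =
    \int[P]_w H (U w, Z w))%E.
  apply: eq_integral => w _; rewrite /H /= /walk_exponent walkS big_ord_recr/=.
  by congr (expR _)%:E; ring.
rewrite (@integral_indep _ _ _ P _ _ _ _ U Z (normal_prob 0 s)); last 3 first.
- move=> A B mA mB; transitivity (P (U @^-1` A) * P (D k @^-1` B))%E; last first.
    by congr (_ * _)%E; exact: law.
  apply: mutually_independent_past => //.
  rewrite -[_ @^-1` _]setTI.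
  pose G := g_sigma_algebraType (cylinder (fun i => D i : T -> R) k).
  have := @mUf _ G (fun i => D i); apply => // i ik _ B' mB'.
  rewrite setTI; apply: sub_sigma_algebra.
  exists (fun j => if j == i then B' else setT).
    by move=> j; case: ifP.
  apply/seteqP; split=> [x xB j jk /=|x /(_ i ik)/=]; last by rewrite eqxx.
  by case: eqP => [->|].
- by move=> x; rewrite lee_fin expR_ge0.
- exact: mH.
have mY : measurable_fun setT
    (fun w => (expR (walk_exponent s F u (fun i => D i) k w))%:E).
  apply/measurable_EFinP; apply: measurableT_comp => //.
  exact: measurable_walk_exponent.
apply: (@le_trans _ _ (\int[P]_w ((expR (C * s ^+ 3))%:E * (expR (walk_exponent s F u D k w))%:E))%E).
  apply: ge0_le_integral => //.
  - by move=> w _; apply: integral_ge0 => z _; rewrite lee_fin expR_ge0.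
  - have mG : measurable_fun setT (fubini_F (normal_prob 0 s) H).
      apply: measurable_fun_fubini_tonelli_F => //.
      by move=> x; rewrite lee_fin expR_ge0.
    exact: (measurableT_comp mG mU).
  - exact: emeasurable_funM.
  - move=> w _; rewrite /H/=.
    set x := walk D k w; set v := walk_exponent s F u D k w.
    rewrite -EFinM (_ : expR (C * s ^+ 3) * expR v =
      expR (v - s ^+ 2 * u x) * expR (s ^+ 2 * u x + C * s ^+ 3)); last first.
      by rewrite -!expRD; congr expR; ring.
    under eq_integral do rewrite addrC expRD EFinM.
    rewrite ge0_integralZl//.
    + by rewrite EFinM lee_wpmul2l// lee_fin expR_ge0.
    + apply/measurable_EFinP; apply: measurableT_comp => //.
      apply: measurable_funB => //; apply: measurableT_comp => //.
      exact: measurable_funD.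
rewrite ge0_integralZl//.
rewrite -natr1 mulrDl mul1r addrC expRD EFinM; exact: lee_wpmul2l.
Qed.

End DiscreteFeynmanKac.

Section FeynmanKac.
Context {R : realType} {d : measure_display} {T : measurableType d}.
Variable P : probability T R.
Variable W : R -> {RV P >-> R}.
Hypothesis bm : brownian_motion W.

Lemma bm_continuous_itv (a b : R) (w : T) : 0 <= a ->
  {within `[a, b], continuous (fun t => W t w)}.
Proof.
move=> a0; have := @bm_continuous_paths _ _ _ _ _ bm w; apply: continuous_subspaceW.
by move=> t /=; rewrite !in_itv/= => /andP[/(le_trans a0)-> _].
Qed.

Lemma within_continuous_comp_real (A : set R) (f g : R -> R) : continuous g ->
  {within A, continuous f} -> {within A, continuous (fun t => g (f t))}.
Proof. by move=> cg cf x; apply: continuous_comp; [exact: cf|exact: cg]. Qed.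

Lemma bm_shift_continuous (a b c : R) (w : T) : 0 <= a ->
  {within `[a, b], continuous (fun t => W t w - c)}.
Proof.
move=> a0; apply: (@within_continuous_comp_real _ _ (fun x => x - c)).
  by move=> x; apply: cvgB => //; exact: cvg_cst.
exact: bm_continuous_itv.
Qed.

Definition bm_increment (a de : R) (i : nat) (w : T) : R :=
  W (a + i.+1%:R * de) w - W (a + i%:R * de) w.

Lemma measurable_bm_increment a de i :
  measurable_fun setT (bm_increment a de i).
Proof. by apply: measurable_funB; exact: measurable_funP. Qed.

HB.instance Definition _ a de i :=
  isMeasurableFun.Build _ _ _ _ _ (measurable_bm_increment a de i).

Lemma walk_bm_increment a de k w :
  walk (bm_increment a de) k w = W (a + k%:R * de) w - W a w.
Proof.
rewrite /walk /bm_increment -(big_mkord xpredT (fun i => W (a + i.+1%:R * de) w -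
  W (a + i%:R * de) w)) telescope_sumr//.
by rewrite mul0r addr0.
Qed.

Lemma limn_einf_le_cst (u : (\bar R)^nat) (c : \bar R) :
  (forall n, (u n <= c)%E) -> (limn_einf u <= c)%E.
Proof.
move=> uc; rewrite limn_einf_lim; apply: lime_le; first exact: is_cvg_einfs.
apply: nearW => n; apply: le_trans (uc n); apply: ereal_inf_lbound.
by exists n => //=.
Qed.

(** Itô's formula in exponential form: for the increments [X] of the motion,
    the process [expR (F X_t - \int drift)] has mean at most that of its initial
    value.  The integral is the limit of the Riemann
    sums of a walk, and Fatou's lemma passes the discrete bound to the limit. *)
Lemma feynman_kac (K : R) F F1 F2 (a b : R) : jet2 K F F1 F2 -> 0 <= a -> a < b ->
  (\int[P]_w (expR (F (W b w - W a w) - F 0 -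
     itg a b (fun t => ito_drift F1 F2 (W t w - W a w))))%:E <= 1)%E.
Proof.
move=> jF a0 ab; have [C C0 step] := normal_jet2_le jF.
have ba0 : 0 < b - a by rewrite subr_gt0.
have cu := jet2_drift_continuous jF.
set u := ito_drift F1 F2 in cu step *.
(* A walk obeys the bound up to a factor that tends to [1] with its step. *)
suff H eta : 0 < eta -> (\int[P]_w (expR (F (W b w - W a w) - F 0 -
     itg a b (fun t => u (W t w - W a w))))%:E <= (expR eta)%:E)%E.
  apply/lee_addgt0Pr => e e0; have := H (ln (1 + e)).
  rewrite lnK ?posrE ?addr_gt0//; apply.
  by rewrite ln_gt0// ltrDl.
move=> eta0.
pose s0 := Num.min 1 (eta / (C * (b - a) + 1)).
have s00 : 0 < s0.
  by rewrite lt_min ltr01 divr_gt0// ltr_wpDl// mulr_ge0// ltW.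
(* With more than [N0] steps, the standard deviation of a step is at most [s0]. *)
pose N0 := Num.truncn ((b - a) / s0 ^+ 2).
pose de N := (b - a) / (N + N0).+1%:R.
have de0 N : 0 < de N by rewrite divr_gt0.
have des N : Num.sqrt (de N) <= s0.
  rewrite -(ger0_norm (ltW s00)) -sqrtr_sqr ler_sqrt ?exprn_ge0 ?(ltW s00)//.
  rewrite /de ler_pdivrMr// mulrC -ler_pdivrMr ?exprn_gt0//.
  apply: (le_trans (ltW (truncnS_gt _))).
  by rewrite ler_nat ltnS leq_addl.
pose D N i : {mfun T >-> R} := bm_increment a (de N) i.
pose f N w : \bar R := (expR (walk_exponent (Num.sqrt (de N)) F u (D N) (N + N0).+1 w))%:E.
have cF := jet2_cont jF.
have fE : forall M w, f M w = (expR (F (W b w - W a w) - F 0 - (b - a) / (M + N0).+1%:R *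
   \sum_(i < (M + N0).+1) u (W (a + i%:R * ((b - a) / (M + N0).+1%:R)) w - W a w)))%:E.
  move=> M w; congr (expR _)%:E; rewrite /walk_exponent sqr_sqrtr ?(ltW (de0 M))//.
  rewrite walk_bm_increment; congr (F (W _ w - _) - _ - _).
    by rewrite /de mulrC divfK// addrC subrK.
  by congr (_ * _); apply: eq_bigr => i _; rewrite walk_bm_increment.
apply: (@le_trans _ _ (\int[P]_w limn_einf (f^~ w))%E).
  rewrite le_eqVlt; apply/orP; left; apply/eqP; apply: eq_integral => w _; apply/esym.
  apply: (cvg_limn_einf_sup _).1; apply: cvg_EFin.
    by apply: nearW => N.
  rewrite (_ : fine \o _ = fun N => expR (F (W b w - W a w) - F 0 - (b - a) / (N + N0).+1%:R *
   \sum_(i < (N + N0).+1) u (W (a + i%:R * ((b - a) / (N + N0).+1%:R)) w - W a w))); last first.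
    by apply/funext => N; have /(congr1 fine) := fE N w.
  apply: (cvg_comp _ expR); last exact: continuous_expR.
  apply: cvgB; first exact: cvg_cst.
  have := @riemann_sum_cvg R a b (fun t => u (W t w - W a w)) (ltW ab).
  rewrite -(cvg_shiftn N0); apply.
  apply: (@within_continuous_comp_real _ _ u) => //.
  exact: bm_shift_continuous.
apply: (@le_trans _ _ (limn_einf (fun N => \int[P]_w f N w))%E).
  apply: fatou => //.
  - move=> N; apply/measurable_EFinP; apply: measurableT_comp => //.
    apply: measurable_walk_exponent => // i _; exact: measurable_funP.
  - by move=> N w _; rewrite lee_fin expR_ge0.
apply: limn_einf_le_cst => N.
have sq0 : 0 < Num.sqrt (de N) by rewrite sqrtr_gt0.
have sq1 : Num.sqrt (de N) <= 1.
  by apply: (le_trans (des N)); rewrite ge_min lexx.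
apply: le_trans (@walk_feynman_kac _ _ _ P (D N) (Num.sqrt (de N)) C F u cF cu _ _ _ _) _.
- move=> n; apply: (bm_independent_increments bm (t := fun i => a + i%:R * de N)).
    by rewrite mul0r addr0.
  by move=> i; rewrite lerD2l ler_wpM2r ?(ltW (de0 N))// ler_nat.
- move=> i B mB.
  have := bm_normal_increments bm (s := a + i%:R * de N) (t := a + i.+1%:R * de N).
  rewrite (_ : a + i.+1%:R * de N - (a + i%:R * de N) = de N); last first.
    by rewrite -natr1; ring.
  apply => //; first by rewrite addr_ge0// mulr_ge0// ltW.
  by rewrite ltrD2l ltr_pM2r// ltr_nat.
- by move=> x; exact: step.
rewrite lee_fin ler_expR.
have -> : Num.sqrt (de N) ^+ 3 = de N * Num.sqrt (de N).
  by rewrite exprSr sqr_sqrtr// ltW.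
have -> : (N + N0).+1%:R * (C * (de N * Num.sqrt (de N))) =
    C * (b - a) * Num.sqrt (de N).
  by rewrite /de; field.
have CB : 0 <= C * (b - a) by rewrite mulr_ge0// ltW.
have : C * (b - a) * Num.sqrt (de N) <= (C * (b - a) + 1) * (eta / (C * (b - a) + 1)).
  rewrite ler_pM ?sqrtr_ge0//; first by rewrite lerDl.
  by apply: (le_trans (des N)); rewrite ge_min lexx orbT.
by rewrite [leRHS]mulrCA divff ?mulr1// gt_eqF// ltr_wpDl.
Qed.

End FeynmanKac.

(** * Tents and the potentials that measure the time spent in them *)

Section TentPotentials.
Context {R : realType}.
Implicit Types x y z w : R.

Definition ramp y : R := (y + `|y|) / 2.

Lemma ramp_ge0E y : 0 <= y -> ramp y = y.
Proof. by move=> y0; rewrite /ramp ger0_norm//; field. Qed.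

Lemma ramp_le0E y : y <= 0 -> ramp y = 0.
Proof. by move=> y0; rewrite /ramp ler0_norm// subrr mul0r. Qed.

Lemma ramp_cases y : (0 <= y /\ ramp y = y) \/ (y < 0 /\ ramp y = 0).
Proof.
have [y0|y0] := leP 0 y; [left|right]; split => //; first exact: ramp_ge0E.
exact/ramp_le0E/ltW.
Qed.

Lemma continuous_ramp : continuous ramp.
Proof.
move=> y; apply: cvgM; last exact: cvg_cst.
by apply: cvgD; [exact: cvg_id|apply: cvg_norm; exact: cvg_id].
Qed.

Lemma ramp_lip x y : x <= y -> 0 <= ramp y - ramp x <= y - x.
Proof.
move=> xy; case: (ramp_cases x) => -[? ->]; case: (ramp_cases y) => -[? ->];
  apply/andP; split; lra.
Qed.

(** The ramp convolved with the tent of half-width [w]: its second derivative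
    is [tent w / w], and it stays within [w / 6] of the ramp. *)
Definition smooth_ramp w y : R :=
  (ramp (y + w) ^+ 3 - 2 * ramp y ^+ 3 + ramp (y - w) ^+ 3) / (6 * w ^+ 2).

Definition smooth_ramp' w y : R :=
  (ramp (y + w) ^+ 2 - 2 * ramp y ^+ 2 + ramp (y - w) ^+ 2) / (2 * w ^+ 2).

Definition tent w y : R := (ramp (y + w) - 2 * ramp y + ramp (y - w)) / w.

Lemma ramp_window w y : 0 < w ->
  [\/ [/\ y <= - w, ramp (y + w) = 0, ramp y = 0 & ramp (y - w) = 0],
      [/\ - w <= y <= 0, ramp (y + w) = y + w, ramp y = 0 & ramp (y - w) = 0],
      [/\ 0 <= y <= w, ramp (y + w) = y + w, ramp y = y & ramp (y - w) = 0] |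
      [/\ w <= y, ramp (y + w) = y + w, ramp y = y & ramp (y - w) = y - w]].
Proof.
move=> w0; have [h1|h1] := leP y (- w).
  by apply: Or41; split => //; apply: ramp_le0E; lra.
have [h2|h2] := leP y 0.
  apply: Or42; split; [by apply/andP; split; lra|apply: ramp_ge0E; lra|..];
    apply: ramp_le0E; lra.
have [h3|h3] := leP y w.
  by apply: Or43; split; [apply/andP; split; lra|apply: ramp_ge0E; lra|
    apply: ramp_ge0E; lra|apply: ramp_le0E; lra].
by apply: Or44; split; [lra|apply: ramp_ge0E; lra|apply: ramp_ge0E; lra|
    apply: ramp_ge0E; lra].
Qed.

Lemma tentE w y : 0 < w -> tent w y = Num.max 0 (1 - `|y| / w).
Proof.
move=> w0; have wN0 : w != 0 by rewrite gt_eqF.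
rewrite /tent; case: (ramp_window y w0) => -[h -> -> ->].
- rewrite max_l; first by rewrite mulr0 subrr addr0 mul0r.
  by rewrite subr_le0 ler_pdivlMr// mul1r ler0_norm; lra.
- case/andP: h => h1 h2; rewrite max_r ler0_norm//; first by field.
  by rewrite subr_ge0 ler_pdivrMr// mul1r; lra.
- case/andP: h => h1 h2; rewrite max_r ger0_norm//; first by field.
  by rewrite subr_ge0 ler_pdivrMr// mul1r; lra.
- rewrite max_l; first by field.
  by rewrite subr_le0 ler_pdivlMr// mul1r ger0_norm; lra.
Qed.

Lemma tent_ge0 w y : 0 < w -> 0 <= tent w y.
Proof. by move=> w0; rewrite tentE// le_max lexx. Qed.

Lemma tent_le1 w y : 0 < w -> tent w y <= 1.
Proof.
move=> w0; rewrite tentE// ge_max ler01/= gerBl.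
by rewrite divr_ge0// ltW.
Qed.

Lemma continuous_tent w : continuous (tent w).
Proof.
have c (b : R) : continuous (fun y => ramp (y + b)).
  move=> y; apply: (@continuous_comp _ _ _ (fun y => y + b) ramp).
    by apply: cvgD; [exact: cvg_id|exact: cvg_cst].
  exact: continuous_ramp.
move=> y; apply: cvgM; last exact: cvg_cst.
apply: cvgD; last exact: c.
apply: cvgB; first exact: c.
by apply: cvgM; [exact: cvg_cst|exact: continuous_ramp].
Qed.

Lemma smooth_ramp_bound w y : 0 < w ->
  ramp y <= smooth_ramp w y <= ramp y + w / 6.
Proof.
move=> w0; rewrite /smooth_ramp.
have q0 : 0 < 6 * w ^+ 2 by rewrite mulr_gt0// exprn_gt0.
rewrite ler_pdivlMr// ler_pdivrMr//.
have e : w / 6 * (6 * w ^+ 2) = w ^+ 3 by field.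
rewrite (mulrDl (ramp y)) e; case: (ramp_window y w0) => -[h -> -> ->].
- have : 0 <= w ^+ 3 by rewrite exprn_ge0// ltW.
  by move=> ?; apply/andP; split; lra.
- case/andP: h => h1 h2.
  have p1 : 0 <= (y + w) ^+ 3 by apply: exprn_ge0; lra.
  have p2 : (y + w) ^+ 3 <= w ^+ 3 by rewrite lerXn2r ?nnegrE; lra.
  by apply/andP; split; lra.
- case/andP: h => h1 h2.
  have p1 : 0 <= (w - y) ^+ 3 by apply: exprn_ge0; lra.
  have p2 : (w - y) ^+ 3 <= w ^+ 3 by rewrite lerXn2r ?nnegrE; lra.
  have -> : (y + w) ^+ 3 - 2 * y ^+ 3 + 0 ^+ 3 = y * (6 * w ^+ 2) + (w - y) ^+ 3 by ring.
  by apply/andP; split; lra.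
- have : 0 <= w ^+ 3 by rewrite exprn_ge0// ltW.
  have -> : (y + w) ^+ 3 - 2 * y ^+ 3 + (y - w) ^+ 3 = y * (6 * w ^+ 2) by ring.
  by move=> ?; apply/andP; split; lra.
Qed.

Lemma smooth_ramp'_bound w y : 0 < w -> 0 <= smooth_ramp' w y <= 1.
Proof.
move=> w0; rewrite /smooth_ramp'.
have q0 : 0 < 2 * w ^+ 2 by rewrite mulr_gt0// exprn_gt0.
rewrite ler_pdivlMr// ler_pdivrMr//.
have : 0 <= w ^+ 2 by rewrite exprn_ge0// ltW.
case: (ramp_window y w0) => -[h -> -> ->] ?.
- by apply/andP; split; lra.
- case/andP: h => h1 h2.
  have p1 : 0 <= (y + w) ^+ 2 by exact: sqr_ge0.
  have p2 : (y + w) ^+ 2 <= w ^+ 2 by rewrite lerXn2r ?nnegrE; lra.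
  by apply/andP; split; lra.
- case/andP: h => h1 h2.
  have p1 : 0 <= (w - y) ^+ 2 by exact: sqr_ge0.
  have p2 : (w - y) ^+ 2 <= w ^+ 2 by rewrite lerXn2r ?nnegrE; lra.
  have -> : (y + w) ^+ 2 - 2 * y ^+ 2 + 0 ^+ 2 = 2 * w ^+ 2 - (w - y) ^+ 2 by ring.
  by apply/andP; split; lra.
- by apply/andP; split; lra.
Qed.

Lemma smooth_ramp'_left w y : 0 < w -> y <= - w -> smooth_ramp' w y = 0.
Proof.
by move=> w0 yw; rewrite /smooth_ramp' !ramp_le0E; [field; rewrite gt_eqF|lra..].
Qed.

Lemma smooth_ramp'_right w y : 0 < w -> w <= y -> smooth_ramp' w y = 1.
Proof.
by move=> w0 yw; rewrite /smooth_ramp' !ramp_ge0E; [field; rewrite gt_eqF|lra..].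
Qed.

(** The cube of the positive part has a Lipschitz second derivative. *)
Lemma ramp_cube_taylor x z :
  `|ramp (x + z) ^+ 3 / 6 - ramp x ^+ 3 / 6 - ramp x ^+ 2 / 2 * z - ramp x * z ^+ 2 / 2|
    <= `|z| ^+ 3 / 6.
Proof.
have cube (p q : R) : 0 <= p -> p <= q -> p ^+ 3 / 6 <= q ^+ 3 / 6.
  move=> p0 pq; rewrite ler_wpM2r// lerXn2r ?nnegrE//; exact: le_trans pq.
case: (ramp_cases x) => -[hx ->]; case: (ramp_cases (x + z)) => -[hz ->].
- by rewrite (_ : _ - _ = z ^+ 3 / 6) ?normrM ?normrX ?(ger0_norm (_ : 0 <= 6^-1))//; field.
- have z0 : z < 0 by lra.
  have a1 := cube (- (x + z)) (- z); have a2 : 0 <= (- (x + z)) ^+ 3 by apply: exprn_ge0; lra.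
  rewrite (ltr0_norm z0) (_ : _ - _ = (z ^+ 3 - (x + z) ^+ 3) / 6); last by field.
  have e1 : (- (x + z)) ^+ 3 = - (x + z) ^+ 3 by ring.
  have e2 : (- z) ^+ 3 = - z ^+ 3 by ring.
  rewrite e1 e2 in a1 a2 *.
  have : - (x + z) ^+ 3 / 6 <= - z ^+ 3 / 6 by apply: a1; lra.
  by move=> ?; rewrite ler0_norm; lra.
- have z0 : 0 <= z by lra.
  have a1 : (x + z) ^+ 3 / 6 <= z ^+ 3 / 6 by apply: cube; lra.
  have a2 : 0 <= (x + z) ^+ 3 by exact: exprn_ge0.
  by rewrite (ger0_norm z0) ger0_norm; lra.
- by rewrite (_ : _ - _ = 0) ?normr0 ?mulr_ge0 ?exprn_ge0//; ring.
Qed.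

Lemma smooth_ramp_taylor w y z : 0 < w ->
  `|smooth_ramp w (y + z) - smooth_ramp w y - smooth_ramp' w y * z
     - tent w y / w * z ^+ 2 / 2| <= w ^- 2 * `|z| ^+ 3.
Proof.
move=> w0; have wN0 : w != 0 by rewrite gt_eqF.
have t1 := ramp_cube_taylor (y + w) z.
have t2 := ramp_cube_taylor y z.
have t3 := ramp_cube_taylor (y - w) z.
set r1 := _ - _ in t1; set r2 := _ - _ in t2; set r3 := _ - _ in t3.
have -> : smooth_ramp w (y + z) - smooth_ramp w y - smooth_ramp' w y * z
     - tent w y / w * z ^+ 2 / 2 = w ^- 2 * (r1 - 2 * r2 + r3).
  rewrite /smooth_ramp /smooth_ramp' /tent /r1 /r2 /r3 (addrAC y z w) (addrAC y z (- w)).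
  by field.
rewrite normrM normrV ?unitfE ?expf_neq0// (ger0_norm (sqr_ge0 w)).
rewrite ler_wpM2l ?invr_ge0 ?sqr_ge0//.
apply: le_trans (ler_normD _ _) _.
have := ler_normB r1 (2 * r2); rewrite normrM (ger0_norm (_ : 0 <= 2))//.
have : 0 <= `|z| ^+ 3 by rewrite exprn_ge0.
lra.
Qed.

Lemma continuous_rampX n (b : R) : continuous (fun y => ramp (y + b) ^+ n).
Proof.
move=> y; apply: (@continuous_comp _ _ _ (fun y => ramp (y + b)) (fun x => x ^+ n)).
  apply: (@continuous_comp _ _ _ (fun y => y + b) ramp).
    by apply: cvgD; [exact: cvg_id|exact: cvg_cst].
  exact: continuous_ramp.
exact: exprn_continuous.
Qed.

Lemma continuous_ramp_second_difference n w (k : R) : continuous (fun y =>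
  (ramp (y + w) ^+ n - 2 * ramp y ^+ n + ramp (y - w) ^+ n) / k).
Proof.
move=> y; apply: cvgM; last exact: cvg_cst.
apply: cvgD; last exact: continuous_rampX.
apply: cvgB; first exact: continuous_rampX.
apply: cvgM; first exact: cvg_cst.
apply: (@continuous_comp _ _ _ ramp (fun x => x ^+ n)); first exact: continuous_ramp.
exact: exprn_continuous.
Qed.

(** A difference of two smoothed ramps is bounded, as the linear growths
    cancel, and its second derivative is a difference of two tents: it is the
    potential that compares the time spent near two places. *)
Lemma jet2_smooth_ramp_diff (k w1 w2 c1 c2 : R) : 0 < w1 -> 0 < w2 ->
  exists K, jet2 K
   (fun y => k * (smooth_ramp w1 (y - c1) - smooth_ramp w2 (y - c2)))
   (fun y => k * (smooth_ramp' w1 (y - c1) - smooth_ramp' w2 (y - c2)))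
   (fun y => k * (tent w1 (y - c1) / w1 - tent w2 (y - c2) / w2)).
Proof.
move=> w10 w20.
pose K := `|k| * (`|c1 - c2| + w1 + w2 + 1 + w1^-1 + w2^-1 + w1 ^- 2 + w2 ^- 2).
have iw1 : 0 < w1^-1 by rewrite invr_gt0.
have iw2 : 0 < w2^-1 by rewrite invr_gt0.
have iiw1 : 0 < w1 ^- 2 by rewrite invr_gt0 exprn_gt0.
have iiw2 : 0 < w2 ^- 2 by rewrite invr_gt0 exprn_gt0.
have c0 := normr_ge0 (c1 - c2).
have shift (f : R -> R) (c : R) : continuous f -> continuous (fun y => f (y - c)).
  move=> cf y; apply: (@continuous_comp _ _ _ (fun y => y - c) f); last exact: cf.
  by apply: cvgB; [exact: cvg_id|exact: cvg_cst].
have diff (f g : R -> R) : continuous f -> continuous g ->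
    continuous (fun y => k * (f (y - c1) - g (y - c2))).
  move=> cf cg y; apply: cvgM; first exact: cvg_cst.
  by apply: cvgB; exact: shift.
exists K; split.
- by rewrite mulr_ge0//; lra.
- move=> y; rewrite normrM ler_wpM2l//.
  have /andP[a1 a2] := smooth_ramp_bound (y - c1) w10.
  have /andP[b1 b2] := smooth_ramp_bound (y - c2) w20.
  have [h|h] := leP c1 c2.
    have hh : y - c2 <= y - c1 by lra.
    have /andP[r1 r2] := ramp_lip hh.
    have : c2 - c1 = `|c1 - c2| by rewrite distrC ger0_norm// subr_ge0.
    by move=> ?; rewrite ler_norml; apply/andP; split; lra.
  have hh : y - c1 <= y - c2 by lra.
  have /andP[r1 r2] := ramp_lip hh.
  have : c1 - c2 = `|c1 - c2| by rewrite ger0_norm// subr_ge0 ltW.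
  by move=> ?; rewrite ler_norml; apply/andP; split; lra.
- move=> y; rewrite normrM ler_wpM2l//.
  have /andP[a1 a2] := smooth_ramp'_bound (y - c1) w10.
  have /andP[b1 b2] := smooth_ramp'_bound (y - c2) w20.
  by rewrite ler_norml; apply/andP; split; lra.
- move=> y; rewrite normrM ler_wpM2l//.
  have a1 : 0 <= tent w1 (y - c1) / w1 by rewrite mulr_ge0 ?tent_ge0 ?ltW.
  have b1 : 0 <= tent w2 (y - c2) / w2 by rewrite mulr_ge0 ?tent_ge0 ?ltW.
  have a2 : tent w1 (y - c1) / w1 <= w1^-1 by rewrite ler_piMl ?tent_le1 ?ltW.
  have b2 : tent w2 (y - c2) / w2 <= w2^-1 by rewrite ler_piMl ?tent_le1 ?ltW.
  by rewrite ler_norml; apply/andP; split; lra.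
- move=> x z.
  have t1 := smooth_ramp_taylor (x - c1) z w10.
  have t2 := smooth_ramp_taylor (x - c2) z w20.
  rewrite !(addrAC x z).
  set r1 := _ - _ in t1; set r2 := _ - _ in t2.
  rewrite (_ : _ - _ = k * (r1 - r2)); last by rewrite /r1 /r2; field; rewrite !gt_eqF.
  rewrite normrM /K -mulrA ler_wpM2l//.
  apply: le_trans (ler_normB _ _) _; apply: le_trans (lerD t1 t2) _.
  by rewrite -mulrDl ler_wpM2r ?exprn_ge0//; lra.
- by apply: diff; exact: continuous_ramp_second_difference.
- by apply: diff; exact: continuous_ramp_second_difference.
- apply: (diff (fun y => tent w1 y / w1) (fun y => tent w2 y / w2)).
    by move=> y; apply: cvgM; [exact: continuous_tent|exact: cvg_cst].
  by move=> y; apply: cvgM; [exact: continuous_tent|exact: cvg_cst].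
Qed.

(** A continuous step, from [0] at [0] to [1] at [w]; tents are the differences
    of consecutive steps. *)
Definition ramp_step w y : R := (ramp y - ramp (y - w)) / w.

Lemma ramp_step_ge0 w y : 0 < w -> 0 <= ramp_step w y.
Proof.
move=> w0; have /ramp_lip/andP[h _] : y - w <= y by lra.
by rewrite divr_ge0// ltW.
Qed.

Lemma ramp_step_le1 w y : 0 < w -> ramp_step w y <= 1.
Proof.
move=> w0; have /ramp_lip/andP[_ h] : y - w <= y by lra.
by rewrite ler_pdivrMr//; lra.
Qed.

Lemma ramp_step0 w y : 0 < w -> y <= 0 -> ramp_step w y = 0.
Proof. by move=> w0 y0; rewrite /ramp_step !ramp_le0E ?subrr ?mul0r//; lra. Qed.

Lemma ramp_step1 w y : 0 < w -> w <= y -> ramp_step w y = 1.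
Proof.
move=> w0 wy; rewrite /ramp_step ramp_ge0E; last by lra.
by rewrite ramp_ge0E; [field; rewrite gt_eqF|lra].
Qed.

Lemma tent_ramp_step w y : tent w y = ramp_step w (y + w) - ramp_step w y.
Proof. by rewrite /tent /ramp_step addrK -mulrBl; congr (_ / _); ring. Qed.

(** The translates of the tent by multiples of its half-width form a partition
    of unity: the sum telescopes. *)
Lemma sum_tent w y (n : nat) : \sum_(i < n) tent w (y - i%:R * w) =
  ramp_step w (y + w) - ramp_step w (y + w - n%:R * w).
Proof.
elim: n => [|n IH]; first by rewrite big_ord0 mul0r subr0 subrr.
rewrite big_ord_recr/= IH tent_ramp_step -natr1.
have -> : y - n%:R * w + w = y + w - n%:R * w by ring.
have -> : y + w - (n%:R + 1) * w = y - n%:R * w by ring.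
by ring.
Qed.

End TentPotentials.

(** * Tail bounds for the times spent in cells *)

Section TailBounds.
Context {R : realType} {d : measure_display} {T : measurableType d}.
Variable P : probability T R.

(** The integral is a limit of Riemann sums, each of which is measurable. *)
Lemma measurable_itg_path (Y : R -> T -> R) (a b : R) : a <= b ->
  (forall t, measurable_fun setT (Y t)) ->
  (forall w, {within `[a, b], continuous (fun t => Y t w)}) ->
  measurable_fun setT (fun w => itg a b (fun t => Y t w)).
Proof.
move=> ab mY cY.
apply: (measurable_fun_cvg (h := fun N w => (b - a) / N.+1%:R *
  \sum_(i < N.+1) Y (a + i%:R * ((b - a) / N.+1%:R)) w)).
  by move=> N; apply: measurable_funM => //; apply: measurable_sum => i; exact: mY.
by move=> w _; exact: riemann_sum_cvg.
Qed.

Lemma measurable_gt (Y : T -> R) (k : R) : measurable_fun setT Y ->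
  measurable [set w | k < Y w].
Proof.
move=> mY; have := mY measurableT _ (measurable_itv `]k, +oo[); rewrite setTI.
rewrite (_ : _ @^-1` _ = [set w | k < Y w])//.
by apply/seteqP; split=> w /=; rewrite in_itv/= andbT.
Qed.

Lemma measurable_lt_real (Y Z : T -> R) : measurable_fun setT Y ->
  measurable_fun setT Z -> measurable [set w | Y w < Z w].
Proof.
move=> mY mZ; rewrite (_ : [set w | _] = [set w | 0 < Z w - Y w]); last first.
  by apply/seteqP; split=> w /=; rewrite subr_gt0.
by apply: measurable_gt; exact: measurable_funB.
Qed.

Lemma chernoff (Y : T -> R) (A : set T) (y : R) : measurable A ->
  measurable_fun setT Y -> (\int[P]_w (expR (Y w))%:E <= 1)%E ->
  (forall w, A w -> y <= Y w) -> (P A <= (expR (- y))%:E)%E.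
Proof.
move=> mA mY EY AY.
have -> : P A = (\int[P]_w (\1_A w)%:E)%E by rewrite integral_indic// setIT.
have mE : measurable_fun setT (fun w => (expR (Y w))%:E).
  by apply/measurable_EFinP; exact: measurableT_comp.
apply: (@le_trans _ _ (\int[P]_w ((expR (- y))%:E * (expR (Y w))%:E))%E).
  apply: ge0_le_integral => //.
  - by apply/measurable_EFinP.
  - exact: emeasurable_funM.
  - move=> w _; rewrite -EFinM lee_fin indicE.
    have [/set_mem Aw|_] := boolP (w \in A); last by rewrite mulr_ge0 ?expR_ge0.
    by rewrite -expRD -[leLHS]expR0 ler_expR addrC subr_ge0; exact: AY.
rewrite ge0_integralZl//.
by rewrite -[leRHS]mule1 lee_wpmul2l// lee_fin expR_ge0.
Qed.

Variable W : R -> {RV P >-> R}.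
Hypothesis bm : brownian_motion W.

Definition tent_time (a b l c : R) (w : T) : R :=
  itg a b (fun t => tent l (W t w - W a w - c)).

Lemma bm_tent_continuous (a b l c : R) (w : T) : 0 <= a ->
  {within `[a, b], continuous (fun t => tent l (W t w - W a w - c))}.
Proof.
move=> a0; apply: (@within_continuous_comp_real _ _ _ (fun x => tent l (x - c))).
  move=> x; apply: (@continuous_comp _ _ _ (fun x => x - c) (tent l)).
    by apply: cvgB; [exact: cvg_id|exact: cvg_cst].
  exact: continuous_tent.
exact: bm_shift_continuous.
Qed.

Lemma measurable_tent_time (a b l c : R) : 0 <= a -> a <= b ->
  measurable_fun setT (tent_time a b l c).
Proof.
move=> a0 ab; apply: measurable_itg_path => //.
  move=> t; apply: measurableT_comp.
    exact: (continuous_measurable_fun (@continuous_tent R l)).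
  by apply: measurable_funB => //; apply: measurable_funB; exact: measurable_funP.
by move=> w; exact: bm_tent_continuous.
Qed.

Lemma measurable_feynman_kac_exponent (F u : R -> R) (a b : R) : 0 <= a -> a <= b ->
  continuous F -> continuous u ->
  measurable_fun setT (fun w => F (W b w - W a w) - F 0 -
     itg a b (fun t => u (W t w - W a w))).
Proof.
move=> a0 ab cF cu.
have mF := continuous_measurable_fun cF; have mu := continuous_measurable_fun cu.
have mX t : measurable_fun setT (fun w => W t w - W a w).
  by apply: measurable_funB; exact: measurable_funP.
apply: measurable_funB; first by apply: measurable_funB => //; exact: measurableT_comp.
apply: measurable_itg_path => //; first by move=> t; exact: measurableT_comp.
move=> w; apply: (@within_continuous_comp_real _ _ _ u) => //.
exact: bm_shift_continuous.
Qed.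

(** Markov's inequality for the exponential functional. *)
Lemma feynman_kac_tail (K : R) F F1 F2 (a b y : R) (A : set T) :
  jet2 K F F1 F2 -> 0 <= a -> a < b -> measurable A ->
  (forall w, A w -> y <= F (W b w - W a w) - F 0 -
     itg a b (fun t => ito_drift F1 F2 (W t w - W a w))) ->
  (P A <= (expR (- y))%:E)%E.
Proof.
move=> jF a0 ab mA AY; have cu := jet2_drift_continuous jF.
apply: (chernoff mA) AY; last exact: (feynman_kac bm jF).
by apply: measurable_feynman_kac_exponent => //; [exact: ltW|exact: (jet2_cont jF)].
Qed.

(** The potential [smooth_ramp tau - smooth_ramp l] has second derivative about
    [- 1 / l] near the level and at most [1 / tau] elsewhere: an excessive time
    near the level makes the exponential functional large. *)
Lemma tent_time_tail (a b tau l c y : R) : 0 <= a -> 0 < l -> l <= tau ->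
  b - a = tau ^+ 2 ->
  (P [set w | 2 * y * (tau * l) < tent_time a b l c w]%R <= (expR (2 - y))%:E)%E.
Proof.
move=> a0 l0 ltau bE.
have tau0 : 0 < tau := lt_le_trans l0 ltau.
have ab : a < b by rewrite -subr_gt0 bE exprn_gt0.
have [K jF] := jet2_smooth_ramp_diff tau^-1 c c tau0 l0.
have mT := measurable_tent_time l c a0 (ltW ab).
rewrite (_ : 2 - y = - (y - 2)); last by ring.
apply: (feynman_kac_tail (a := a) (b := b) jF a0 ab).
  exact: measurable_gt.
move=> w /= Aw.
set X := fun t => W t w - W a w.
rewrite -/(X b).
have bF x : - (1 / 6) <= tau^-1 * (smooth_ramp tau (x - c) - smooth_ramp l (x - c)) <= 1 / 6.
  have /andP[a1 a2] := smooth_ramp_bound (x - c) tau0.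
  have /andP[b1 b2] := smooth_ramp_bound (x - c) l0.
  by rewrite (mulrC tau^-1) ler_pdivrMr// ler_pdivlMr//; apply/andP; split; lra.
have ct m : {within `[a, b], continuous (fun t => tent m (X t - c))}.
  exact: bm_tent_continuous.
have bt m := continuous_bounded_measurable (ct m).
suff : itg a b (fun t => ito_drift
    (fun y => tau^-1 * (smooth_ramp' tau (y - c) - smooth_ramp' l (y - c)))
    (fun y => tau^-1 * (tent tau (y - c) / tau - tent l (y - c) / l)) (X t)) <=
    1 - tent_time a b l c w / (2 * (tau * l)).
  have /andP[f1 f2] := bF (X b); have /andP[g1 g2] := bF 0.
  have : y < tent_time a b l c w / (2 * (tau * l)).
    by rewrite ltr_pdivlMr ?mulr_gt0//; lra.
  lra.
have tl0 : 0 < 2 * (tau * l) by rewrite !mulr_gt0.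
rewrite (_ : 1 - _ = itg a b (fun t => tau ^- 2 - (2 * (tau * l))^-1 * tent l (X t - c))); last first.
  rewrite itgB; [|exact: bounded_measurable_cst|exact: bounded_measurableZ].
  rewrite itgZ// itg_cst ?(ltW ab)// bE mulVf ?expf_neq0 ?gt_eqF//.
  by rewrite mulrC.
apply: le_itg.
- apply: continuous_bounded_measurable.
  apply: (@within_continuous_comp_real _ _ X); first exact: (jet2_drift_continuous jF).
  exact: bm_shift_continuous.
- apply: bounded_measurableB; first exact: bounded_measurable_cst.
  exact: bounded_measurableZ.
move=> t _; rewrite /ito_drift.
set x := X t - c.
have /andP[a1 a2] := smooth_ramp'_bound x tau0.
have /andP[b1 b2] := smooth_ramp'_bound x l0.
have sq : (smooth_ramp' tau x - smooth_ramp' l x) ^+ 2 <= 1.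
  rewrite -real_normK ?num_real// exprn_ile1// ler_norml.
  by apply/andP; split; lra.
have -> : (tau^-1 * (tent tau x / tau - tent l x / l) +
    (tau^-1 * (smooth_ramp' tau x - smooth_ramp' l x)) ^+ 2) / 2 =
  tau ^- 2 * ((tent tau x + (smooth_ramp' tau x - smooth_ramp' l x) ^+ 2) / 2) -
  (2 * (tau * l))^-1 * tent l x by field; rewrite !gt_eqF.
rewrite lerD2r ler_piMr ?invr_ge0 ?sqr_ge0//.
have := tent_le1 x tau0; lra.
Qed.

End TailBounds.

Section TailBoundsDiff.
Context {R : realType} {d : measure_display} {T : measurableType d}.
Variable P : probability T R.
Variable W : R -> {RV P >-> R}.
Hypothesis bm : brownian_motion W.

Lemma measurable_tent_time_diff (a b l c y k th sg : R) : 0 <= a -> a <= b ->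
  measurable [set w | y + k * (tent_time W a b l (c - l) w +
      tent_time W a b l c w + tent_time W a b l (c + l) w + tent_time W a b l (c + 2 * l) w) <
    th * (sg * (tent_time W a b l (c + l) w - tent_time W a b l c w))].
Proof.
move=> a0 ab; have mT c' := measurable_tent_time bm l c' a0 ab.
apply: measurable_lt_real.
  apply: measurable_funD => //; apply: measurable_funM => //.
  by apply: measurable_funD => //; apply: measurable_funD => //; exact: measurable_funD.
by apply: measurable_funM => //; apply: measurable_funM => //; exact: measurable_funB.
Qed.

(** Here the potential is the ramp between two neighbouring levels: its
    gradient is at most [theta * l] and lives near them, so that the quadratic
    term is controlled by the time spent there. *)
Lemma tent_time_diff_tail (a b l theta sg c y : R) : 0 <= a -> a < b -> 0 < l ->
  0 <= theta -> theta * l ^+ 2 <= 1 -> `|sg| = 1 ->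
  (P [set w | y + (theta * l) ^+ 2 / 2 * (tent_time W a b l (c - l) w +
         tent_time W a b l c w + tent_time W a b l (c + l) w + tent_time W a b l (c + 2 * l) w) <
       theta / 2 * (sg * (tent_time W a b l (c + l) w - tent_time W a b l c w))]%R
   <= (expR (4 - y))%:E)%E.
Proof.
move=> a0 ab l0 th0 thl sg1.
have [K jF] := jet2_smooth_ramp_diff (sg * (theta * l)) c (c + l) l0 l0.
have mT c' := measurable_tent_time bm l c' a0 (ltW ab).
rewrite (_ : 4 - y = - (y - 4)); last by ring.
apply: (feynman_kac_tail bm (a := a) (b := b) jF a0 ab).
  exact: (measurable_tent_time_diff _ _ _ _ _ _ a0 (ltW ab)).
move=> w /= Aw.
set X := fun t => W t w - W a w.
rewrite -/(X b).
have bF x : `|sg * (theta * l) * (smooth_ramp l (x - c) - smooth_ramp l (x - (c + l)))| <= 2.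
  have /andP[a1 a2] := smooth_ramp_bound (x - c) l0.
  have /andP[b1 b2] := smooth_ramp_bound (x - (c + l)) l0.
  have hh : x - (c + l) <= x - c by lra.
  have /andP[r1 r2] := ramp_lip hh.
  rewrite !normrM sg1 mul1r (ger0_norm th0) (gtr0_norm l0).
  have : `|smooth_ramp l (x - c) - smooth_ramp l (x - (c + l))| <= 2 * l.
    by rewrite ler_norml; apply/andP; split; lra.
  move=> h; have := ler_wpM2l (mulr_ge0 th0 (ltW l0)) h; lra.
have ct c' : {within `[a, b], continuous (fun t => tent l (X t - c'))}.
  exact: (bm_tent_continuous bm).
have bt c' := continuous_bounded_measurable (ct c').
set F1 := fun y => sg * (theta * l) * (smooth_ramp' l (y - c) - smooth_ramp' l (y - (c + l))).
set F2 := fun y => sg * (theta * l) * (tent l (y - c) / l - tent l (y - (c + l)) / l).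
have : itg a b (fun t => ito_drift F1 F2 (X t)) <=
    theta / 2 * (sg * (tent_time W a b l c w - tent_time W a b l (c + l) w)) +
    (theta * l) ^+ 2 / 2 * (tent_time W a b l (c - l) w +
         tent_time W a b l c w + tent_time W a b l (c + l) w + tent_time W a b l (c + 2 * l) w).
  set G := fun t => theta / 2 * (sg * (tent l (X t - c) - tent l (X t - (c + l)))).
  set H := fun t => (theta * l) ^+ 2 / 2 * (tent l (X t - (c - l)) + tent l (X t - c) +
    tent l (X t - (c + l)) + tent l (X t - (c + 2 * l))).
  have bG' := bounded_measurableB (bt c) (bt (c + l)).
  have bG'' := bounded_measurableZ sg bG'.
  have bG : bounded_measurable a b G by exact: bounded_measurableZ.
  have bH1 := bounded_measurableD (bt (c - l)) (bt c).
  have bH2 := bounded_measurableD bH1 (bt (c + l)).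
  have bH3 := bounded_measurableD bH2 (bt (c + 2 * l)).
  have bH : bounded_measurable a b H by exact: bounded_measurableZ.
  have -> : theta / 2 * (sg * (tent_time W a b l c w - tent_time W a b l (c + l) w)) +
      (theta * l) ^+ 2 / 2 * (tent_time W a b l (c - l) w +
       tent_time W a b l c w + tent_time W a b l (c + l) w + tent_time W a b l (c + 2 * l) w) =
      itg a b (fun t => G t + H t).
    rewrite itgD//; congr (_ + _); first by rewrite /G itgZ// itgZ// itgB.
    by rewrite /H itgZ// itgD// itgD// itgD.
  apply: le_itg.
  - apply: continuous_bounded_measurable.
    apply: (@within_continuous_comp_real _ _ X); first exact: (jet2_drift_continuous jF).
    exact: (bm_shift_continuous bm).
  - exact: bounded_measurableD.
  move=> t _; rewrite /ito_drift /F1 /F2 /G /H.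
  set x := X t - c.
  have -> : X t - (c + l) = x - l by rewrite /x; ring.
  have -> : X t - (c - l) = x + l by rewrite /x; ring.
  have -> : X t - (c + 2 * l) = x - 2 * l by rewrite /x; ring.
  (* The gradient vanishes off [-l, 2 * l], which four tents cover. *)
  have sq : (smooth_ramp' l x - smooth_ramp' l (x - l)) ^+ 2 <=
      tent l (x + l) + tent l x + tent l (x - l) + tent l (x - 2 * l).
    have t1 := tent_ge0 (x + l) l0; have t2 := tent_ge0 x l0.
    have t3 := tent_ge0 (x - l) l0; have t4 := tent_ge0 (x - 2 * l) l0.
    have [h1|h1] := leP x (- l).
      by rewrite !smooth_ramp'_left//; [lra|lra].
    have [h2|h2] := leP (2 * l) x.
      by rewrite !smooth_ramp'_right//; [lra|lra|lra].
    have : tent l (x + l) + tent l x + tent l (x - l) + tent l (x - 2 * l) = 1.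
      have := sum_tent l (x + l) 4; rewrite !big_ord_recr big_ord0/=.
      rewrite mul0r subr0 mul1r add0r.
      have -> : x + l - l = x by ring.
      have -> : x + l - 2 * l = x - l by ring.
      have -> : x + l - 3 * l = x - 2 * l by ring.
      by move=> ->; rewrite ramp_step1 ?ramp_step0 ?subr0//; lra.
    move=> ->.
    have /andP[a1 a2] := smooth_ramp'_bound x l0.
    have /andP[b1 b2] := smooth_ramp'_bound (x - l) l0.
    rewrite -real_normK ?num_real// exprn_ile1// ler_norml.
    by apply/andP; split; lra.
  have sg2 : sg ^+ 2 = 1 by rewrite -real_normK ?num_real// sg1 expr1n.
  have -> : (sg * (theta * l) * (tent l x / l - tent l (x - l) / l) +
     (sg * (theta * l) * (smooth_ramp' l x - smooth_ramp' l (x - l))) ^+ 2) / 2 =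
     theta / 2 * (sg * (tent l x - tent l (x - l))) + (theta * l) ^+ 2 / 2 *
      (smooth_ramp' l x - smooth_ramp' l (x - l)) ^+ 2.
    by rewrite !exprMn sg2; field; rewrite gt_eqF.
  by rewrite lerD2l ler_wpM2l// divr_ge0// sqr_ge0.
have := bF (X b); have := bF 0; rewrite !ler_norml => /andP[f1 f2] /andP[g1 g2].
rewrite -[tent_time W a b l c w - _]opprB mulrN mulrN.
by move: Aw; lra.
Qed.

End TailBoundsDiff.

Section TailBoundsIncrement.
Context {R : realType} {d : measure_display} {T : measurableType d}.
Variable P : probability T R.
Variable W : R -> {RV P >-> R}.
Hypothesis bm : brownian_motion W.

(** Markov's inequality for the exponentials of both signs. *)
Lemma bm_increment_tail (a b tau y : R) : 0 <= a -> 0 < tau -> b - a = tau ^+ 2 ->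
  (P [set w | y * tau < `|W b w - W a w|]%R <= (expR (2 - y))%:E)%E.
Proof.
move=> a0 tau0 bE.
have ab : a < b by rewrite -subr_gt0 bE exprn_gt0.
have tN0 : tau != 0 by rewrite gt_eqF.
pose B := [set x : R | y * tau < `|x|].
have mB : measurable B.
  apply: (measurable_gt (T := R) (Y := fun x : R => `|x|)).
  exact: measurableT_comp.
have -> : P [set w | y * tau < `|W b w - W a w|] = normal_prob 0 tau B.
  by rewrite (bm_normal_increments bm a0 ab mB) bE sqrtr_sqr gtr0_norm.
have -> : normal_prob 0 tau B = (\int[normal_prob 0 tau]_x (\1_B x)%:E)%E.
  by rewrite integral_indic// setIT.
have mE (c : R) : measurable_fun setT (fun x : measurableTypeR R => (expR (- y))%:E * (expR (c * x))%:E)%E.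
  by apply: emeasurable_funM => //; apply/measurable_EFinP; apply: measurableT_comp.
apply: (@le_trans _ _ (\int[normal_prob 0 tau]_x
    ((expR (- y))%:E * (expR (tau^-1 * x))%:E +
     (expR (- y))%:E * (expR ((- tau^-1) * x))%:E))%E).
  apply: ge0_le_integral => //.
  - by apply/measurable_EFinP.
  - by apply: emeasurable_funD.
  - move=> x _; rewrite -!EFinM -EFinD lee_fin indicE -!expRD.
    have [/set_mem Bx|_] := boolP (x \in B); last by rewrite addr_ge0 ?expR_ge0.
    have [x0|x0] := leP 0 x.
      apply: (@le_trans _ _ (expR (- y + tau^-1 * x))); last by rewrite lerDl expR_ge0.
      rewrite -[leLHS]expR0 ler_expR addrC subr_ge0 mulrC ler_pdivlMr//.
      by move: Bx; rewrite /B/= ger0_norm// => /ltW.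
    apply: (@le_trans _ _ (expR (- y + (- tau^-1) * x))); last by rewrite lerDr expR_ge0.
    rewrite -[leLHS]expR0 ler_expR addrC subr_ge0 mulNr -mulrN mulrC ler_pdivlMr//.
    by move: Bx; rewrite /B/= ltr0_norm// => /ltW.
rewrite ge0_integralD//=.
rewrite !ge0_integralZl//.
rewrite !normal_mgf// sqrrN.
have -> : tau^-1 ^+ 2 * tau ^+ 2 / 2 = 1 / 2 by field.
rewrite -EFinM -EFinD lee_fin (_ : 2 - y = - y + 1 / 2 + 3 / 2); last by field.
rewrite !expRD -[X in X <= _]mulr2n -[X in X <= _]mulr_natr ler_wpM2l//.
  by have := expR_ge1Dx (3 / 2 : R); lra.
all: by apply/measurable_EFinP; apply: measurableT_comp.
Qed.

End TailBoundsIncrement.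

(** * The time spent near a curve during one block *)

Section TentWindows.
Context {R : realType}.
Implicit Types (l v : R) (J : nat).

(** A trapezoid made of consecutive tents: [1] up to distance [J * l] and [0] from
    distance [J.+1 * l] on. *)
Definition tent_window l J v : R :=
  \sum_(i < (2 * J).+1) tent l (v - (i%:R - J%:R) * l).

Lemma tent_windowE l J v : tent_window l J v =
  ramp_step l (v + J%:R * l + l) - ramp_step l (v - J%:R * l).
Proof.
rewrite /tent_window.
rewrite (eq_bigr (fun i : 'I_ _ => tent l (v + J%:R * l - i%:R * l))); last first.
  by move=> i _; congr (tent l _); ring.
rewrite sum_tent -natr1 natrM.
by congr (_ - ramp_step l _); ring.
Qed.

Lemma tent_window_ge0 l J v : 0 < l -> 0 <= tent_window l J v.
Proof. by move=> l0; apply: sumr_ge0 => i _; exact: tent_ge0. Qed.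

Lemma tent_window_le1 l J v : 0 < l -> tent_window l J v <= 1.
Proof.
move=> l0; rewrite tent_windowE.
have := ramp_step_le1 (v + J%:R * l + l) l0.
have := ramp_step_ge0 (v - J%:R * l) l0; lra.
Qed.

Lemma tent_window1 l J v : 0 < l -> `|v| <= J%:R * l -> tent_window l J v = 1.
Proof.
move=> l0; rewrite ler_norml => /andP[v1 v2]; rewrite tent_windowE.
by rewrite ramp_step1 ?ramp_step0 ?subr0//; lra.
Qed.

Lemma tent_window0 l J v : 0 < l -> J.+1%:R * l <= `|v| -> tent_window l J v = 0.
Proof.
move=> l0; rewrite -natr1 => vJ; rewrite tent_windowE.
have J0 : 0 <= J%:R * l by rewrite mulr_ge0// ltW.
have [v0|v0] := leP 0 v.
  move: vJ; rewrite ger0_norm// => vJ.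
  by rewrite !ramp_step1 ?subrr//; lra.
move: vJ; rewrite ltr0_norm// => vJ.
by rewrite !ramp_step0 ?subrr//; lra.
Qed.

End TentWindows.

Section NearTime.
Context {R : realType}.
Implicit Types (w f : R -> R) (r a b : R).

Definition near_time w f r a b : R :=
  itg a b (fun s => (`|w s - f s| < r)%R%:R).

Lemma near_bounded_measurable w f r a b :
  {within `[a, b], continuous w} -> {within `[a, b], continuous f} ->
  bounded_measurable a b (fun s => (`|w s - f s| < r)%R%:R : R).
Proof.
move=> cw cf; split; last by exists 1 => s _; case: (_ < _); rewrite ?normr1 ?normr0.
have cwf : {within `[a, b], continuous (fun s => w s - f s)}.
  by move=> s; apply: cvgB; [exact: cw|exact: cf].
have [mwf _] := continuous_bounded_measurable cwf.
have mn : measurable_fun `[a, b] (fun s => `|w s - f s|) by exact: measurableT_comp.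
have mlt : measurable_fun `[a, b] (fun s => `|w s - f s| < r).
  by apply: measurable_fun_ltr.
apply: (measurableT_comp (f := fun c : bool => c%:R : R)) => //.
Qed.

End NearTime.

Section BlockEstimate.
Context {R : realType}.
Variables (w f : R -> R) (p q l r be e : R) (M : nat).
Hypotheses (pq : p <= q) (l0 : 0 < l).
Hypotheses (cw : {within `[p, q], continuous w})
           (cf : {within `[p, q], continuous f}).

Definition cell_time (m : int) : R :=
  itg p q (fun s => tent l (w s - w p - m%:~R * l)).

Hypothesis cell_ub : forall m : int, `|m| <= M%:Z -> cell_time m <= be.
Hypothesis cell_step : forall m : int, `|m| <= M%:Z ->
  `|cell_time (m + 1) - cell_time m| <= e.
Hypothesis f_osc : forall s, p <= s <= q -> `|f s - f p| <= l.

(* The cell that contains the curve at the start of the block. *)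
Let m0 : int := Num.floor ((f p - w p) / l).

Lemma cell_time_ge0 m : 0 <= cell_time m.
Proof. by apply: itg_ge0 => s _; exact: tent_ge0. Qed.

Lemma cell_bounded_measurable (m : int) :
  bounded_measurable p q (fun s => tent l (w s - w p - m%:~R * l)).
Proof.
apply: continuous_bounded_measurable.
apply: (@within_continuous_comp_real _ _ _ (fun z => tent l (z - w p - m%:~R * l))) => //.
move=> z; apply: (@continuous_comp _ _ _ (fun z => z - w p - m%:~R * l) (tent l)).
  by apply: cvgB; [apply: cvgB; [exact: cvg_id|exact: cvg_cst]|exact: cvg_cst].
exact: continuous_tent.
Qed.

(** Neighbouring cells are compared one step at a time. *)
Lemma cell_time_near (m : int) (j : nat) : `|m| + j%:Z <= M%:Z ->
  `|cell_time (m + j%:Z) - cell_time m| <= j%:R * e /\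
  `|cell_time (m - j%:Z) - cell_time m| <= j%:R * e.
Proof.
elim: j => [_|j IH mj].
  by rewrite !(addr0, subr0) subrr normr0 mul0r.
have [|h1 h2] := IH; first by lia.
rewrite -natr1 mulrDl mul1r; split.
  have := ler_distD (cell_time (m + j%:Z)) (cell_time (m + j.+1%:Z)) (cell_time m).
  have : `|cell_time (m + j.+1%:Z) - cell_time (m + j%:Z)| <= e.
    by rewrite (_ : m + j.+1%:Z = m + j%:Z + 1); [apply: cell_step; lia|lia].
  lra.
have := ler_distD (cell_time (m - j%:Z)) (cell_time (m - j.+1%:Z)) (cell_time m).
have : `|cell_time (m - j.+1%:Z) - cell_time (m - j%:Z)| <= e.
  rewrite distrC (_ : m - j%:Z = m - j.+1%:Z + 1); [apply: cell_step; lia|lia].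
lra.
Qed.

Definition window_time (J : nat) : R :=
  itg p q (fun s => tent_window l J (w s - w p - m0%:~R * l)).

Lemma shifted_cellE (i J : nat) :
  (fun s => tent l (w s - w p - m0%:~R * l - (i%:R - J%:R) * l)) =
  (fun s => tent l (w s - w p - (m0 + (i%:Z - J%:Z))%:~R * l)).
Proof. by apply/funext => s; congr (tent l _); rewrite intrD intrB; ring. Qed.

Lemma window_bounded_measurable J :
  bounded_measurable p q (fun s => tent_window l J (w s - w p - m0%:~R * l)).
Proof.
by apply: bounded_measurable_sum => i; rewrite shifted_cellE; exact: cell_bounded_measurable.
Qed.

Lemma window_timeE J : window_time J =
  \sum_(i < (2 * J).+1) cell_time (m0 + (i%:Z - J%:Z)).
Proof.
rewrite /window_time /tent_window itg_sum//.
  by apply: eq_bigr => i _; rewrite shifted_cellE.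
by move=> i; rewrite shifted_cellE; exact: cell_bounded_measurable.
Qed.

Lemma window_time_dist J : `|m0| + J%:Z <= M%:Z ->
  `|window_time J - (2 * J).+1%:R * cell_time m0| <= (2 * J).+1%:R * (J%:R * e).
Proof.
move=> mJ.
have e0 : 0 <= e by apply: le_trans (normr_ge0 _) (cell_step (m := m0) _); lia.
rewrite window_timeE mulr_natl -[X in _ *+ X]card_ord -sumr_const -sumrB.
apply: le_trans (ler_norm_sum _ _ _) _.
rewrite mulr_natl -[X in _ *+ X]card_ord -sumr_const; apply: ler_sum => i _.
have iJ := ltn_ord i.
have [Ji|iJ'] := leqP J i.
  have [|h _] := @cell_time_near m0 (i - J)%N; first by lia.
  rewrite (_ : m0 + (i%:Z - J%:Z) = m0 + (i - J)%N%:Z); last by lia.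
  by apply: (le_trans h); rewrite ler_wpM2r// ler_nat; lia.
have [|_ h] := @cell_time_near m0 (J - i)%N; first by lia.
rewrite (_ : m0 + (i%:Z - J%:Z) = m0 - (J - i)%N%:Z); last by lia.
by apply: (le_trans h); rewrite ler_wpM2r// ler_nat; lia.
Qed.

Lemma window_time_ub J : `|m0| + J%:Z <= M%:Z ->
  window_time J <= (2 * J).+1%:R * be.
Proof.
move=> mJ; rewrite window_timeE mulr_natl -[X in _ *+ X]card_ord -sumr_const.
by apply: ler_sum => i _; apply: cell_ub; have := ltn_ord i; lia.
Qed.

Lemma dist_level s : p <= s <= q ->
  `|w s - w p - m0%:~R * l - (w s - f s)| <= 2 * l.
Proof.
move=> /f_osc fs.
have /andP[h1 h2] := floor_itv ((f p - w p) / l).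
move: h1 h2; rewrite -/m0 ler_pdivlMr// ltr_pdivrMr// intrD mulrDl mul1r => h1 h2.
rewrite (_ : _ - _ = (f s - f p) + (f p - w p - m0%:~R * l)); last by ring.
apply: le_trans (ler_normD _ _) _.
have : `|f p - w p - m0%:~R * l| <= l by rewrite ger0_norm; lra.
lra.
Qed.

Lemma near_time_le_window J : r + 2 * l <= J%:R * l ->
  near_time w f r p q <= window_time J.
Proof.
move=> rJ; apply: le_itg.
- exact: near_bounded_measurable.
- exact: window_bounded_measurable.
move=> s /dist_level ds; have [h|_] := ltP; last exact: tent_window_ge0.
rewrite tent_window1//.
have := ler_normD (w s - w p - m0%:~R * l - (w s - f s)) (w s - f s).
rewrite subrK; lra.
Qed.

Lemma window_le_near_time J : J.+1%:R * l + 2 * l <= r ->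
  window_time J <= near_time w f r p q.
Proof.
move=> rJ; apply: le_itg.
- exact: window_bounded_measurable.
- exact: near_bounded_measurable.
move=> s /dist_level ds; have [h|h] := ltP; first exact: tent_window_le1.
rewrite tent_window0//.
have := ler_normB (w s - w p - m0%:~R * l) (w s - w p - m0%:~R * l - (w s - f s)).
rewrite opprB addrC subrK; lra.
Qed.

(** The time spent within [r] of the curve is about the number of cells in a
    window of radius [r] times the time spent in one cell. *)
Lemma near_time_density : 4 * l <= r -> `|m0| + (Num.truncn (r / l) + 3)%:Z <= M%:Z ->
  `|near_time w f r p q / (2 * r) - cell_time m0 / l| <=
    7 * be / (2 * r) + 2 / l * ((r / l + 3) * e).
Proof.
move=> lr mJ.
have r0 : 0 < r by apply: lt_le_trans lr; rewrite mulr_gt0.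
have e0 : 0 <= e by apply: le_trans (normr_ge0 _) (cell_step (m := m0) _); lia.
have rl0 : 0 <= r / l by rewrite divr_ge0// ltW.
set Q := Num.truncn (r / l) in mJ *.
have /andP[Q1 Q2] : Q%:R <= r / l < Q.+1%:R by exact: truncn_itv.
have Q3 : (3 <= Q)%N.
  have : 4 <= r / l by rewrite ler_pdivlMr.
  have := Q2 => h1 h2; have := le_lt_trans h2 h1.
  by rewrite ltr_nat ltnS; apply: leq_trans.
have lE : r = r / l * l by rewrite divfK// gt_eqF.
rewrite -natr1 in Q2.
set u := r / l in rl0 Q1 Q2 lE *.
set T0 := cell_time m0.
have T00 : 0 <= T0 by exact: cell_time_ge0.
have mM : `|m0| <= M%:Z by apply: le_trans mJ; rewrite lerDl.
have T0b : T0 <= be by exact: cell_ub.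
(* Rounding [r / l], the motion of the curve during the block and its position
   inside the cell [m0] change the radius of the window by at most three cells. *)
have UB : near_time w f r p q <= (2 * u + 7) * (T0 + (u + 3) * e).
  have J1 : r + 2 * l <= (Q + 3)%:R * l.
    rewrite {1}lE natrD.
    by have := ler_wpM2r (ltW l0) (ltW Q2); lra.
  apply: (le_trans (near_time_le_window J1)).
  have := window_time_dist mJ; rewrite -/T0 ler_norml => /andP[_ h].
  have JE : (2 * (Q + 3)).+1%:R <= 2 * u + 7 :> R.
    by rewrite -(natr1 (2 * (Q + 3))%N) natrM natrD; lra.
  have Je : (Q + 3)%:R * e <= (u + 3) * e by rewrite ler_wpM2r// natrD; lra.
  apply: (@le_trans _ _ ((2 * (Q + 3)).+1%:R * (T0 + (Q + 3)%:R * e))); first by lra.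
  by rewrite ler_pM// ?lerD2l// addr_ge0// mulr_ge0.
have LB : (2 * u - 7) * T0 - (2 * u + 7) * ((u + 3) * e) <= near_time w f r p q.
  have J1 : (Q - 3).+1%:R * l + 2 * l <= r.
    rewrite [leRHS]lE -natr1 natrB//.
    by have := ler_wpM2r (ltW l0) Q1; lra.
  apply: le_trans (window_le_near_time J1).
  have mJ' : `|m0| + (Q - 3)%:Z <= M%:Z.
    by apply: le_trans mJ; rewrite lerD2l lez_nat (leq_trans (leq_subr _ _) (leq_addr _ _)).
  have := window_time_dist mJ'; rewrite -/T0 ler_norml => /andP[h _].
  have JE : 2 * u - 7 <= (2 * (Q - 3)).+1%:R :> R.
    by rewrite -(natr1 (2 * (Q - 3))%N) natrM natrB//; lra.
  have JE' : (2 * (Q - 3)).+1%:R <= 2 * u + 7 :> R.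
    by rewrite -(natr1 (2 * (Q - 3))%N) natrM natrB//; lra.
  have Je : (Q - 3)%:R * e <= (u + 3) * e by rewrite ler_wpM2r// natrB//; lra.
  have h1 := ler_wpM2r T00 JE.
  have h2 : (2 * (Q - 3)).+1%:R * ((Q - 3)%:R * e) <= (2 * u + 7) * ((u + 3) * e).
    by rewrite ler_pM// mulr_ge0.
  lra.
set E := (u + 3) * e in UB LB *.
have E0 : 0 <= E by rewrite mulr_ge0//; lra.
have u4 : 4 <= u by rewrite /u ler_pdivlMr.
have -> : near_time w f r p q / (2 * r) - T0 / l =
  (near_time w f r p q - 2 * u * T0) / (2 * r).
  by rewrite [in RHS]/u; field; rewrite !gt_eqF.
have -> : 7 * be / (2 * r) + 2 / l * E = (7 * be + 4 * u * E) / (2 * r).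
  by rewrite /u; field; rewrite !gt_eqF.
have r20 : 0 < 2 * r by lra.
have ir0 : 0 < (2 * r)^-1 by rewrite invr_gt0.
rewrite normrM (gtr0_norm ir0) ler_wpM2r ?(ltW ir0)//.
have uE : 4 * E <= u * E by rewrite ler_wpM2r.
by rewrite ler_norml; apply/andP; split; lra.
Qed.

End BlockEstimate.

(** * Comparison of the densities at one scale *)

Section OneScale.
Context {R : realType}.

Definition curve_density (w f : R -> R) (r t : R) : R :=
  near_time w f r 0 t / (2 * r).

Variables (w f : R -> R) (x tau : R) (N M : nat).

(* The lengths [l], [ep], [tau] and [rho] are separated by powers of [x]: a tube
   of radius [ep] is many cells wide, and yet a path that visits it during a block,
   over which it moves by about [tau / x], stays within [rho] of the curve. *)
Let h := tau ^+ 2.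
Let l := x ^+ 16 * tau.
Let ep := x ^+ 12 * tau.
Let rho := 18 * tau / x.
Let node (k : nat) := k%:R * h.

Hypotheses (Nh : N%:R * h = 1) (x0 : 0 < x) (x4 : x ^+ 4 <= 8^-1)
  (tau0 : 0 < tau) (taux : tau <= x ^+ 3) (Mx : 14 <= M%:R * x ^+ 17).
Hypotheses (cw : {within `[0, 1], continuous w})
           (cf : {within `[0, 1], continuous f}).
Hypothesis w_osc : forall k s, (k < N)%N -> node k <= s <= node k.+1 ->
  `|w s - w (node k)| <= 8 * tau / x.
Hypothesis cell_ub : forall k (m : int), (k < N)%N -> `|m| <= M%:Z ->
  cell_time w (node k) (node k.+1) l m <= tau * l / x.
Hypothesis cell_step : forall k (m : int), (k < N)%N -> `|m| <= M%:Z ->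
  `|cell_time w (node k) (node k.+1) l (m + 1) - cell_time w (node k) (node k.+1) l m|
    <= 6 * tau * l * x ^+ 7.
Hypothesis f_hold : forall s t, 0 <= s <= 1 -> 0 <= t <= 1 -> `|s - t| <= h ->
  `|f s - f t| <= l.

Let h0 : 0 < h. Proof. by rewrite exprn_gt0. Qed.
Let l0 : 0 < l. Proof. by rewrite mulr_gt0 ?exprn_gt0. Qed.
Let ep0 : 0 < ep. Proof. by rewrite mulr_gt0 ?exprn_gt0. Qed.
Let x1 : x <= 1.
Proof.
rewrite leNgt; apply/negP => x1; have : 1 <= x ^+ 4 by rewrite exprn_ege1// ltW.
by move: x4; lra.
Qed.
Let lep : 8 * l <= ep.
Proof.
rewrite /l /ep (_ : x ^+ 16 = x ^+ 12 * x ^+ 4) -?exprD//.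
rewrite (_ : 8 * _ = (x ^+ 12 * tau) * (8 * x ^+ 4)); last by ring.
by rewrite ler_piMr ?(ltW ep0)//; move: x4; lra.
Qed.
Let ept : ep <= tau / x.
Proof.
rewrite /ep mulrC ler_wpM2l ?(ltW tau0)//.
rewrite (le_trans (exprn_ile1 _ _ _))// ?(ltW x0)//.
by rewrite invf_ge1.
Qed.

Let node_ge0 k : 0 <= node k. Proof. by rewrite mulr_ge0// ltW. Qed.
Let node_le k j : (k <= j)%N -> node k <= node j.
Proof. by move=> kj; rewrite ler_wpM2r ?(ltW h0)// ler_nat. Qed.
Let node_le1 k : (k <= N)%N -> node k <= 1.
Proof. by move=> kN; rewrite -Nh; exact: node_le. Qed.
Let nodeS k : node k.+1 - node k = h.
Proof. by rewrite /node -natr1; ring. Qed.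

Let sub_cont (g : R -> R) (a b : R) : 0 <= a -> b <= 1 ->
  {within `[0, 1], continuous g} -> {within `[a, b], continuous g}.
Proof.
move=> a0 b1; apply: continuous_subspaceW => s /=; rewrite !in_itv/= => /andP[as_ sb].
by rewrite (le_trans a0 as_) (le_trans sb b1).
Qed.

Let near_bm (r a b : R) : 0 <= a -> b <= 1 ->
  bounded_measurable a b (fun s => (`|w s - f s| < r)%R%:R : R).
Proof. by move=> a0 b1; apply: near_bounded_measurable; [exact: (sub_cont a0 b1 cw)|exact: (sub_cont a0 b1 cf)]. Qed.

Lemma near_time_ge0 r a b : 0 <= near_time w f r a b.
Proof. by apply: itg_ge0 => s _; case: (_ < _). Qed.

Lemma le_near_time r a b c : 0 <= a -> a <= b -> b <= c -> c <= 1 ->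
  near_time w f r a b <= near_time w f r a c.
Proof.
move=> a0 ab bc c1; apply: le_itg_itv => //; exact: near_bm.
Qed.

Definition active k := exists2 s, node k <= s <= node k.+1 & `|w s - f s| < ep.

Lemma near_time_inactive k r t : (k < N)%N -> ~ active k -> r <= ep ->
  node k <= t <= node k.+1 -> near_time w f r (node k) t = 0.
Proof.
move=> kN nak rep /andP[kt tk]; rewrite /near_time -[RHS](mul0r (t - node k)) -itg_cst//.
apply: eq_itg => s /andP[ks st]; case: ltP => // h1; exfalso; apply: nak.
by exists s; [rewrite ks/= (le_trans st)|exact: lt_le_trans rep].
Qed.

Let block01 k s : (k < N)%N -> node k <= s <= node k.+1 -> 0 <= s <= 1.
Proof.
by move=> kN /andP[ks sk]; rewrite (le_trans _ ks) ?node_ge0//= (le_trans sk)// node_le1.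
Qed.

Let block_dist k s t : node k <= s <= node k.+1 -> node k <= t <= node k.+1 ->
  `|s - t| <= h.
Proof.
move=> /andP[a1 a2] /andP[b1 b2]; rewrite -(nodeS k) ler_norml.
by apply/andP; split; lra.
Qed.

Let f_block k s t : (k < N)%N -> node k <= s <= node k.+1 ->
  node k <= t <= node k.+1 -> `|f s - f t| <= l.
Proof.
by move=> kN sk tk; apply: f_hold; [exact: block01 sk|exact: block01 tk|exact: block_dist tk].
Qed.

Let node_block k : node k <= node k <= node k.+1.
Proof. by rewrite lexx node_le. Qed.

(** On a block of which a point is within [ep] of the curve, the oscillations of
    the path and of the curve keep the distance below [rho]. *)
Lemma near_time_active k : (k < N)%N -> active k ->
  near_time w f rho (node k) (node k.+1) = h.
Proof.
move=> kN [s sk hs]; rewrite /near_time -(nodeS k) -[RHS]mul1r -itg_cst ?node_le//.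
apply: eq_itg => t tk; rewrite (_ : (_ < _) = true)//.
have d1 := w_osc kN sk; have d2 := w_osc kN tk; have d3 := f_block kN sk tk.
have -> : w t - f t = (w t - w (node k)) - (w s - w (node k)) + (w s - f s) + (f s - f t) by ring.
have := ler_normD (w t - w (node k) - (w s - w (node k)) + (w s - f s)) (f s - f t).
have := ler_normD (w t - w (node k) - (w s - w (node k))) (w s - f s).
have := ler_normB (w t - w (node k)) (w s - w (node k)).
have h1 := ept; have h2 := lep; have h3 := l0; rewrite /rho -!mulrA in d1 d2 *.
move: d1 d2 d3 hs h1 h2 h3; set q := tau / x; lra.
Qed.

(** Near the curve the path is, hence the curve is too, within [10 * tau / x] of
    the starting point of the block: the bound on [M] puts the cells of the tube
    among those that are controlled. *)
Lemma active_cell_index k r : (k < N)%N -> active k -> r <= ep -> 0 < r ->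
  `|Num.floor ((f (node k) - w (node k)) / l)| + (Num.truncn (r / l) + 3)%:Z <= M%:Z.
Proof.
move=> kN [s sk hs] rep r0.
have d1 := w_osc kN sk; have d3 := f_block kN sk (node_block k).
have d : `|f (node k) - w (node k)| <= 10 * (tau / x).
  have -> : f (node k) - w (node k) = (w s - w (node k)) - (w s - f s) - (f s - f (node k)) by ring.
  have := ler_normB (w s - w (node k) - (w s - f s)) (f s - f (node k)).
  have := ler_normB (w s - w (node k)) (w s - f s).
  have h1 := ept; have h2 := lep; have h3 := l0; rewrite -!mulrA in d1 *.
  move: d1 d3 hs h1 h2 h3; set q := tau / x; lra.
set v := (f (node k) - w (node k)) / l.
have vb : `|v| <= 10 * x ^- 17.
  rewrite /v normrM (gtr0_norm (_ : 0 < l^-1)) ?invr_gt0// ler_pdivrMr//.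
  apply: (le_trans d); rewrite le_eqVlt; apply/orP; left; apply/eqP.
  by rewrite /l; field; rewrite gt_eqF.
have /andP[v1 v2] := floor_itv v; rewrite intrD in v2.
have rl : r / l <= x ^- 4.
  rewrite ler_pdivrMr//; apply: (le_trans rep).
  rewrite le_eqVlt; apply/orP; left; apply/eqP.
  by rewrite /l /ep; field; rewrite gt_eqF.
have rl0 : 0 <= r / l by rewrite divr_ge0// ltW.
have tr : (Num.truncn (r / l))%:R <= r / l by have /andP[] := truncn_itv rl0.
have X4 : 8 <= x ^- 4 by rewrite -[8]invrK lef_pV2 ?posrE ?exprn_gt0.
have X17 : x ^- 4 <= x ^- 17.
  by rewrite lef_pV2 ?posrE ?exprn_gt0// ler_wiXn2l// ltW.
have MX : 14 * x ^- 17 <= M%:R by rewrite ler_pdivrMr ?exprn_gt0.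
rewrite -(ler_int R) intrD intr_norm -[X in _ + X]/((Num.truncn (r / l) + 3)%:R : R).
rewrite -[X in _ <= X]/(M%:R : R) natrD.
have : `|(Num.floor v)%:~R : R| <= `|v| + 1.
  rewrite ler_norml; apply/andP; split.
    by have := ler_norm (- v); rewrite normrN; lra.
  by have := ler_norm v; lra.
lra.
Qed.

Lemma block_density k r : (k < N)%N -> active k -> ep / 2 <= r -> r <= ep ->
  `|near_time w f r (node k) (node k.+1) / (2 * r) -
    cell_time w (node k) (node k.+1) l (Num.floor ((f (node k) - w (node k)) / l)) / l|
  <= 31 * tau * x ^+ 3.
Proof.
move=> kN ak epr rep.
have r0 : 0 < r by apply: lt_le_trans epr; rewrite divr_gt0.
have lr : 4 * l <= r by move: lep epr; lra.
have cwk := sub_cont (node_ge0 k) (node_le1 kN) cw.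
have cfk := sub_cont (node_ge0 k) (node_le1 kN) cf.
have mJ := active_cell_index kN ak rep r0.
have := @near_time_density R w f (node k) (node k.+1) l r (tau * l / x)
  (6 * tau * l * x ^+ 7) M (node_le (leqnSn k)) l0 cwk cfk (fun m => @cell_ub k m kN)
  (fun m => @cell_step k m kN) (fun s sk => f_block kN sk (node_block k)) lr mJ.
move/le_trans; apply.
have e1 : 7 * (tau * l / x) / (2 * r) <= 7 * tau * x ^+ 3.
  rewrite ler_pdivrMr ?mulr_gt0//.
  have -> : 7 * (tau * l / x) = 7 * tau * x ^+ 3 * ep.
    by rewrite /l /ep; field; rewrite gt_eqF.
  rewrite ler_wpM2l//; first by rewrite mulr_ge0 ?exprn_ge0 ?mulr_ge0 ?ltW.
  by move: epr; lra.
have e2 : 2 / l * ((r / l + 3) * (6 * tau * l * x ^+ 7)) <= 24 * tau * x ^+ 3.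
  have -> : 2 / l * ((r / l + 3) * (6 * tau * l * x ^+ 7)) =
    12 * tau * x ^+ 7 * (r / l + 3) by field; rewrite gt_eqF.
  have rl : r / l + 3 <= 2 * x ^- 4.
    have X4 : 8 <= x ^- 4 by rewrite -[8]invrK lef_pV2 ?posrE ?exprn_gt0.
    have : r / l <= x ^- 4.
      rewrite ler_pdivrMr//; apply: (le_trans rep).
      rewrite le_eqVlt; apply/orP; left; apply/eqP.
      by rewrite /l /ep; field; rewrite gt_eqF.
    lra.
  have -> : 24 * tau * x ^+ 3 = 12 * tau * x ^+ 7 * (2 * x ^- 4).
    by field; rewrite gt_eqF.
  by rewrite ler_wpM2l// mulr_ge0 ?exprn_ge0 ?mulr_ge0 ?ltW.
lra.
Qed.

(** On a block, changing the radius changes the density by an amount charged to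
    the time that the path spends at distance [rho] from the curve: a block
    visited by the [ep]-tube lies entirely in the [rho]-tube. *)
Lemma block_density_cmp k r r' : (k < N)%N -> ep / 2 <= r -> r <= ep ->
  ep / 2 <= r' -> r' <= ep ->
  `|near_time w f r (node k) (node k.+1) / (2 * r) -
    near_time w f r' (node k) (node k.+1) / (2 * r')| <=
  62 * x ^+ 3 / tau * near_time w f rho (node k) (node k.+1).
Proof.
move=> kN r1 r2 r3 r4; have [ak|nak] := pselect (active k); last first.
  have kk : node k <= node k.+1 <= node k.+1 by rewrite lexx andbT; exact: node_le.
  rewrite (near_time_inactive kN nak r2 kk) (near_time_inactive kN nak r4 kk).
  rewrite !mul0r subrr normr0.
  by rewrite mulr_ge0 ?near_time_ge0// divr_ge0 ?mulr_ge0 ?exprn_ge0 ?ltW.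
rewrite near_time_active//.
have d1 := block_density kN ak r1 r2; have d2 := block_density kN ak r3 r4.
have -> : 62 * x ^+ 3 / tau * h = 31 * tau * x ^+ 3 + 31 * tau * x ^+ 3.
  by rewrite /h; field; rewrite gt_eqF.
rewrite (distrC (near_time w f r' _ _ / _)) in d2.
by apply: le_trans (lerD d1 d2); exact: ler_distD.
Qed.

(** This serves for the block that contains [t], which is cut at [t]: there the
    contributions to both densities are small. *)
Lemma block_density_small k r t : (k < N)%N -> ep / 2 <= r -> r <= ep ->
  node k <= t <= node k.+1 ->
  0 <= near_time w f r (node k) t / (2 * r) <= 2 * x ^+ 2.
Proof.
move=> kN epr rep /andP[kt tk].
have r0 : 0 < r by apply: lt_le_trans epr; rewrite divr_gt0.
rewrite divr_ge0 ?near_time_ge0//=; last by rewrite mulr_ge0// ltW.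
have [ak|nak] := pselect (active k); last first.
  by rewrite near_time_inactive ?kt ?tk// mul0r mulr_ge0 ?sqr_ge0.
rewrite ler_pdivrMr ?mulr_gt0//.
apply: le_trans (le_near_time _ (node_ge0 k) kt tk (node_le1 kN)) _.
have lr : 4 * l <= r by move: lep epr; lra.
have cwk := sub_cont (node_ge0 k) (node_le1 kN) cw.
have cfk := sub_cont (node_ge0 k) (node_le1 kN) cf.
have mJ := active_cell_index kN ak rep r0.
have rl0 : 0 <= r / l by rewrite divr_ge0// ltW.
have /andP[Q1 Q2] := truncn_itv rl0; rewrite -natr1 in Q2.
set Q := Num.truncn (r / l) in mJ Q1 Q2.
have lE : r = r / l * l by rewrite divfK// gt_eqF.
have u4 : 4 <= r / l by rewrite ler_pdivlMr.
have J1 : r + 2 * l <= (Q + 3)%:R * l.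
  rewrite {1}lE natrD.
  by have := ler_wpM2r (ltW l0) (ltW Q2); lra.
have := near_time_le_window l0 cwk cfk (fun s sk => f_block kN sk (node_block k)) J1.
move/le_trans; apply.
have := window_time_ub (node_le (leqnSn k)) l0 cwk (fun m => @cell_ub k m kN) mJ.
move/le_trans; apply.
have JE : (2 * (Q + 3)).+1%:R <= 4 * (r / l).
  by rewrite -(natr1 (2 * (Q + 3))%N) natrM natrD; lra.
have tl0 : 0 <= tau * l / x by rewrite divr_ge0 ?mulr_ge0 ?ltW.
apply: le_trans (ler_wpM2r tl0 JE) _.
have -> : 4 * (r / l) * (tau * l / x) = 4 * r * (tau / x).
  by field; rewrite !gt_eqF.
have : tau / x <= x ^+ 2 by rewrite ler_pdivrMr// -exprSr.
move=> tx; have := ler_wpM2l (ltW r0) tx; lra.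
Qed.

(** The errors of the blocks add up to a multiple of the time spent in the tube
    of radius [rho], that is, of the density at this larger radius. *)
Theorem curve_density_cmp r r' t : ep / 2 <= r -> r <= ep ->
  ep / 2 <= r' -> r' <= ep -> 0 <= t <= 1 ->
  `|curve_density w f r t - curve_density w f r' t| <=
  2232 * x ^+ 2 * (1 + curve_density w f rho 1).
Proof.
move=> r1 r2 r3 r4 /andP[t0 t1].
pose j := Num.truncn (t / h).
have th0 : 0 <= t / h by rewrite divr_ge0// ltW.
have /andP[j1 j2] := truncn_itv th0.
rewrite -/j ler_pdivlMr// in j1; rewrite -/j ltr_pdivrMr// in j2.
rewrite -/(node j) in j1; rewrite -/(node j.+1) in j2.
have jN : (j <= N)%N.
  have : node j <= node N by rewrite (le_trans j1)// (le_trans t1)// /node Nh.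
  by rewrite /node ler_pM2r// ler_nat.
have split_t q : near_time w f q 0 t =
    \sum_(k < j) near_time w f q (node k) (node k.+1) + near_time w f q (node j) t.
  rewrite /near_time (itg_split (node_ge0 j) j1); last exact: near_bm.
  congr (_ + _); have := @itg_split_sum R 0 h j (fun s => (`|w s - f s| < q)%R%:R) (ltW h0).
  rewrite add0r => ->; last by apply: near_bm => //; exact: node_le1.
  by apply: eq_bigr => k _; rewrite !add0r.
have last_block : `|near_time w f r (node j) t / (2 * r) -
    near_time w f r' (node j) t / (2 * r')| <= 2 * x ^+ 2.
  have [jN'|jN'] := ltnP j N.
    have tj : node j <= t <= node j.+1 by rewrite j1 ltW.
    have /andP[a1 a2] := block_density_small jN' r1 r2 tj.
    have /andP[b1 b2] := block_density_small jN' r3 r4 tj.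
    by rewrite ler_norml; apply/andP; split; lra.
  have -> : t = node j.
    apply/eqP; rewrite eq_le j1 andbT (le_trans t1)//.
    by rewrite -Nh; exact: node_le.
  by rewrite /near_time !itg_point !mul0r subrr normr0 mulr_ge0// sqr_ge0.
have blocks : `|\sum_(k < j) near_time w f r (node k) (node k.+1) / (2 * r) -
    \sum_(k < j) near_time w f r' (node k) (node k.+1) / (2 * r')| <=
    62 * x ^+ 3 / tau * near_time w f rho 0 1.
  rewrite -sumrB; apply: le_trans (ler_norm_sum _ _ _) _.
  apply: (@le_trans _ _ (\sum_(k < j) 62 * x ^+ 3 / tau * near_time w f rho (node k) (node k.+1))).
    by apply: ler_sum => k _; apply: block_density_cmp => //; exact: leq_trans jN.
  rewrite -mulr_sumr ler_wpM2l//.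
    by rewrite divr_ge0 ?mulr_ge0 ?exprn_ge0 ?ltW.
  have tj1 : near_time w f rho 0 t <= near_time w f rho 0 1 by exact: le_near_time.
  apply: le_trans tj1; rewrite split_t lerDl; exact: near_time_ge0.
have splitE q : near_time w f q 0 t / (2 * q) =
    \sum_(k < j) (near_time w f q (node k) (node k.+1) / (2 * q)) +
    near_time w f q (node j) t / (2 * q).
  by rewrite split_t mulrDl mulr_suml.
rewrite /curve_density !splitE.
set s1 := \sum_(k < j) (near_time w f r (node k) (node k.+1) / (2 * r)) in blocks *.
set s2 := \sum_(k < j) (near_time w f r' (node k) (node k.+1) / (2 * r')) in blocks *.
set z1 := near_time w f r (node j) t / (2 * r) in last_block *.
set z2 := near_time w f r' (node j) t / (2 * r') in last_block *.
rewrite (_ : s1 + z1 - (s2 + z2) = (s1 - s2) + (z1 - z2)); last by ring.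
apply: le_trans (ler_normD _ _) _; apply: le_trans (lerD blocks last_block) _.
(* [2232 = 62 * 36], as [2 * rho = 36 * tau / x]. *)
have -> : 62 * x ^+ 3 / tau * near_time w f rho 0 1 =
   2232 * x ^+ 2 * (near_time w f rho 0 1 / (2 * rho)).
  by rewrite /rho; field; rewrite !gt_eqF.
have := sqr_ge0 x; lra.
Qed.

End OneScale.

(** * The scales *)

Section Scales.
Context {R : realType}.
Variable al : R.
Hypotheses (al1 : 2^-1 < al) (al2 : al <= 1).

Definition scale_base : R := 2 `^ (- ((al - 2^-1) / 16)).
Definition sqrt_half : R := 2 `^ (- 2^-1).

Local Notation X := scale_base.
Local Notation S := sqrt_half.

(** The scales of level [n]: with [x = xs n] and [tau = taus n], time blocks
    have length [tau ^+ 2 = 2 ^- n], a curve moves by at most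
    [x ^+ 16 * tau = 2 `^ (- al * n)] over a block, and [x], which decays
    geometrically because [al > 2^-1], is the ratio that every estimate may lose.
    The radii are smaller than [taus] and larger than [cells], by powers of [x]. *)
Definition xs (n : nat) : R := X ^+ n.
Definition taus (n : nat) : R := S ^+ n.
Definition cells (n : nat) : R := xs n ^+ 16 * taus n.
Definition radii (n : nat) : R := xs n ^+ 12 * taus n.

Lemma pow2X (z : R) (n : nat) : (2 `^ (- z)) ^+ n = 2 `^ (- (z * n%:R)) :> R.
Proof. by rewrite -powR_mulrn ?powR_ge0// -powRrM mulNr. Qed.

Lemma pow2_half : 2 `^ (- 1) = 2^-1 :> R.
Proof. by rewrite powR_inv1. Qed.

Lemma pow2_ge (z y : R) : z <= y -> 2 `^ (- y) <= 2 `^ (- z) :> R.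
Proof. by move=> zy; apply: ler_powR; rewrite ?ler1n// lerN2. Qed.

Lemma pow2_lt1 (z : R) : 0 < z -> 2 `^ (- z) < 1 :> R.
Proof.
move=> z0; rewrite powRN invf_lt1 ?powR_gt0//.
have -> : 1 < 2 `^ z = (1 `^ z < 2 `^ z) :> bool by rewrite powR1.
by apply: gt0_ltr_powR; rewrite ?nnegrE ?ltr1n.
Qed.

Lemma scale_base_gt0 : 0 < X. Proof. by rewrite powR_gt0. Qed.
Lemma sqrt_half_gt0 : 0 < S. Proof. by rewrite powR_gt0. Qed.

Lemma scale_base_lt1 : X < 1.
Proof. by rewrite pow2_lt1// divr_gt0// subr_gt0. Qed.

Lemma sqrt_half_sqr : S ^+ 2 = 2^-1.
Proof. by rewrite pow2X mulVf// pow2_half. Qed.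

Lemma scale_base17 : 2^-1 <= X ^+ 17.
Proof. by rewrite -pow2_half pow2X; apply: pow2_ge; move: al1 al2; lra. Qed.

Lemma sqrt_half_le_scale : S <= X ^+ 3.
Proof. rewrite /S pow2X; apply: pow2_ge; move: al2; lra. Qed.

Lemma radii_ratio : 2^-1 <= X ^+ 12 * S <= 1.
Proof.
have X0 := scale_base_gt0; have X1 := scale_base_lt1.
have S0 := sqrt_half_gt0; have S1 : S < 1 by rewrite pow2_lt1// invr_gt0.
apply/andP; split; last first.
  by rewrite mulr_ile1 ?exprn_ge0 ?exprn_ile1 ?(ltW X0) ?(ltW X1) ?(ltW S0) ?(ltW S1).
rewrite pow2X -powRD; last by apply/implyP.
by rewrite -[leLHS]pow2_half -opprD; apply: pow2_ge; move: al1 al2; lra.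
Qed.

(** Dyadic chaining sums a geometric series of this ratio, hence loses a factor
    [8]. *)
Lemma osc_ratio : S / X <= 7 / 8.
Proof.
have X0 := scale_base_gt0; have S0 := sqrt_half_gt0.
rewrite leNgt; apply/negP => h.
have h4 : (7 / 8) ^+ 4 < (S / X) ^+ 4 by rewrite ltrXn2r// nnegrE divr_ge0// ltW.
have S4 : S ^+ 4 = 4^-1.
  have -> : S ^+ 4 = (S ^+ 2) ^+ 2 by rewrite -exprM.
  by rewrite sqrt_half_sqr; field.
have X4 : 2^-1 <= X ^+ 4.
  by rewrite -pow2_half pow2X; apply: pow2_ge; move: al1 al2; lra.
have : (S / X) ^+ 4 <= 2^-1.
  rewrite expr_div_n S4 ler_pdivrMr ?exprn_gt0//; lra.
lra.
Qed.

Lemma xs_gt0 n : 0 < xs n. Proof. by rewrite exprn_gt0// scale_base_gt0. Qed.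
Lemma taus_gt0 n : 0 < taus n. Proof. by rewrite exprn_gt0// sqrt_half_gt0. Qed.
Lemma cells_gt0 n : 0 < cells n.
Proof. by rewrite (mulr_gt0 (exprn_gt0 _ (xs_gt0 n)) (taus_gt0 n)). Qed.
Lemma radii_gt0 n : 0 < radii n.
Proof. by rewrite (mulr_gt0 (exprn_gt0 _ (xs_gt0 n)) (taus_gt0 n)). Qed.

Lemma taus_sqr n : taus n ^+ 2 = 2 ^- n.
Proof. rewrite /taus exprAC sqrt_half_sqr exprVn. by []. Qed.

Lemma nb_blocks n : (2 ^ n)%:R * taus n ^+ 2 = 1.
Proof. by rewrite taus_sqr natrX mulfV// expf_neq0. Qed.

Lemma taus_le n : taus n <= xs n ^+ 3.
Proof.
rewrite /taus /xs exprAC; apply: lerXn2r.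
- by rewrite nnegrE; exact/ltW/sqrt_half_gt0.
- by rewrite nnegrE; exact/exprn_ge0/ltW/scale_base_gt0.
- exact: sqrt_half_le_scale.
Qed.

Lemma radii_le n : radii n.+1 <= radii n /\ radii n / 2 <= radii n.+1.
Proof.
have E : radii n.+1 = radii n * (X ^+ 12 * S).
  by rewrite /radii /xs /taus !exprS !exprMn; ring.
have /andP[h1 h2] := radii_ratio.
rewrite E; split; first by rewrite ler_piMr// ltW// radii_gt0.
by rewrite ler_wpM2l// ltW// radii_gt0.
Qed.

Lemma nonincr_radii n m : (n <= m)%N -> radii m <= radii n.
Proof.
elim: m => [|m IH]; first by rewrite leqn0 => /eqP ->.
rewrite leq_eqVlt => /predU1P[->//|]; rewrite ltnS => /IH.
by apply: le_trans; have [] := radii_le m.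
Qed.

Lemma cellsE n : (2 ^- n) `^ al = cells n.
Proof.
have -> : 2 ^- n = 2 `^ (- n%:R) :> R.
  by rewrite powRN powR_mulrn.
rewrite -powRrM /cells /xs /taus -exprM !pow2X -powRD; last by apply/implyP.
by congr (_ `^ _); rewrite natrM; field.
Qed.

(** Equivalently [14 * taus n / xs n <= 4 ^ n * cells n]: cells of index at most
    [4 ^ n] reach further than the path goes over a block. *)
Lemma cells_enough n : (4 <= n)%N -> 14 <= (4 ^ n)%:R * xs n ^+ 17 :> R.
Proof.
move=> n4; have h : 2 ^- n <= xs n ^+ 17.
  rewrite /xs exprAC -exprVn; apply: lerXn2r; last exact: scale_base17.
    by rewrite nnegrE invr_ge0.
  by rewrite nnegrE; exact/exprn_ge0/ltW/scale_base_gt0.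
have h2 : 2 ^+ n <= (4 ^ n)%:R * xs n ^+ 17 :> R.
  have : (4 ^ n)%:R * 2 ^- n <= (4 ^ n)%:R * xs n ^+ 17 by rewrite ler_wpM2l.
  apply: le_trans; rewrite (_ : 4 = 2 * 2)%N// expnMn natrM !natrX -mulrA mulfV ?mulr1//.
apply: le_trans h2; apply: (@le_trans _ _ (2 ^+ 4)); first by rewrite -natrX ler_nat.
by rewrite ler_weXn2l ?ler1n.
Qed.

Lemma scales_small : exists n0, forall n, (n0 <= n)%N ->
  xs n ^+ 4 <= 8^-1 /\ 14 <= (4 ^ n)%:R * xs n ^+ 17.
Proof.
have : X ^+ n @[n --> \oo] --> 0.
  by apply: cvg_expr; rewrite ger0_norm ?scale_base_lt1// ltW// scale_base_gt0.
move=> /cvgrPdist_lt/(_ 8^-1); rewrite invr_gt0 => /(_ (ltr0n _ _)).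
case=> n0 _ h; exists (maxn 4 n0) => n; rewrite geq_max => /andP[n4 nn0].
split; last exact: cells_enough.
have := h n nn0; rewrite sub0r normrN ger0_norm; last by rewrite exprn_ge0// ltW// scale_base_gt0.
rewrite -/(xs n) => hx; have x0 := xs_gt0 n.
apply: le_trans (ltW hx); rewrite exprS ler_piMr ?(ltW x0)// exprn_ile1 ?(ltW x0)//.
by apply: (le_trans (ltW hx)); rewrite invf_le1// ler1n.
Qed.

Lemma radii_to0 (r : R) : 0 < r -> forall n0, exists2 n, (n0 <= n)%N & radii n <= r.
Proof.
move=> r0 n0.
have S1 : S < 1 by rewrite pow2_lt1// invr_gt0.
have : S ^+ n @[n --> \oo] --> 0.
  by apply: cvg_expr; rewrite ger0_norm// ltW// sqrt_half_gt0.
move=> /cvgrPdist_lt/(_ r r0) [n1 _ h]; exists (maxn n0 n1); first exact: leq_maxl.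
have := h _ (leq_maxr n0 n1); rewrite sub0r normrN ger0_norm; last by rewrite exprn_ge0// ltW// sqrt_half_gt0.
move=> /ltW; apply: le_trans; rewrite /radii ler_piMl ?(ltW (taus_gt0 _))//.
rewrite exprn_ile1 ?(ltW (xs_gt0 _))// exprn_ile1 ?(ltW scale_base_lt1)//.
by rewrite ltW// scale_base_gt0.
Qed.

End Scales.

(** * Good levels of a path *)

Section GoodPaths.
Context {R : realType}.
Variable al : R.
Hypotheses (al1 : 2^-1 < al) (al2 : al <= 1).
Implicit Types (w f : R -> R).

Local Notation xs := (xs al).
Local Notation cells := (cells al).
Local Notation radii := (radii al).

Definition node (n k : nat) : R := k%:R * taus n ^+ 2.

(** A path is observed through finitely many numbers per level.  Since no curve is
    mentioned, one event serves all of them. *)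
Record good_level w (n : nat) : Prop := GoodLevel {
  good_increment : forall k, (k < 2 ^ n)%N ->
    `|w (node n k.+1) - w (node n k)| <= taus n / xs n ;
  good_cell : forall k (m : int), (k < 2 ^ n)%N -> `|m| <= (4 ^ n)%:Z ->
    cell_time w (node n k) (node n k.+1) (cells n) m <= taus n * cells n / xs n ;
  good_step : forall k (m : int), (k < 2 ^ n)%N -> `|m| <= (4 ^ n)%:Z ->
    `|cell_time w (node n k) (node n k.+1) (cells n) (m + 1) -
      cell_time w (node n k) (node n k.+1) (cells n) m|
      <= 6 * taus n * cells n * xs n ^+ 7 }.

Lemma node_double n k : node n.+1 k.*2 = node n k.
Proof. by rewrite /node !taus_sqr exprS invfM -muln2 natrM; field. Qed.

Lemma node_itv n k : (k < 2 ^ n)%N -> 0 <= node n k /\ node n k.+1 <= 1.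
Proof.
move=> kn; rewrite /node taus_sqr; split; first by rewrite divr_ge0 ?exprn_ge0.
by rewrite ler_pdivrMr ?exprn_gt0// mul1r -natrX ler_nat.
Qed.

Let q : R := taus 1 / xs 1.

Let qE n : taus n / xs n = q ^+ n.
Proof. by rewrite /q /taus /xs !expr1 expr_div_n. Qed.

Let q0 : 0 < q. Proof. by rewrite divr_gt0 ?taus_gt0 ?xs_gt0. Qed.
Let q78 : q <= 7 / 8.
Proof. by rewrite /q /taus /xs !expr1; exact: osc_ratio. Qed.

(** Dyadic chaining: moving one level down costs one more increment. *)
Lemma dyadic_osc w n0 n k i k' :
  (forall m, (n0 <= m)%N -> good_level w m) -> (n0 <= n)%N -> (k < 2 ^ n)%N ->
  (k * 2 ^ i <= k' <= k.+1 * 2 ^ i)%N ->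
  `|w (node (n + i) k') - w (node n k)| <= q ^+ n * (8 - 7 * q ^+ i).
Proof.
move=> gw n0n kn; elim: i k' => [|i IH] k'.
  rewrite addn0 expn0 !muln1 => /andP[kk' k'k].
  have [->|k'k2] := eqVneq k' k.
    by rewrite subrr normr0 mulr_ge0 ?exprn_ge0 ?(ltW q0)//= expr0; lra.
  have -> : k' = k.+1 by lia.
  rewrite expr0 (_ : 8 - 7 * 1 = 1); last by ring.
  by rewrite mulr1 -qE; apply: good_increment => //; exact: gw.
rewrite expnS => kk'.
have step : q ^+ n * (8 - 7 * q ^+ i) + q ^+ (n + i.+1) <= q ^+ n * (8 - 7 * q ^+ i.+1).
  have qn := exprn_ge0 n (ltW q0); have qi := exprn_ge0 i (ltW q0).
  have h : 0 <= q ^+ n * q ^+ i by rewrite mulr_ge0.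
  have := ler_wpM2l h q78.
  by rewrite exprD !exprS; lra.
have even_case j : (k * 2 ^ i <= j <= k.+1 * 2 ^ i)%N ->
    `|w (node (n + i.+1) j.*2) - w (node n k)| <= q ^+ n * (8 - 7 * q ^+ i).
  by move=> jk; rewrite addnS node_double; exact: IH.
have [odk|evk] := boolP (odd k').
  have k'E : k' = (k'./2).*2.+1 by rewrite -[LHS]odd_double_half odk.
  have jk : (k * 2 ^ i <= k'./2 <= k.+1 * 2 ^ i)%N by lia.
  apply: le_trans step; rewrite k'E.
  have := ler_distD (w (node (n + i.+1) (k'./2).*2)) (w (node (n + i.+1) (k'./2).*2.+1)) (w (node n k)).
  have : `|w (node (n + i.+1) (k'./2).*2.+1) - w (node (n + i.+1) (k'./2).*2)| <= q ^+ (n + i.+1).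
    rewrite -qE; apply: good_increment; first by apply: gw; lia.
    have : (k'./2.*2 < k.+1 * 2 ^ i * 2)%N by lia.
    have : (k.+1 * 2 ^ i * 2 <= 2 ^ n * 2 ^ i * 2)%N by rewrite leq_mul2r leq_mul2r kn !orbT.
    rewrite expnD expnS; lia.
  have := even_case _ jk; lra.
have k'E : k' = (k'./2).*2 by rewrite -[LHS]odd_double_half (negbTE evk).
have jk : (k * 2 ^ i <= k'./2 <= k.+1 * 2 ^ i)%N by lia.
rewrite k'E; apply: le_trans step; apply: le_trans (even_case _ jk) _.
by rewrite lerDl exprn_ge0// ltW.
Qed.

(** The dyadic bound extends to all times by continuity. *)
Lemma good_osc w n0 n k s : {within `[0, 1], continuous w} ->
  (forall m, (n0 <= m)%N -> good_level w m) -> (n0 <= n)%N -> (k < 2 ^ n)%N ->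
  node n k <= s <= node n k.+1 -> `|w s - w (node n k)| <= 8 * taus n / xs n.
Proof.
move=> cw gw n0n kn /andP[ks sk].
have [nk0 nk1] := node_itv kn.
have s0 : 0 <= s := le_trans nk0 ks.
have s1 : s <= 1 := le_trans sk nk1.
rewrite -mulrA qE; apply/ler_addgt0Pr => e e0.
have [dl dl0 wd] := (@within_continuous_epsP R `[0, 1] w).1 cw s ltac:(by rewrite /= in_itv/= s0 s1) e e0.
have [i _ hi] : exists2 i, True & 2 ^- (n + i) < dl.
  have : (2^-1 : R) ^+ m @[m --> \oo] --> 0.
    by apply: cvg_expr; rewrite ger0_norm ?invr_ge0// invf_lt1 ?ltr1n.
  move=> /cvgrPdist_lt/(_ dl dl0) [m _ hm]; exists m => //.
  have := hm (n + m)%N (leq_addl _ _); rewrite sub0r normrN ger0_norm ?exprn_ge0 ?invr_ge0//.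
  by rewrite exprVn.
have h0 : 0 < (2 ^- (n + i) : R) by rewrite invr_gt0 exprn_gt0.
have sh0 : 0 <= s / 2 ^- (n + i) by rewrite divr_ge0// ltW.
have /andP[j1 j2] := truncn_itv sh0.
set j := Num.truncn _ in j1 j2.
rewrite ler_pdivlMr// in j1; rewrite ltr_pdivrMr// in j2.
have jE : node (n + i) j = j%:R * 2 ^- (n + i) by rewrite /node taus_sqr.
have E (a : nat) : node n a = (a * 2 ^ i)%:R * 2 ^- (n + i).
  rewrite /node taus_sqr exprD natrM natrX; field.
  by rewrite !expf_neq0.
have jk : (k * 2 ^ i <= j <= k.+1 * 2 ^ i)%N.
  apply/andP; split.
    have : (k * 2 ^ i)%:R * 2 ^- (n + i) < j.+1%:R * 2 ^- (n + i) :> R.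
      by apply: le_lt_trans j2; rewrite -E.
    by rewrite ltr_pM2r// ltr_nat ltnS.
  have : j%:R * 2 ^- (n + i) <= (k.+1 * 2 ^ i)%:R * 2 ^- (n + i) :> R.
    by apply: (le_trans j1); rewrite -E.
  by rewrite ler_pM2r// ler_nat.
have d1 := dyadic_osc gw n0n kn jk.
have d2 : `|w s - w (node (n + i) j)| < e.
  apply: wd.
    rewrite /= in_itv/= jE (le_trans j1 s1) andbT.
    by rewrite mulr_ge0// ltW.
  rewrite jE ger0_norm ?subr_ge0//; apply: le_lt_trans hi.
  by move: j2; rewrite -natr1; lra.
have := ler_distD (w (node (n + i) j)) (w s) (w (node n k)).
have : 0 <= q ^+ n * q ^+ i by rewrite mulr_ge0 ?exprn_ge0// ltW.
lra.
Qed.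

Definition holder_path f : Prop :=
  (forall t, 0 <= t <= 1 -> `|f t| <= 1) /\
  (forall s t, 0 <= s <= 1 -> 0 <= t <= 1 -> `|f s - f t| <= `|s - t| `^ al).

Lemma holder_path_continuous f : holder_path f -> {within `[0, 1], continuous f}.
Proof.
move=> [_ fh]; apply/within_continuous_epsP => s /=; rewrite in_itv/= => s01 e e0.
have al0 : 0 < al by apply: lt_trans al1; rewrite invr_gt0.
exists (e `^ al^-1); first exact: powR_gt0.
move=> t; rewrite /= in_itv/= => t01 st; apply: le_lt_trans (fh _ _ s01 t01) _.
have -> : e = (e `^ al^-1) `^ al.
  by rewrite -powRrM mulVf ?gt_eqF// powRr1// ltW.
by apply: gt0_ltr_powR; rewrite ?nnegrE ?powR_ge0.
Qed.

Lemma holder_path_block f n s t : holder_path f -> 0 <= s <= 1 -> 0 <= t <= 1 ->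
  `|s - t| <= taus n ^+ 2 -> `|f s - f t| <= cells n.
Proof.
move=> [_ fh] s01 t01 st; apply: le_trans (fh _ _ s01 t01) _.
rewrite -cellsE -taus_sqr.
by apply: ge0_ler_powR; rewrite ?nnegrE ?sqr_ge0// (le_trans _ (ltW al1))// invr_ge0.
Qed.

Lemma good_density_cmp w f n0 n r r' t : {within `[0, 1], continuous w} ->
  (forall m, (n0 <= m)%N -> good_level w m) -> (n0 <= n)%N ->
  xs n ^+ 4 <= 8^-1 -> 14 <= (4 ^ n)%:R * xs n ^+ 17 -> holder_path f ->
  radii n.+1 <= r -> r <= radii n -> radii n.+1 <= r' -> r' <= radii n ->
  0 <= t <= 1 ->
  `|curve_density w f r t - curve_density w f r' t| <=
  2232 * xs n ^+ 2 * (1 + curve_density w f (18 * taus n / xs n) 1).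
Proof.
move=> cw gw n0n x4 Mx hf r1 r2 r3 r4 t01.
have gn := gw n n0n; have [_ rl] := radii_le al1 al2 n.
apply: (@curve_density_cmp R w f (xs n) (taus n) (2 ^ n) (4 ^ n)) => //.
- exact: nb_blocks.
- exact: xs_gt0.
- exact: taus_gt0.
- exact: taus_le.
- exact: holder_path_continuous.
- by move=> k s kn sk; apply: (good_osc cw gw n0n kn).
- by move=> k m kn mn; apply: (good_cell gn).
- by move=> k m kn mn; apply: (good_step gn).
- by move=> s u s01 u01; exact: holder_path_block.
- exact: le_trans rl r1.
- exact: le_trans rl r3.
Qed.

End GoodPaths.

(** * Convergence of the densities along a good path *)

Section AllScales.
Context {R : realType}.

Lemma geometric_increment (k q p : R) : 1 - q != 0 ->
  k * p = k / (1 - q) * (p - q * p).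
Proof. by move=> q1; field. Qed.

Variable al : R.
Hypotheses (al1 : 2^-1 < al) (al2 : al <= 1).
Implicit Types (w f : R -> R).

Local Notation xs := (xs al).
Local Notation radii := (radii al).
Let Q : R := scale_base al ^+ 2.
(* With this constant the errors telescope, see [CQ]. *)
Let C : R := 2232 / (1 - Q).

Definition density_bound (n0 : nat) : R := (1 + (2 * radii n0)^-1) * expR (C * Q ^+ n0).
Definition density_rate (n0 n : nat) : R := density_bound n0 * C * Q ^+ n.

Let Q0 : 0 < Q. Proof. by rewrite exprn_gt0// scale_base_gt0. Qed.
Let Q1 : Q < 1. Proof. by rewrite exprn_ilt1 ?scale_base_lt1// ltW// scale_base_gt0. Qed.
Let C0 : 0 < C. Proof. by apply: divr_gt0; rewrite ?ltr0n ?subr_gt0. Qed.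
Let CQ (n : nat) : 2232 * xs n ^+ 2 = C * (Q ^+ n - Q ^+ n.+1) :> R.
Proof.
have e1 : xs n ^+ 2 = Q ^+ n by rewrite /xs exprAC.
have e2 : Q ^+ n.+1 = Q * Q ^+ n by rewrite exprS.
by rewrite e1 e2; apply: geometric_increment; rewrite gt_eqF// subr_gt0.
Qed.

Lemma density_bound_ge1 n0 : 1 <= density_bound n0.
Proof.
rewrite -[leLHS]mulr1 ler_pM ?ler01//.
  by rewrite lerDl invr_ge0 mulr_ge0// ltW// radii_gt0.
by rewrite -expR0 ler_expR (mulr_ge0 (ltW C0) (exprn_ge0 _ (ltW Q0))).
Qed.

Lemma density_rate_ge0 n0 n : 0 <= density_rate n0 n.
Proof.
have D0 : 0 <= density_bound n0 := le_trans ler01 (density_bound_ge1 n0).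
exact: mulr_ge0 (mulr_ge0 D0 (ltW C0)) (exprn_ge0 _ (ltW Q0)).
Qed.

Lemma density_rate_cvg n0 : density_rate n0 n @[n --> \oo] --> 0.
Proof.
rewrite /density_rate -(mulr0 (density_bound n0 * C)).
apply: cvgM; first exact: cvg_cst.
by apply: cvg_expr; rewrite ger0_norm ?Q1// ltW.
Qed.

Section OnePath.
Variables (w : R -> R) (n0 : nat).
Hypotheses (cw : {within `[0, 1], continuous w})
  (gw : forall m, (n0 <= m)%N -> good_level al w m)
  (small : forall n, (n0 <= n)%N ->
     xs n ^+ 4 <= 8^-1 /\ 14 <= (4 ^ n)%:R * xs n ^+ 17).

Lemma curve_density_trivial f r : holder_path al f -> 0 < r ->
  0 <= curve_density w f r 1 <= (2 * r)^-1.
Proof.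
move=> hf r0; have r20 : 0 < 2 * r by rewrite mulr_gt0.
have nt : 0 <= near_time w f r 0 1 by exact: near_time_ge0.
rewrite /curve_density divr_ge0 ?(ltW r20)//= ler_piMl ?invr_ge0 ?(ltW r20)//.
have i1 : itg 0 1 (fun=> 1 : R) = 1 by rewrite itg_cst// subr0 mulr1.
rewrite -[leRHS]i1; apply: le_itg; first exact: (near_bounded_measurable _ cw (holder_path_continuous al1 hf)).
  exact: bounded_measurable_cst.
by move=> s _; case: (_ < _).
Qed.

Let rho_radii n : radii n <= 18 * taus n / xs n.
Proof.
have x0 := xs_gt0 al n; have t0 := @taus_gt0 R n.
have x1 : xs n <= 1 by rewrite exprn_ile1 ?(ltW (scale_base_lt1 al1))// ltW// scale_base_gt0.
rewrite ler_pdivlMr// /radii mulrAC -exprSr ler_wpM2r ?(ltW t0)//.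
by apply: (@le_trans _ _ 1); [rewrite exprn_ile1// ltW|rewrite ler1n].
Qed.

Let density_first_radii f r : holder_path al f -> radii n0 <= r ->
  1 + curve_density w f r 1 <= 1 + (2 * radii n0)^-1.
Proof.
move=> hf nr; have R0 := radii_gt0 al n0; have r0 := lt_le_trans R0 nr.
have /andP[_ h] := curve_density_trivial hf r0.
rewrite lerD2l; apply: (le_trans h).
by rewrite lef_pV2 ?ler_pM2l// posrE mulr_gt0.
Qed.

(** The comparison between consecutive scales is relative to the density at a
    larger radius, so that bounds propagate to small radii by a convergent
    product. *)
Lemma density_bounded_radii f n r : holder_path al f -> (n0 <= n)%N -> radii n <= r ->
  1 + curve_density w f r 1 <=
    (1 + (2 * radii n0)^-1) * expR (C * (Q ^+ n0 - Q ^+ n)).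
Proof.
move=> hf; elim: n r => [|n IH] r.
  rewrite leqn0 => /eqP n00 nr; have -> : Q ^+ 0 = Q ^+ n0 by rewrite n00.
  rewrite subrr mulr0 expR0 mulr1.
  by apply: density_first_radii => //; rewrite n00.
rewrite leq_eqVlt => /predU1P[n0n nr|].
  have -> : Q ^+ n.+1 = Q ^+ n0 by rewrite n0n.
  rewrite subrr mulr0 expR0 mulr1.
  by apply: density_first_radii => //; rewrite n0n.
rewrite ltnS => n0n nr.
have G0 : 0 <= (1 + (2 * radii n0)^-1) * expR (C * (Q ^+ n0 - Q ^+ n)).
  by rewrite mulr_ge0 ?expR_ge0// addr_ge0// invr_ge0 mulr_ge0// ltW// radii_gt0.
have e1 : (1 + (2 * radii n0)^-1) * expR (C * (Q ^+ n0 - Q ^+ n)) *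
    (1 + C * (Q ^+ n - Q ^+ n.+1)) <=
    (1 + (2 * radii n0)^-1) * expR (C * (Q ^+ n0 - Q ^+ n.+1)).
  rewrite (_ : C * (Q ^+ n0 - Q ^+ n.+1) = C * (Q ^+ n0 - Q ^+ n) + C * (Q ^+ n - Q ^+ n.+1)); last by ring.
  by rewrite expRD [leRHS]mulrA; apply: ler_wpM2l => //; exact: expR_ge1Dx.
apply: le_trans e1.
have CQ0 : 0 <= C * (Q ^+ n - Q ^+ n.+1) by rewrite -CQ mulr_ge0 ?ler0n ?sqr_ge0.
set G := (1 + (2 * radii n0)^-1) * expR (C * (Q ^+ n0 - Q ^+ n)) in IH G0 *.
have [rn|rn] := leP (radii n) r.
  by apply: le_trans (IH r n0n rn) _; rewrite ler_peMr// lerDl.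
have [x4 Mx] := small n0n; have [rl _] := radii_le al1 al2 n.
have t1 : 0 <= (1 : R) <= 1 by rewrite lexx ler01.
have := good_density_cmp al1 al2 cw gw n0n x4 Mx hf nr (ltW rn) rl (lexx _) t1.
rewrite CQ ler_norml => /andP[_ h].
have h1 := IH _ n0n (lexx (radii n)); have h2 := IH _ n0n (rho_radii n).
have h3 := ler_wpM2l CQ0 h2; rewrite mulrDr mulr1; lra.
Qed.

Lemma density_bounded f r : holder_path al f -> 0 < r ->
  1 + curve_density w f r 1 <= density_bound n0.
Proof.
move=> hf r0; have [n n0n nr] := radii_to0 al1 r0 n0.
apply: le_trans (density_bounded_radii hf n0n nr) _.
rewrite ler_wpM2l//; first by rewrite addr_ge0// invr_ge0 mulr_ge0// ltW// radii_gt0.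
by rewrite ler_expR ler_wpM2l ?(ltW C0)// gerBl exprn_ge0// ltW.
Qed.

Lemma density_near_radii f n m r t : holder_path al f -> (n0 <= n)%N -> (n <= m)%N ->
  radii m <= r -> r <= radii n -> 0 <= t <= 1 ->
  `|curve_density w f r t - curve_density w f (radii n) t| <=
  density_bound n0 * C * (Q ^+ n - Q ^+ m).
Proof.
move=> hf n0n; elim: m r => [|m IH] r.
  rewrite leqn0 => /eqP -> r1 r2 _.
  have -> : r = radii 0 by apply/eqP; rewrite eq_le r1 r2.
  by rewrite !subrr normr0 mulr0.
rewrite leq_eqVlt => /predU1P[<-|].
  move=> r1 r2 _.
  have -> : r = radii n by apply/eqP; rewrite eq_le r1 r2.
  by rewrite !subrr normr0 mulr0.
rewrite ltnS => nm r1 r2 t01.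
have D0 : 0 <= density_bound n0 := le_trans ler01 (density_bound_ge1 n0).
have mono : density_bound n0 * C * (Q ^+ n - Q ^+ m) <=
    density_bound n0 * C * (Q ^+ n - Q ^+ m.+1).
  apply: ler_wpM2l; first exact: mulr_ge0 D0 (ltW C0).
  rewrite lerD2l lerN2 (exprS Q m); apply: ler_piMl; last exact: ltW.
  exact: exprn_ge0 (ltW Q0).
have [rm|rm] := leP (radii m) r.
  by apply: le_trans (IH r nm rm r2 t01) mono.
have n0m := leq_trans n0n nm.
have [x4 Mx] := small n0m; have [rl _] := radii_le al1 al2 m.
have h1 := good_density_cmp al1 al2 cw gw n0m x4 Mx hf r1 (ltW rm) rl (lexx _) t01.
have h2 := IH _ nm (lexx (radii m)) (nonincr_radii al1 al2 nm) t01.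
have rho0 : 0 < 18 * taus m / xs m by rewrite divr_gt0 ?xs_gt0// mulr_gt0// taus_gt0.
have CQ0 : 0 <= C * (Q ^+ m - Q ^+ m.+1) by rewrite -CQ mulr_ge0 ?ler0n ?sqr_ge0.
have h3 := ler_wpM2l CQ0 (density_bounded hf rho0).
rewrite CQ in h1.
have := ler_distD (curve_density w f (radii m) t) (curve_density w f r t) (curve_density w f (radii n) t).
lra.
Qed.

(** The errors of all smaller scales add up to a multiple of [Q ^+ n], whatever the
    curve and the time. *)
Theorem density_cauchy f n r t : holder_path al f -> (n0 <= n)%N ->
  0 < r -> r <= radii n -> 0 <= t <= 1 ->
  `|curve_density w f r t - curve_density w f (radii n) t| <= density_rate n0 n.
Proof.
move=> hf n0n r0 rn t01; have [m nm mr] := radii_to0 al1 r0 n.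
apply: le_trans (density_near_radii hf n0n nm mr rn t01) _.
have D0 : 0 <= density_bound n0 := le_trans ler01 (density_bound_ge1 n0).
apply: ler_wpM2l; first exact: mulr_ge0 D0 (ltW C0).
by rewrite gerBl exprn_ge0 ?(ltW Q0).
Qed.

End OnePath.
End AllScales.

(** * Almost every path is good *)

Section BadLevels.
Context {R : realType} {d : measure_display} {T : measurableType d}.
Variable P : probability T R.
Variable W : R -> {RV P >-> R}.
Hypothesis bm : brownian_motion W.
Variable al : R.
Hypotheses (al1 : 2^-1 < al) (al2 : al <= 1).

Local Notation xs := (xs al).
Local Notation cells := (cells al).

Lemma bigcup_ltn_le (N : nat) (A : nat -> set T) (c : R) :
  (forall i, (i < N)%N -> measurable (A i)) ->
  (forall i, (i < N)%N -> (P (A i) <= c%:E)%E) ->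
  measurable (\bigcup_(i in `I_N) A i) /\
  (P (\bigcup_(i in `I_N) A i) <= (N%:R * c)%:E)%E.
Proof.
elim: N => [|N IH] mA PA.
  by rewrite II0 bigcup_set0 measure0 mul0r.
have [|i iN|mU PU] := IH.
- by move=> i iN; apply: mA; exact: ltnW.
- by apply: PA; exact: ltnW.
rewrite IIS bigcup_setU bigcup_set1.
have mN := mA N (ltnSn N).
split; first exact: measurableU.
apply: le_trans (measureU2 _ _ _) _ => //.
by rewrite -natr1 mulrDl mul1r EFinD; apply: leeD => //; exact: PA.
Qed.

(* The controls on two neighbouring cells involve one more cell on either side,
   whence the margin of [2]. *)
Let center (n i : nat) : int := i%:Z - (4 ^ n + 2)%:Z.
Let cell n k (m : int) : T -> R :=
  tent_time W (node n k) (node n k.+1) (cells n) (m%:~R * cells n).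
(* Once the times in the cells are bounded by [taus * cells / xs], this choice makes
   the terms [(xs n)^-1] and [(theta * cells) ^+ 2 / 2 * ...] of [bad_step] of the
   same order. *)
Let theta n : R := (taus n * cells n * xs n ^+ 8)^-1.

Definition bad_increment n k : set T :=
  [set w | (xs n)^-1 * taus n < `|W (node n k.+1) w - W (node n k) w|].
Definition bad_cell n k i : set T :=
  [set w | 2 * (2 * xs n)^-1 * (taus n * cells n) < cell n k (center n i) w].
Definition bad_step (sg : R) n k i : set T :=
  [set w | (xs n)^-1 + (theta n * cells n) ^+ 2 / 2 *
      (tent_time W (node n k) (node n k.+1) (cells n) ((center n i)%:~R * cells n - cells n) w +
       tent_time W (node n k) (node n k.+1) (cells n) ((center n i)%:~R * cells n) w +
       tent_time W (node n k) (node n k.+1) (cells n) ((center n i)%:~R * cells n + cells n) w +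
       tent_time W (node n k) (node n k.+1) (cells n) ((center n i)%:~R * cells n + 2 * cells n) w) <
    theta n / 2 * (sg *
      (tent_time W (node n k) (node n k.+1) (cells n) ((center n i)%:~R * cells n + cells n) w -
       tent_time W (node n k) (node n k.+1) (cells n) ((center n i)%:~R * cells n) w))].

Definition bad_level n : set T :=
  \bigcup_(k in `I_(2 ^ n)) (bad_increment n k `|`
    \bigcup_(i in `I_((2 * (4 ^ n + 2)).+1))
      (bad_cell n k i `|` (bad_step 1 n k i `|` bad_step (-1) n k i))).

Let x0 n : 0 < xs n. Proof. exact: xs_gt0. Qed.
Let t0 n : 0 < (taus n : R). Proof. exact: taus_gt0. Qed.
Let c0 n : 0 < cells n. Proof. exact: cells_gt0. Qed.
Let nodeS n k : node n k.+1 - node n k = taus n ^+ 2 :> R.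
Proof. by rewrite /node -natr1; ring. Qed.
Let node0 n k : 0 <= (node n k : R).
Proof. by rewrite /node mulr_ge0// sqr_ge0. Qed.
Let node_lt n k : node n k < node n k.+1 :> R.
Proof. by rewrite -subr_gt0 nodeS exprn_gt0. Qed.
Let x1 n : xs n <= 1.
Proof. by rewrite exprn_ile1 ?(ltW (scale_base_lt1 al1))// ltW// scale_base_gt0. Qed.
Let ct n : cells n <= taus n.
Proof. by rewrite /cells ler_piMl ?(ltW (t0 n))// exprn_ile1 ?(ltW (x0 n)). Qed.

Lemma bad_increment_le n k : measurable (bad_increment n k) /\
  (P (bad_increment n k) <= (expR (2 - (xs n)^-1))%:E)%E.
Proof.
split; last exact: (bm_increment_tail bm _ (node0 n k) (t0 n) (nodeS n k)).
apply: measurable_gt; apply: measurableT_comp => //.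
by apply: measurable_funB; exact: measurable_funP.
Qed.

Lemma bad_cell_le n k i : measurable (bad_cell n k i) /\
  (P (bad_cell n k i) <= (expR (2 - (2 * xs n)^-1))%:E)%E.
Proof.
split; last exact: (tent_time_tail bm _ _ (node0 n k) (c0 n) (ct n) (nodeS n k)).
apply: measurable_gt; exact: (measurable_tent_time bm _ _ (node0 n k) (ltW (node_lt n k))).
Qed.

Let theta0 n : 0 < theta n.
Proof.
by rewrite invr_gt0 (mulr_gt0 (mulr_gt0 (t0 n) (c0 n)) (exprn_gt0 _ (x0 n))).
Qed.

Let theta_cells n : theta n * cells n ^+ 2 = xs n ^+ 8.
Proof. by rewrite /theta /cells; field; rewrite !gt_eqF. Qed.

Lemma bad_step_le sg n k i : `|sg| = 1 -> measurable (bad_step sg n k i) /\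
  (P (bad_step sg n k i) <= (expR (4 - (xs n)^-1))%:E)%E.
Proof.
move=> sg1; split.
  exact: (measurable_tent_time_diff bm _ _ _ _ _ _ (node0 n k) (ltW (node_lt n k))).
apply: (tent_time_diff_tail bm _ _ (node0 n k) (node_lt n k) (c0 n) (ltW (theta0 n)) _ sg1).
by rewrite theta_cells exprn_ile1 ?x1// ltW.
Qed.

Let decay n := expR (4 - (2 * xs n)^-1).

Lemma bad_level_le n : measurable (bad_level n) /\
  (P (bad_level n) <= (22 * 8 ^+ n * decay n)%:E)%E.
Proof.
have d0 : 0 <= decay n by rewrite expR_ge0.
have ix : (2 * xs n)^-1 <= (xs n)^-1.
  by rewrite lef_pV2 ?posrE ?mulr_gt0// ler_peMl ?ler1n// ltW.
have inner k i : measurable (bad_cell n k i `|` (bad_step 1 n k i `|` bad_step (-1) n k i)) /\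
    (P (bad_cell n k i `|` (bad_step 1 n k i `|` bad_step (-1) n k i)) <= (3 * decay n)%:E)%E.
  have [m1 p1] := bad_cell_le n k i.
  have [m2 p2] := @bad_step_le 1 n k i (normr1 _).
  have [m3 p3] := @bad_step_le (-1) n k i (normrN1 _).
  split; first by apply: measurableU => //; exact: measurableU.
  apply: le_trans (measureU2 _ m1 (measurableU _ _ m2 m3)) _.
  apply: le_trans (leeD p1 (le_trans (measureU2 _ m2 m3) (leeD p2 p3))) _.
  rewrite -!EFinD lee_fin.
  have e1 : expR (2 - (2 * xs n)^-1) <= decay n by rewrite ler_expR; lra.
  have e2 : expR (4 - (xs n)^-1) <= decay n by rewrite ler_expR; lra.
  lra.
have outer k : measurable (bad_increment n k `|`
      \bigcup_(i in `I_((2 * (4 ^ n + 2)).+1))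
      (bad_cell n k i `|` (bad_step 1 n k i `|` bad_step (-1) n k i))) /\
    (P (bad_increment n k `|` \bigcup_(i in `I_((2 * (4 ^ n + 2)).+1))
      (bad_cell n k i `|` (bad_step 1 n k i `|` bad_step (-1) n k i))) <=
     (22 * 4 ^+ n * decay n)%:E)%E.
  have [m1 p1] := bad_increment_le n k.
  have [m2 p2] := bigcup_ltn_le (N := (2 * (4 ^ n + 2)).+1)
    (fun i _ => (inner k i).1) (fun i _ => (inner k i).2).
  split; first exact: measurableU.
  apply: le_trans (measureU2 _ m1 m2) _; apply: le_trans (leeD p1 p2) _.
  rewrite -EFinD lee_fin -(natr1 (2 * (4 ^ n + 2))%N) natrM natrD natrX.
  have e1 : expR (2 - (xs n)^-1) <= decay n by rewrite ler_expR; lra.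
  have n1 : 1 <= 4 ^+ n :> R by rewrite exprn_ege1// ler1n.
  have := ler_wpM2r d0 n1; lra.
have [m p] := bigcup_ltn_le (N := (2 ^ n)%N) (fun k _ => (outer k).1) (fun k _ => (outer k).2).
split; first exact: m.
apply: (le_trans p); rewrite lee_fin natrX le_eqVlt; apply/orP; left; apply/eqP.
by rewrite (_ : 8 = 2 * 4) ?exprMn; ring.
Qed.

(** The tail is smaller than any power of [xs n], which itself decays
    geometrically: this beats the number of events. *)
Lemma bad_level_summable : exists2 c, 0 <= c &
  forall n, (P (bad_level n) <= (c * 2 ^- n)%:E)%E.
Proof.
have [p Xp] : exists p, scale_base al ^+ p.+1 <= 16^-1.
  have : scale_base al ^+ p @[p --> \oo] --> 0.
    by apply: cvg_expr; rewrite ger0_norm ?scale_base_lt1// ltW// scale_base_gt0.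
  move=> /cvgrPdist_le/(_ 16^-1); rewrite invr_gt0 => /(_ (ltr0n _ _)).
  case=> p _ /(_ p.+1 (leqnSn p)); rewrite sub0r normrN ger0_norm; first by exists p.
  by rewrite exprn_ge0// ltW// scale_base_gt0.
exists (22 * (expR 4 * ((p.+1)`!%:R * 2 ^+ p.+1))).
  by rewrite !mulr_ge0 ?expR_ge0 ?exprn_ge0.
move=> n; have [_ h] := bad_level_le n; apply: (le_trans h); rewrite lee_fin.
have y0 : 0 <= (2 * xs n)^-1 by rewrite invr_ge0 mulr_ge0// ltW.
have F0 : 0 < (p.+1)`!%:R :> R by rewrite ltr0n fact_gt0.
have e1 : expR (- (2 * xs n)^-1) <= (p.+1)`!%:R * 2 ^+ p.+1 * 16 ^- n.
  have h1 := expR_ge1Dxn p y0.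
  have h2 : (2 * xs n)^-1 ^+ p.+1 / (p.+1)`!%:R <= expR (2 * xs n)^-1 by lra.
  have q0 : 0 < (2 * xs n)^-1 ^+ p.+1 / (p.+1)`!%:R.
    by rewrite divr_gt0// exprn_gt0// invr_gt0 mulr_gt0.
  rewrite expRN; apply: (@le_trans _ _ ((2 * xs n)^-1 ^+ p.+1 / (p.+1)`!%:R)^-1).
    by rewrite lef_pV2 ?posrE ?expR_gt0.
  rewrite invf_div exprVn invrK exprMn mulrA ler_wpM2l ?mulr_ge0 ?exprn_ge0 ?(ltW F0)//.
  rewrite /xs exprAC -exprVn; apply: lerXn2r => //; rewrite nnegrE ?invr_ge0//.
  by rewrite exprn_ge0// ltW// scale_base_gt0.
rewrite /decay expRD.
have E : (8 : R) ^+ n * 16 ^- n = 2 ^- n.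
  by rewrite -exprVn -exprMn -exprVn; congr (_ ^+ n); field.
rewrite -E.
have := ler_wpM2l (_ : 0 <= 22 * 8 ^+ n * expR 4) e1.
rewrite mulr_ge0 ?expR_ge0 ?mulr_ge0 ?exprn_ge0// => /(_ isT).
by lra.
Qed.

Lemma not_bad_level n w : ~ bad_level n w -> good_level al (fun t => W t w) n.
Proof.
move=> nb.
have inc k : (k < 2 ^ n)%N -> ~ bad_increment n k w.
  by move=> kn bk; apply: nb; exists k => //; left.
have idx (m : int) : `|m| <= (4 ^ n + 2)%:Z -> exists2 i,
    (i < (2 * (4 ^ n + 2)).+1)%N & center n i = m.
  move=> mM; exists (absz (m + (4 ^ n + 2)%:Z)); rewrite /center; lia.
have inn k (m : int) : (k < 2 ^ n)%N -> `|m| <= (4 ^ n + 2)%:Z -> exists2 i, center n i = m &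
    ~ (bad_cell n k i `|` (bad_step 1 n k i `|` bad_step (-1) n k i)) w.
  move=> kn /idx[i iN im]; exists i => // bi; apply: nb; exists k => //.
  by right; exists i.
have cellb k (m : int) : (k < 2 ^ n)%N -> `|m| <= (4 ^ n + 2)%:Z ->
    cell n k m w <= taus n * cells n / xs n.
  move=> kn mM; have [i im ni] := inn k m kn mM.
  have : ~ bad_cell n k i w by move=> b; apply: ni; left.
  rewrite /bad_cell/= im => /negP; rewrite -leNgt => /le_trans; apply.
  rewrite le_eqVlt; apply/orP; left; apply/eqP; field.
  by rewrite gt_eqF.
split.
- move=> k kn; have := inc k kn; rewrite /bad_increment/= => /negP.
  by rewrite -leNgt mulrC.
- move=> k m kn mM; apply: cellb => //; lia.
move=> k m kn mM.
have [|i im ni] := inn k m kn; first by lia.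
have ns sg : `|sg| = 1 -> sg = 1 \/ sg = -1 ->
    sg * (cell n k (m + 1) w - cell n k m w) <= 6 * taus n * cells n * xs n ^+ 7.
  move=> sg1 sgE; have : ~ bad_step sg n k i w.
    by case: sgE => -> b; apply: ni; right; [left|right].
  rewrite /bad_step/= im => /negP; rewrite -leNgt.
  have shift (j : int) c : c = (m + j)%:~R * cells n ->
      tent_time W (node n k) (node n k.+1) (cells n) c w = cell n k (m + j) w.
    by move=> ->.
  rewrite (shift (-1) (m%:~R * cells n - cells n)); last by rewrite intrD; ring.
  rewrite (shift 0 (m%:~R * cells n)); last by rewrite addr0.
  rewrite (shift 1 (m%:~R * cells n + cells n)); last by rewrite intrD; ring.
  rewrite (shift 2 (m%:~R * cells n + 2 * cells n)); last by rewrite intrD; ring.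
  rewrite addr0.
  have b1 : cell n k (m + -1) w <= taus n * cells n / xs n by apply: cellb => //; lia.
  have b2 : cell n k m w <= taus n * cells n / xs n by apply: cellb => //; lia.
  have b3 : cell n k (m + 1) w <= taus n * cells n / xs n by apply: cellb => //; lia.
  have b4 : cell n k (m + 2) w <= taus n * cells n / xs n by apply: cellb => //; lia.
  set t1 := cell n k (m + -1) w in b1 *; set t2 := cell n k m w in b2 *.
  set t3 := cell n k (m + 1) w in b3 *; set t4 := cell n k (m + 2) w in b4 *.
  move=> h.
  have b : t1 + t2 + t3 + t4 <= 4 * (taus n * cells n / xs n) by lra.
  have k0 : 0 <= (theta n * cells n) ^+ 2 / 2 by rewrite divr_ge0 ?sqr_ge0.
  have h' := le_trans h (lerD (lexx (xs n)^-1) (ler_wpM2l k0 b)).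
  have th2 : 0 < theta n / 2 by rewrite divr_gt0.
  rewrite -(ler_pM2l th2); apply: (le_trans h').
  rewrite le_eqVlt; apply/orP; left; apply/eqP.
  by rewrite /theta /cells; field; rewrite !gt_eqF.
rewrite ler_norml; apply/andP; split.
  by have := ns (-1) (normrN1 _) (or_intror erefl); rewrite mulN1r lerNl.
by have := ns 1 (normr1 _) (or_introl erefl); rewrite mul1r.
Qed.

End BadLevels.

(** * The local time of a good path *)

Section LocalTimeOfPath.
Context {R : realType}.
Variable al : R.
Hypotheses (al1 : 2^-1 < al) (al2 : al <= 1).
Implicit Types (w f g : R -> R).

Local Notation xs := (xs al).
Local Notation radii := (radii al).
Local Notation rate := (density_rate al).

Lemma dist_between (a b c d p q : R) : `|c - a| <= p -> `|d - b| <= p ->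
  `|c - d| <= q -> `|a - b| <= 2 * p + q.
Proof.
rewrite !ler_norml => /andP[? ?] /andP[? ?] /andP[? ?]; apply/andP; split; lra.
Qed.

Lemma compare_through (a b c d k p B : R) : 0 <= k -> c <= (1 + k) * d ->
  1 + d <= B -> `|d - b| <= p -> `|c - a| <= p -> a <= b + 2 * p + k * B.
Proof.
move=> k0 h /(ler_wpM2l k0); move: h; rewrite mulrDl mul1r mulrDr mulr1.
rewrite !ler_norml => ? ? /andP[? ?] /andP[? ?]; lra.
Qed.

Definition path_local_time w f t : R := limn (fun n => curve_density w f (radii n) t).

Variables (w : R -> R) (n0 : nat).
Hypotheses (cw : {within `[0, 1], continuous w})
  (gw : forall m, (n0 <= m)%N -> good_level al w m)
  (small : forall n, (n0 <= n)%N ->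
     xs n ^+ 4 <= 8^-1 /\ 14 <= (4 ^ n)%:R * xs n ^+ 17).

Lemma path_local_time_cvg f t : holder_path al f -> 0 <= t <= 1 ->
  curve_density w f (radii n) t @[n --> \oo] --> path_local_time w f t.
Proof.
move=> hf t01; apply: cauchy_cvg; apply/cauchy_exP => e e0.
have /cvgrPdist_lt/(_ e e0) [n1 _ hn] := density_rate_cvg al1 n0.
pose n := maxn n0 n1.
exists (curve_density w f (radii n) t), n => // m nm.
have h := density_cauchy al1 al2 cw gw small hf (leq_maxl n0 n1) (radii_gt0 al m)
  (nonincr_radii al1 al2 nm) t01.
rewrite /ball /= distrC; apply: le_lt_trans h _.
have := hn n (leq_maxr n0 n1); rewrite sub0r normrN ger0_norm//.
exact: density_rate_ge0.
Qed.

Lemma path_local_time_dist f n r t : holder_path al f -> (n0 <= n)%N ->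
  0 < r -> r <= radii n -> 0 <= t <= 1 ->
  `|curve_density w f r t - path_local_time w f t| <= 2 * rate n0 n.
Proof.
move=> hf n0n r0 rn t01.
have h1 := density_cauchy al1 al2 cw gw small hf n0n r0 rn t01.
have h2 : `|curve_density w f (radii n) t - path_local_time w f t| <= rate n0 n.
  have cv := path_local_time_cvg hf t01.
  have cv' : `|curve_density w f (radii n) t - curve_density w f (radii m) t|
      @[m --> \oo] --> `|curve_density w f (radii n) t - path_local_time w f t|.
    by apply: cvg_norm; apply: cvgB => //; exact: cvg_cst.
  apply: (cvgr_to_le cv'); near=> m.
  rewrite distrC; apply: density_cauchy => //; first exact: radii_gt0.
  by apply: nonincr_radii => //; near: m; exact: nbhs_infty_ge.
have := ler_distD (curve_density w f (radii n) t) (curve_density w f r t) (path_local_time w f t).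
lra.
Unshelve. all: by end_near.
Qed.

Lemma path_local_time_bounded f : holder_path al f ->
  path_local_time w f 1 <= density_bound al n0 + 2 * rate n0 n0.
Proof.
move=> hf; have t01 : 0 <= (1 : R) <= 1 by rewrite ler01 lexx.
have := path_local_time_dist hf (leqnn n0) (radii_gt0 al n0) (lexx _) t01.
have := density_bounded al1 al2 cw gw small hf (radii_gt0 al n0).
by rewrite ler_norml => h /andP[h1 h2]; lra.
Qed.

Lemma near_time_lip f r s t : holder_path al f -> 0 <= s -> s <= t -> t <= 1 ->
  0 <= near_time w f r 0 t - near_time w f r 0 s <= t - s.
Proof.
move=> hf s0 st t1.
have cf := holder_path_continuous al1 hf.
have bm := near_bounded_measurable r cw cf.
have bmt := bounded_measurableS (lexx 0) t1 bm.
have bms := bounded_measurableS s0 t1 bm.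
rewrite /near_time (itg_split s0 st bmt) addrAC subrr add0r.
rewrite itg_ge0/=; last by move=> u _; case: (_ < _).
rewrite -[leRHS]mul1r -itg_cst//; apply: le_itg => //; first exact: bounded_measurable_cst.
by move=> u _; case: (_ < _).
Qed.

(** A uniform limit of functions that are Lipschitz in time. *)
Lemma path_local_time_continuous_time f : holder_path al f ->
  {within `[0, 1], continuous (path_local_time w f)}.
Proof.
move=> hf; apply/within_continuous_epsP => s /=; rewrite in_itv/= => s01 e e0.
have e5 : 0 < e / 5 by rewrite divr_gt0.
have sum5 p : p < e / 5 -> 2 * (2 * p) + e / 5 < e by lra.
have /cvgrPdist_lt/(_ _ e5) [n1 _ hn] := density_rate_cvg al1 n0.
pose n := maxn n0 n1.
have rn : rate n0 n < e / 5.
  have := hn n (leq_maxr n0 n1); rewrite sub0r normrN ger0_norm//.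
  exact: density_rate_ge0.
pose r := radii n.
have r0 : 0 < r by exact: radii_gt0.
have r2 : 0 < 2 * r by exact: mulr_gt0 _ r0.
exists (2 * r * (e / 5)); first exact: mulr_gt0 r2 e5.
move=> t; rewrite /= in_itv/= => t01 st.
have d1 := path_local_time_dist hf (leq_maxl n0 n1) r0 (lexx _) s01.
have d2 := path_local_time_dist hf (leq_maxl n0 n1) r0 (lexx _) t01.
have d3 : `|curve_density w f r s - curve_density w f r t| <= e / 5.
  rewrite /curve_density -mulrBl normrM (@gtr0_norm _ (2 * r)^-1) ?invr_gt0//.
  rewrite ler_pdivrMr// mulrC; apply: le_trans (ltW st).
  have /andP[s0 s1] := s01; have /andP[t0 t1] := t01.
  have [h|h] := leP s t.
    have /andP[a1 a2] := near_time_lip r hf s0 h t1.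
    by rewrite distrC (distrC s) ger0_norm// ger0_norm ?subr_ge0.
  have /andP[a1 a2] := near_time_lip r hf t0 (ltW h) s1.
  by rewrite ger0_norm// ger0_norm// subr_ge0 ltW.
rewrite -/n -/r in d1 d2.
exact: le_lt_trans (dist_between d1 d2 d3) (sum5 _ rn).
Qed.

(** The tube of radius [r] around [f] is contained in the tube of radius [r + de]
    around [g]. *)
Lemma curve_density_shift f g r de : holder_path al f -> holder_path al g ->
  0 < r -> 0 <= de -> (forall s, 0 <= s <= 1 -> `|f s - g s| <= de) ->
  curve_density w f r 1 <= (1 + de / r) * curve_density w g (r + de) 1.
Proof.
move=> hf hg r0 de0 fg.
have -> : (1 + de / r) * curve_density w g (r + de) 1 = near_time w g (r + de) 0 1 / (2 * r).
  by rewrite /curve_density; field; rewrite gt_eqF// gt_eqF// ltr_wpDr.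
rewrite /curve_density ler_wpM2r ?invr_ge0 ?mulr_ge0 ?(ltW r0)//.
apply: le_itg.
- exact: (near_bounded_measurable _ cw (holder_path_continuous al1 hf)).
- exact: (near_bounded_measurable _ cw (holder_path_continuous al1 hg)).
move=> s s01; case: ltP => [h|_]; last by case: (_ < _).
rewrite (_ : `|w s - g s| < r + de = true)//.
have := ler_normD (w s - f s) (f s - g s); rewrite addrA subrK.
have := fg s s01; lra.
Qed.

(** The radius is halved so that the enlarged tube keeps a radius at which the
    density is close to its limit. *)
Lemma path_local_time_le f g n de : holder_path al f -> holder_path al g ->
  (n0 <= n)%N -> 0 <= de -> 2 * de <= radii n ->
  (forall s, 0 <= s <= 1 -> `|f s - g s| <= de) ->
  path_local_time w f 1 <= path_local_time w g 1 + 2 * (2 * rate n0 n) +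
    2 * de / radii n * density_bound al n0.
Proof.
move=> hf hg n0n de0 der fg; have t01 : 0 <= (1 : R) <= 1 by rewrite ler01 lexx.
have R0 := radii_gt0 al n.
have r0 : 0 < radii n / 2 by rewrite divr_gt0.
have rr : radii n / 2 <= radii n by lra.
have rd0 : 0 < radii n / 2 + de by lra.
have rdr : radii n / 2 + de <= radii n by lra.
have := path_local_time_dist hf n0n r0 rr t01.
have := path_local_time_dist hg n0n rd0 rdr t01.
have h := curve_density_shift hf hg r0 de0 fg.
have hb := density_bounded al1 al2 cw gw small hg rd0.
rewrite (_ : de / (radii n / 2) = 2 * de / radii n) in h; last by field; rewrite gt_eqF.
have k0 : 0 <= 2 * de / radii n := divr_ge0 (mulr_ge0 (ler0n _ 2) de0) (ltW R0).
exact: (compare_through k0 h hb).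
Qed.

Lemma path_local_time_continuous_curve f e : holder_path al f -> 0 < e ->
  exists2 de, 0 < de & forall g, holder_path al g ->
    (forall s, 0 <= s <= 1 -> `|f s - g s| <= de) ->
    `|path_local_time w f 1 - path_local_time w g 1| <= e.
Proof.
move=> hf e0; have e8 : 0 < e / 8 by rewrite divr_gt0.
have /cvgrPdist_lt/(_ _ e8) [n1 _ hn] := density_rate_cvg al1 n0.
pose n := maxn n0 n1.
have n0n : (n0 <= n)%N by exact: leq_maxl.
have rn : rate n0 n < e / 8.
  have := hn n (leq_maxr n0 n1); rewrite sub0r normrN ger0_norm//.
  exact: density_rate_ge0.
have R0 := radii_gt0 al n.
have B1 := density_bound_ge1 al1 n0.
set B := density_bound al n0 in B1.
have B0 : 0 < B by lra.
pose de := Num.min (radii n / 2) (radii n * e / (4 * B)).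
have re0 : 0 < radii n * e := mulr_gt0 R0 e0.
have B40 : 0 < 4 * B := mulr_gt0 (ltr0n _ 4) B0.
have de0 : 0 < de by rewrite lt_min (divr_gt0 R0 (ltr0n _ 2)) (divr_gt0 re0 B40).
have de1 : 2 * de <= radii n.
  have : de <= radii n / 2 by rewrite ge_min lexx.
  by rewrite (ler_pdivlMr _ _ (ltr0n _ 2)) mulrC.
have de2 : 2 * de / radii n * B <= e / 2.
  have : de <= radii n * e / (4 * B) by rewrite ge_min lexx orbT.
  rewrite (ler_pdivlMr _ _ B40) => h.
  by rewrite mulrAC (ler_pdivrMr _ _ R0); move: h; rewrite [radii n * e]mulrC [e * _]mulrC => h; lra.
exists de => // g hg fg.
have gf s : 0 <= s <= 1 -> `|g s - f s| <= de by move=> /fg; rewrite distrC.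
have h1 := path_local_time_le hf hg n0n (ltW de0) de1 fg.
have h2 := path_local_time_le hg hf n0n (ltW de0) de1 gf.
rewrite -/B in h1 h2.
by rewrite ler_norml; apply/andP; split; lra.
Qed.

End LocalTimeOfPath.

(** * Measurability of the occupation density *)

Section MeasurableDensity.
Context {R : realType} {d : measure_display} {T : measurableType d}.
Implicit Types (f : R -> R) (r t y : R).

Lemma itg_cvg (a b M : R) (F : nat -> R -> R) (G : R -> R) :
  (forall n, bounded_measurable a b (F n)) -> bounded_measurable a b G ->
  (forall n s, a <= s <= b -> `|F n s| <= M) ->
  (forall s, a <= s <= b -> F n s @[n --> \oo] --> G s) ->
  itg a b (F n) @[n --> \oo] --> itg a b G.
Proof.
move=> bF bG FM FG.
have iG := bounded_measurable_integrable bG.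
have [|||||_ _ h] := @dominated_convergence _ _ R lebesgue_measure `[a, b]
    (measurable_itv _) (fun n s => (F n s)%:E) (fun s => (G s)%:E) (fun=> M%:E).
- by move=> n; apply/measurable_EFinP; have [] := bF n.
- by apply/measurable_EFinP; have [] := bG.
- by apply: aeW => s /=; rewrite in_itv/= => /FG h; apply/fine_cvgP; split; [exact: nearW|exact: h].
- by apply: (bounded_measurable_integrable (bounded_measurable_cst a b M)).
- by apply: aeW => s n /=; rewrite in_itv/= => sab; rewrite lee_fin; exact: FM.
rewrite /itg /Rintegral.
have fG : (\int[lebesgue_measure]_(s in `[a, b]) (G s)%:E)%E \is a fin_num.
  exact: integrable_fin_num.
by apply/fine_cvg; rewrite fineK.
Qed.

(** A continuous approximation of the indicator of [`|y| < r]. *)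
Definition trapezoid (n : nat) r y : R := Num.min 1 (n%:R * Num.max 0 (r - `|y|)).

Lemma continuous_trapezoid n r : continuous (trapezoid n r).
Proof.
have c0 (z : R) : continuous (fun _ : R => z) by move=> y; exact: cvg_cst.
have c1 : continuous (fun y : R => r - `|y|).
  by move=> y; apply: cvgB; [exact: cvg_cst|exact: norm_continuous].
move=> y; apply: (@continuous_min _ _ (fun=> 1)
  (fun y => n%:R * Num.max 0 (r - `|y|)) y (c0 1 y)).
apply: cvgM; first exact: cvg_cst.
exact: (@continuous_max _ _ (fun=> 0) (fun y => r - `|y|) y (c0 0 y) (c1 y)).
Qed.

Lemma trapezoid_bound n r y : `|trapezoid n r y| <= 1.
Proof.
have h : 0 <= trapezoid n r y by rewrite le_min ler01 mulr_ge0// le_max lexx.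
by rewrite ger0_norm// ge_min lexx.
Qed.

Lemma trapezoid_cvg r y : trapezoid n r y @[n --> \oo] --> ((`|y| < r)%R%:R : R).
Proof.
have [yr|yr] := ltP `|y| r; last first.
  rewrite (_ : (fun n => trapezoid n r y) = fun=> 0); first exact: cvg_cst.
  apply/funext => n; rewrite /trapezoid max_l ?subr_le0// mulr0.
  by rewrite min_r.
apply: cvg_near_cst; near=> n.
rewrite /trapezoid max_r ?subr_ge0 ?ltW// min_l//.
rewrite -ler_pdivrMr ?subr_gt0// mul1r ltW//.
by near: n; exact: nbhs_infty_gtr.
Unshelve. all: by end_near.
Qed.

(** Integrals of continuous paths are limits of Riemann sums, hence measurable; the
    indicator of the tube is a bounded limit of continuous functions. *)
Lemma measurable_curve_density (Y : R -> T -> R) f r t : 0 <= t ->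
  (forall s, measurable_fun setT (Y s)) ->
  (forall w, {within `[0, t], continuous (fun s => Y s w)}) ->
  {within `[0, t], continuous f} ->
  measurable_fun setT (fun w => curve_density (fun s => Y s w) f r t).
Proof.
move=> t0 mY cY cf; apply: measurable_funM => //.
pose Z n s w := trapezoid n r (Y s w - f s).
have cZ n w : {within `[0, t], continuous (fun s => Z n s w)}.
  apply: (within_continuous_comp_real (@continuous_trapezoid n r)).
  by move=> s; apply: cvgB; [exact: cY|exact: cf].
apply: (measurable_fun_cvg (h := fun n w => itg 0 t (fun s => Z n s w))).
  move=> n; apply: measurable_itg_path => // s.
  apply: (measurableT_comp (f := @trapezoid n r)); last by apply: measurable_funB.
  by apply: continuous_measurable_fun; exact: continuous_trapezoid.
move=> w _; apply: (itg_cvg (M := 1)).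
- by move=> n; apply: continuous_bounded_measurable; exact: cZ.
- by apply: near_bounded_measurable; [exact: cY|exact: cf].
- by move=> n s _; exact: trapezoid_bound.
by move=> s _; exact: trapezoid_cvg.
Qed.

Lemma occupation_densityE (W : R -> T -> R) f t r w :
  occupation_density W f t r w = curve_density (fun s => W s w) f r t.
Proof.
rewrite /occupation_density /curve_density /near_time mulrC; congr (_ * _).
rewrite /itg; congr Rintegral; apply/funext => s.
by rewrite indicE mem_setE in_itv/= -ltr_distl.
Qed.

End MeasurableDensity.

(** * The local time as a random variable *)

Section LocalTime.
Context {R : realType} {d : measure_display} {T : measurableType d}.
Context {P : probability T R} {W : R -> {RV P >-> R}}.
Hypothesis bm : brownian_motion W.
Variable al : R.
Hypotheses (al1 : 2^-1 < al) (al2 : al <= 1).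

Definition bad_tail (N : nat) : set T := \bigcup_i bad_level W al (N + i).

Lemma measurable_bad_tail N : measurable (bad_tail N).
Proof. by apply: bigcup_measurable => i _; have [] := bad_level_le bm al1 (N + i). Qed.

(** Borel-Cantelli: the probabilities of the bad levels are summable. *)
Lemma bad_tail_le : exists2 c : R, 0 <= c &
  forall N, (P (bad_tail N) <= (c / 2 ^+ N)%:E)%E.
Proof.
have [c c0 hc] := bad_level_summable bm al1.
exists (2 * c); first exact: mulr_ge0.
move=> N; have mb i : measurable (bad_level W al (N + i)).
  by have [] := bad_level_le bm al1 (N + i).
apply: le_trans (generalized_Boole_inequality P mb (measurable_bad_tail N)) _.
have k0 : 0 <= 2 * c / 2 ^+ N by rewrite divr_ge0 ?exprn_ge0 ?mulr_ge0.
apply: le_trans _ (epsilon_trick0 xpredT k0).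
apply: lee_nneseries => // i _; apply: le_trans (hc _) _.
rewrite lee_fin le_eqVlt; apply/orP; left; apply/eqP.
by rewrite natrX exprS exprD; field; rewrite !expf_neq0.
Qed.

Lemma bad_tail_small (e : R) : 0 < e -> exists N, (P (bad_tail N) <= e%:E)%E.
Proof.
move=> e0; have [c c0 hc] := bad_tail_le.
have : c / 2 ^+ N @[N --> \oo] --> 0.
  rewrite -[0](mulr0 c); apply: cvgM; first exact: cvg_cst.
  rewrite (_ : (fun N => _) = (fun N => 2^-1 ^+ N)); last first.
    by apply/funext => N; rewrite exprVn.
  by apply: cvg_expr; rewrite ger0_norm ?invr_ge0// invf_lt1 ?ltr1n.
move=> /cvgrPdist_lt/(_ e e0) [N _ /(_ N (leqnn N)) h]; exists N.
apply: le_trans (hc N) _; rewrite lee_fin; apply: ltW.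
by apply: le_lt_trans h; rewrite sub0r normrN ler_norm.
Qed.

Definition good_event : set T := \bigcup_N ~` bad_tail N.

Lemma measurable_good_event : measurable good_event.
Proof. by apply: bigcup_measurable => N _; exact/measurableC/measurable_bad_tail. Qed.

Lemma negligible_not_good : P.-negligible (~` good_event).
Proof.
exists (~` good_event); split => //; first exact/measurableC/measurable_good_event.
apply/eqP; rewrite eq_le measure_ge0 andbT; apply/lee_addgt0Pr => e e0.
have [N hN] := bad_tail_small e0; rewrite add0e; apply: le_trans hN.
apply: le_measure; rewrite ?inE.
- exact/measurableC/measurable_good_event.
- exact: measurable_bad_tail.
by move=> w; apply: contra_notP => nb; exists N.
Qed.

Lemma bm_continuous01 w : {within `[0, 1], continuous (fun t => W t w)}.
Proof. exact: (bm_continuous_itv bm). Qed.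

Lemma good_eventP w : good_event w -> exists n0,
  (forall m, (n0 <= m)%N -> good_level al (fun t => W t w) m) /\
  (forall n, (n0 <= n)%N -> xs al n ^+ 4 <= 8^-1 /\ 14 <= (4 ^ n)%:R * xs al n ^+ 17).
Proof.
move=> [N _ hN]; have [N1 h1] := scales_small al1 al2.
exists (maxn N N1); split=> m; rewrite geq_max => /andP[Nm N1m]; last exact: h1.
apply: (not_bad_level (P := P) al1 al2) => b; apply: hN.
by exists (m - N)%N => //; rewrite subnKC.
Qed.

(** Off the good event the limit need not exist; the value zero there makes every
    path continuous in time. *)
Definition local_time (f : R -> R) (t : R) (w : T) : R :=
  if `[< holder_path al f /\ 0 <= t <= 1 >]
  then path_local_time al (fun s => W s w) f t * \1_good_event w else 0.

Lemma local_timeE f t w : holder_path al f -> 0 <= t <= 1 -> good_event w ->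
  local_time f t w = path_local_time al (fun s => W s w) f t.
Proof.
move=> hf t01 gw; rewrite /local_time asboolT//.
by rewrite indicE mem_set// mulr1.
Qed.

Lemma local_time0 f t w : ~ good_event w -> local_time f t w = 0.
Proof.
by move=> gw; rewrite /local_time; case: ifP => // _; rewrite indicE memNset// mulr0.
Qed.

Lemma measurable_density f r t : holder_path al f -> 0 <= t <= 1 ->
  measurable_fun setT (fun w => curve_density (fun s => W s w) f r t).
Proof.
move=> hf /andP[t0 t1]; apply: measurable_curve_density => //.
  by move=> w; exact: (bm_continuous_itv bm).
apply: continuous_subspaceW (holder_path_continuous al1 hf) => s /=.
by rewrite !in_itv/= => /andP[-> /le_trans ->].
Qed.

Lemma measurable_occupation_density f r t : holder_path al f -> 0 <= t <= 1 ->
  measurable_fun setT (occupation_density (fun s => W s : T -> R) f t r).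
Proof.
move=> hf t01; rewrite (_ : occupation_density _ _ _ _ =
  fun w => curve_density (fun s => W s w) f r t); first exact: measurable_density.
by apply/funext => w; rewrite occupation_densityE.
Qed.

Lemma measurable_local_time f t : measurable_fun setT (local_time f t).
Proof.
have [[hf t01]|h] := pselect (holder_path al f /\ 0 <= t <= 1); last first.
  rewrite (_ : local_time f t = fun=> 0); first exact: measurable_cst.
  by apply/funext => w; rewrite /local_time asboolF.
apply: (measurable_fun_cvg (h := fun n w =>
    curve_density (fun s => W s w) f (radii al n) t * \1_good_event w)).
  move=> n; apply: measurable_funM; first exact: measurable_density.
  exact/measurable_indicP/measurable_good_event.
move=> w _; have [gw|gw] := pselect (good_event w); last first.
  rewrite local_time0//.
  rewrite (_ : (fun n => _) = fun=> 0); first exact: cvg_cst.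
  by apply/funext => n; rewrite indicE memNset// mulr0.
rewrite local_timeE//.
rewrite (_ : (fun n => _) = fun n => curve_density (fun s => W s w) f (radii al n) t); last first.
  by apply/funext => n; rewrite indicE mem_set// mulr1.
have [n0 [g0 s0]] := good_eventP gw.
exact: (path_local_time_cvg al1 al2 (@bm_continuous01 w) g0 s0).
Qed.

(** Outside [bad_tail N], an event of small probability, the densities converge at
    a rate that does not depend on the path. *)
Lemma local_time_cvg_probability f t : holder_path al f -> 0 <= t <= 1 ->
  cvg_in_probability P 0^'+ (occupation_density (fun s => W s : T -> R) f t) (local_time f t).
Proof.
move=> hf t01 eta eta0.
have mA r : measurable
    [set w | eta < `|occupation_density (fun s => W s : T -> R) f t r w - local_time f t w|].
  apply: measurable_gt; apply: measurableT_comp => //; apply: measurable_funB.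
    exact: measurable_occupation_density.
  exact: measurable_local_time.
apply/fine_cvgP; split.
  by apply: nearW => r; exact: fin_num_measure.
apply/cvgrPdist_le => e e0.
have [N hN] := bad_tail_small e0; have [N1 h1] := scales_small al1 al2.
pose N2 := maxn N N1.
have eta2 : 0 < eta / 2 by rewrite divr_gt0.
have /cvgrPdist_lt/(_ _ eta2) [n1 _ hn] := density_rate_cvg al1 N2.
pose n := maxn N2 n1.
have rn : density_rate al N2 n < eta / 2.
  have := hn n (leq_maxr N2 n1); rewrite sub0r normrN ger0_norm//.
  exact: density_rate_ge0.
near=> r.
have r0 : 0 < r by near: r; exact: nbhs_right_gt.
have rr : r <= radii al n by near: r; apply: nbhs_right_le; exact: radii_gt0.
rewrite sub0r normrN ger0_norm ?fine_ge0// -lee_fin fineK; last exact: fin_num_measure.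
apply: le_trans _ hN; apply: le_measure; rewrite ?inE//; first exact: measurable_bad_tail.
move=> w /=; rewrite occupation_densityE; apply: contraPP => nb; apply/negP; rewrite -leNgt.
have g0 m : (N2 <= m)%N -> good_level al (fun t => W t w) m.
  rewrite geq_max => /andP[Nm _].
  apply: (not_bad_level (P := P) al1 al2) => b; apply: nb.
  by exists (m - N)%N => //; rewrite subnKC.
have s0 m : (N2 <= m)%N -> xs al m ^+ 4 <= 8^-1 /\ 14 <= (4 ^ m)%:R * xs al m ^+ 17.
  by rewrite geq_max => /andP[_]; exact: h1.
rewrite local_timeE//; last by exists N.
have := path_local_time_dist al1 al2 (@bm_continuous01 w) g0 s0 hf (leq_maxl N2 n1) r0 rr t01.
move=> /le_trans; apply.
by move: rn; rewrite ltr_pdivlMr// mulrC => /ltW.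
Unshelve. all: by end_near.
Qed.

Lemma local_time_continuous f w : holder_path al f ->
  {within `[0, 1], continuous (fun t => local_time f t w)}.
Proof.
move=> hf; have [gw|gw] := pselect (good_event w); last first.
  rewrite (_ : (fun t => _) = fun=> 0); first by move=> t; exact: cvg_cst.
  by apply/funext => t; rewrite local_time0.
have [n0 [g0 s0]] := good_eventP gw.
have /within_continuous_epsP h :=
  path_local_time_continuous_time al1 al2 (@bm_continuous01 w) g0 s0 hf.
apply/within_continuous_epsP => t t01 e e0.
have [de de0 hde] := h t t01 e e0; exists de => // s s01 ts.
have := hde s s01 ts; move: t01 s01; rewrite /= !in_itv/= => t01 s01.
by rewrite !local_timeE.
Qed.

End LocalTime.

(** * Uniqueness of the local time *)

Section Uniqueness.
Context {R : realType} {d : measure_display} {T : measurableType d}.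
Variable P : probability T R.

(** If [Y] and [Z] are [2 * h] apart, then [X i] is [h] apart from one of them. *)
Lemma cvg_in_probability_unique (I : Type) (F : set_system I)
    {FF : ProperFilter F} (X : I -> T -> R) (Y Z : T -> R) :
  (forall i, measurable_fun setT (X i)) ->
  measurable_fun setT Y -> measurable_fun setT Z ->
  cvg_in_probability P F X Y -> cvg_in_probability P F X Z ->
  P.-negligible [set w | Y w <> Z w].
Proof.
move=> mX mY mZ XY XZ.
have mgt (A B : T -> R) (h : R) : measurable_fun setT A -> measurable_fun setT B ->
    measurable [set w | h < `|A w - B w|].
  move=> mA mB; apply: measurable_gt.
  by apply: measurableT_comp => //; exact: measurable_funB.
have small (A : T -> R) (h e : R) : measurable_fun setT A ->
    cvg_in_probability P F X A -> 0 < h -> 0 < e ->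
    \forall i \near F, (P [set w | (h < `|X i w - A w|)%R] <= e%:E)%E.
  move=> mA XA h0 e0.
  have /fine_cvgP[_ /cvgrPdist_le/(_ e e0)] := XA h h0.
  apply: filterS => i; rewrite sub0r normrN ger0_norm ?fine_ge0//.
  by rewrite -lee_fin fineK//; apply: fin_num_measure; exact: mgt.
have null (h : R) : 0 < h -> P.-negligible [set w | 2 * h < `|Y w - Z w|].
  move=> h0; exists [set w | 2 * h < `|Y w - Z w|]; split => //; first exact: mgt.
  apply/eqP; rewrite eq_le measure_ge0 andbT; apply/lee_addgt0Pr => e e0.
  have e2 : 0 < e / 2 by rewrite divr_gt0.
  have [i [h1 h2]] := filter_ex (filterI (small Y h _ mY XY h0 e2) (small Z h _ mZ XZ h0 e2)).
  rewrite add0e (splitr e) EFinD.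
  apply: le_trans (leeD h1 h2); apply: le_trans (measureU2 _ _ _); try exact: mgt.
  apply: le_measure; rewrite ?inE; first exact: mgt.
    by apply: measurableU; exact: mgt.
  move=> w /= hw; have [k1|k1] := ltP h `|X i w - Y w|; [by left|right].
  rewrite ltNge; apply/negP => k2; have := ler_distD (X i w) (Y w) (Z w).
  by rewrite (distrC (Y w) (X i w)); lra.
apply: (negligibleS (A := \bigcup_n [set w | 2 * (n.+1%:R^-1) < `|Y w - Z w|])).
  move=> w /= /eqP; rewrite -subr_eq0 -normr_gt0 => yz.
  have yz2 : 0 < `|Y w - Z w| / 2 by rewrite divr_gt0.
  have [n hn] := ltr_add_invr yz2; exists n => //=.
  by move: hn; rewrite add0r ltr_pdivlMr// mulrC.
by apply: negligible_bigcup => n; exact: null.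
Qed.

End Uniqueness.

Lemma within_continuous_eq_grid {R : realType} (f g : R -> R) :
  {within `[0, 1], continuous f} -> {within `[0, 1], continuous g} ->
  (forall n k, (k <= n.+1)%N -> f (k%:R / n.+1%:R) = g (k%:R / n.+1%:R)) ->
  forall t, 0 <= t <= 1 -> f t = g t.
Proof.
move=> /within_continuous_epsP cf /within_continuous_epsP cg fg t t01.
have t01' : `[0, 1]%classic t by rewrite /= in_itv.
apply/eqP; rewrite -subr_eq0 -normr_le0; apply/ler_addgt0Pr => e e0; rewrite add0r.
have e2 : 0 < e / 2 by rewrite divr_gt0.
have [d1 d10 h1] := cf t t01' _ e2; have [d2 d20 h2] := cg t t01' _ e2.
have d0 : 0 < Num.min d1 d2 by rewrite lt_min d10.
have [n hn] := ltr_add_invr d0; rewrite add0r in hn.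
have /andP[t0 t1] := t01.
have N0 : 0 < n.+1%:R :> R by [].
pose k := Num.truncn (t * n.+1%:R).
have /andP[k1 k2] := truncn_itv (mulr_ge0 t0 (ltW N0)).
have kn : (k <= n.+1)%N by rewrite -(ler_nat R) (le_trans k1)// ler_piMl// ltW.
pose q : R := k%:R / n.+1%:R.
have q01 : `[0, 1]%classic q.
  by rewrite /= in_itv/= /q divr_ge0//= ler_pdivrMr// mul1r ler_nat.
have tq : `|t - q| < Num.min d1 d2.
  apply: le_lt_trans hn; rewrite ger0_norm ?subr_ge0; last by rewrite ler_pdivrMr.
  rewrite lerBlDl -[X in _ <= _ + X]mul1r -mulrDl ler_pdivlMr// (natr1 k) ltW//.
have := h1 q q01; have := h2 q q01; rewrite -(fg n k kn).
move: tq; rewrite lt_min => /andP[tq1 tq2] /(_ tq2) k3 /(_ tq1) k4.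
have := ler_distD (f q) (f t) (g t); rewrite (distrC (f q) (g t)); lra.
Qed.

Section TheLocalTime.
Context {R : realType} {d : measure_display} {T : measurableType d}.
Context {P : probability T R} {W : R -> {RV P >-> R}}.
Hypothesis bm : brownian_motion W.
Variable al : R.
Hypotheses (al1 : 2^-1 < al) (al2 : al <= 1).

Definition local_time_rv f t : {RV P >-> R} :=
  HB.pack_for {mfun T >-> R} (local_time (W := W) al f t)
    (isMeasurableFun.Build _ _ _ _ _ (measurable_local_time bm al1 al2 f t)).

Lemma local_time_rvE f t w : local_time_rv f t w = local_time (W := W) al f t w.
Proof. by []. Qed.

Lemma local_time_rv_is_local_time f : holder_path al f ->
  is_local_time W f (local_time_rv f).
Proof.
move=> hf; split; last by move=> w; exact: local_time_continuous.
by move=> t; rewrite in_itv/= => t01; exact: local_time_cvg_probability.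
Qed.

(** Both processes agree almost surely at each rational time, hence at all rational
    times at once, and continuity does the rest. *)
Lemma local_time_unique f (L : R -> {RV P >-> R}) : holder_path al f ->
  is_local_time W f L ->
  {ae P, forall w, forall t, t \in `[0, 1] -> local_time_rv f t w = L t w}.
Proof.
move=> hf [Lcv Lcont]; have [Kcv Kcont] := local_time_rv_is_local_time hf.
pose q n k : R := k%:R / n.+1%:R.
have q01 n k : (k <= n.+1)%N -> 0 <= q n k <= 1.
  by move=> kn; rewrite /q divr_ge0//= ler_pdivrMr// mul1r ler_nat.
have null n k : P.-negligible
    [set w | (k <= n.+1)%N /\ local_time_rv f (q n k) w <> L (q n k) w].
  have [kn|kn] := boolP (k <= n.+1)%N; last first.
    by apply: negligibleS (negligible_set0 P) => w [].
  apply: (negligibleS (A := [set w | local_time_rv f (q n k) w <> L (q n k) w])).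
    by move=> w [].
  have qk : q n k \in `[0, 1] by rewrite in_itv/= q01.
  apply: (cvg_in_probability_unique (F := 0^'+) _ _ _ (Kcv _ qk) (Lcv _ qk)).
  - move=> r; apply: measurable_occupation_density; [exact: bm|exact: al1|exact: hf|exact: q01].
  - exact: measurable_funP.
  - exact: measurable_funP.
apply: (negligibleS (A := \bigcup_n \bigcup_k
    [set w | (k <= n.+1)%N /\ local_time_rv f (q n k) w <> L (q n k) w])); last first.
  by apply: negligible_bigcup => n; exact: negligible_bigcup.
move=> w; apply: contra_notP => nw t; rewrite in_itv/= => t01.
apply: (within_continuous_eq_grid (Kcont w) (Lcont w)) => // n k kn.
by apply: contrapT => neq; apply: nw; exists n => //; exists k.
Qed.

End TheLocalTime.

Theorem theorem1p1 (R : realType) (d : measure_display) (T : measurableType d)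
    (P : probability T R) (W : R -> {RV P >-> R}) (alpha : R) :
  brownian_motion W -> 2^-1 < alpha -> alpha <= 1 ->
  exists Lt : {uniform` (`[0, 1] : set R) -> R} -> R -> {RV P >-> R},
  [/\ forall f, holder_class alpha f ->
        (exists L : R -> {RV P >-> R}, is_local_time W f L) /\
        (forall L : R -> {RV P >-> R}, is_local_time W f L ->
           {ae P, forall w, forall t, t \in `[0, 1] -> Lt f t w = L t w}),
      {ae P, forall w,
        {within holder_class alpha, continuous (fun f => Lt f 1 w)}} &
      {ae P, forall w,
        (ereal_sup [set (Lt f 1 w)%:E | f in holder_class alpha] < +oo)%E}].
Proof.
move=> bm al1 al2.
have hc (f : R -> R) : holder_class alpha f -> holder_path alpha f.
  move=> [f1 f2]; split=> [t t01|s t s01 t01]; first by apply: f1; rewrite in_itv.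
  by apply: f2; rewrite in_itv.
have one01 : 0 <= (1 : R) <= 1 by rewrite ler01 lexx.
exists (local_time_rv bm al1 al2); split.
- move=> f /hc hf; split; last by move=> L; exact: local_time_unique.
  by exists (local_time_rv bm al1 al2 f); exact: local_time_rv_is_local_time.
- apply: (negligibleS _ (negligible_not_good bm al1)) => w.
  apply: contra_not => gw; have [n0 [g0 s0]] := good_eventP al1 al2 gw.
  apply/subspace_continuousP => f /hc hf; apply/cvgrPdist_le => e e0.
  have [de de0 hde] := path_local_time_continuous_curve al1 al2
    (@bm_continuous01 _ _ _ _ _ bm w) g0 s0 hf e0.
  rewrite near_withinE; apply/uniform_nbhs.
  exists [set xy | ball xy.1 de xy.2]; split; first exact: (@entourage_ball _ _ (PosNum de0)).
  move=> g /= fg /hc hg; rewrite /from_subspace !local_timeE//.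
  apply: hde => // s s01; apply: ltW.
  by have := fg s; rewrite in_itv/=; apply.
- apply: (negligibleS _ (negligible_not_good bm al1)) => w.
  apply: contra_not => gw; have [n0 [g0 s0]] := good_eventP al1 al2 gw.
  apply: le_lt_trans (ltry (density_bound alpha n0 + 2 * density_rate alpha n0 n0)).
  apply: ge_ereal_sup => _ [f /hc hf <-]; rewrite local_time_rvE local_timeE// lee_fin.
  exact: (path_local_time_bounded al1 al2 (@bm_continuous01 _ _ _ _ _ bm w) g0 s0 hf).
Qed.
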